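(* Let $Q:\mathbb S^2\to[0,\infty]$ be an external field on $\mathbb S^2$ that is rotationally invariant about the polar axis $x_3$. Suppose that the support $S_Q$ of the extremal measure $\mu_Q$ is a spherical cap $C_{S,\alpha}$ centered at the South Pole, $0<\alpha\le\pi$, and that $Q\in C^2(N)$, where $N$ is an open neighborhood of $S_Q=C_{S,\alpha}$ on the sphere $\mathbb S^2$. Then $\mu_Q$ is absolutely continuous with respect to the Lebesgue surface measure, with a locally bounded density; that is, $d\mu_Q=f(\varphi)\,\sin\varphi\,d\theta\,d\varphi$, where $f\in L^\infty([\alpha,\pi])$.
   Context: $\mathbb S^2=\{x\in\mathbb R^3:|x|=1\}$, with $|\cdot|$ the Euclidean norm. Spherical coordinates are $(r,\theta,\varphi)$ with $0\le\varphi\le\pi$ the polar angle measured from the positive $x_3$-axis (so $x_3=r\cos\varphi$) and $0\le\theta\le2\pi$ the azimuthal angle. For $0<\alpha\le\pi$, $C_{S,\alpha}=\{(r,\theta,\varphi): r=1,\ \alpha\le\varphi\le\pi,\ 0\le\theta\le2\pi\}$. An external field on $\mathbb S^2$ is a non-negative lower semicontinuous function $Q:\mathbb S^2\to[0,\infty]$ that is finite on a set of positive Lebesgue surface measure. It is rotationally invariant about the polar axis if $Q(x)$ depends only on $x_3$ (equivalently only on $\varphi$). For a unit positive Borel measure $\mu$ on $\mathbb S^2$ put $I(\mu)=\iint\frac{1}{|x-y|}\,d\mu(x)\,d\mu(y)$ and $I_Q(\mu)=I(\mu)+2\int Q\,d\mu$. Let $V_Q$ be the infimum of $I_Q(\mu)$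 over all unit positive Borel measures $\mu$ on $\mathbb S^2$. The extremal (equilibrium) measure $\mu_Q$ is the unit positive Borel measure on $\mathbb S^2$ with $I_Q(\mu_Q)=V_Q$, and $S_Q=\operatorname{supp}\mu_Q$. *)

(* Defs.v *)
From HB Require Import structures.
From mathcomp Require Import all_boot all_order all_algebra.
From mathcomp Require Import all_classical all_reals all_analysis.

Set Implicit Arguments.
Unset Strict Implicit.
Unset Printing Implicit Defensive.

Import Order.TTheory GRing.Theory Num.Theory.
Import numFieldNormedType.Exports.

Local Open Scope classical_set_scope.
Local Open Scope ring_scope.

(* R^3, with the product topology and the product sigma-algebra (which is the
   Borel sigma-algebra).  The library norm on this product type is the sup
   norm, hence the explicit Euclidean norm below. *)
Definition enorm3 (R : realType) (x : R * R * R) : R :=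
  Num.sqrt (x.1.1 ^+ 2 + x.1.2 ^+ 2 + x.2 ^+ 2).

Definition sphere (R : realType) : set (R * R * R) := [set x | enorm3 x = 1].

Definition spherical (R : realType) (r theta phi : R) : R * R * R :=
  (r * sin phi * cos theta, r * sin phi * sin theta, r * cos phi).

Definition south_cap (R : realType) (alpha : R) : set (R * R * R) :=
  [set x | exists theta phi : R,
    [/\ 0 <= theta <= 2 * pi, alpha <= phi <= pi & x = spherical 1 theta phi]].

(* The area element of the unit sphere is sin phi dtheta dphi. *)
Definition surface_measure (R : realType) (A : set (R * R * R)) : \bar R :=
  (\int[lebesgue_measure]_(phi in `[0%R, pi])
     \int[lebesgue_measure]_(theta in `[0%R, (2 * pi)%R])
       (\1_A (spherical 1 theta phi) * sin phi)%:E)%E.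

(* An external field is a function on the sphere; it is encoded as a function
   on R^3 whose values off the sphere are irrelevant.  Accordingly lower
   semicontinuity refers to the subspace topology. *)
Definition external_field (R : realType) (Q : R * R * R -> \bar R) : Prop :=
  [/\ forall x, sphere x -> (0 <= Q x)%E,
      lower_semicontinuous (Q : subspace (@sphere R) -> \bar R) &
      (0 < surface_measure (sphere (R := R) `&` [set x | (Q x < +oo)%E]))%E].

Definition rotationally_invariant (R : realType) (Q : R * R * R -> \bar R) :
    Prop :=
  forall x y, sphere x -> sphere y -> x.2 = y.2 -> Q x = Q y.

(* Unit Borel measures on the sphere are the Borel probability measures on R^3
   carried by the sphere. *)
Definition unit_measure (R : realType) (mu : probability (R * R * R)%type R) :
    Prop :=
  mu (@sphere R) = 1%E.

(* The inverse is the extended one: the kernel 1 / |x - y| is +oo at x = y. *)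
Definition energy (R : realType) (mu : probability (R * R * R)%type R) : \bar R :=
  (\int[mu]_(x in @sphere R) \int[mu]_(y in @sphere R)
     ((enorm3 (x - y)%R)%:E)^-1)%E.

Definition weighted_energy (R : realType) (Q : R * R * R -> \bar R)
    (mu : probability (R * R * R)%type R) : \bar R :=
  (energy mu + 2%:E * \int[mu]_(x in @sphere R) Q x)%E.

Definition minimal_energy (R : realType) (Q : R * R * R -> \bar R) : \bar R :=
  ereal_inf [set weighted_energy Q mu |
             mu in [set mu : probability (R * R * R)%type R | unit_measure mu]].

Definition extremal_measure (R : realType) (Q : R * R * R -> \bar R)
    (mu : probability (R * R * R)%type R) : Prop :=
  unit_measure mu /\ weighted_energy Q mu = minimal_energy Q.

Definition measure_support (R : realType)
    (mu : probability (R * R * R)%type R) : set (R * R * R) :=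
  [set x | forall U : set (R * R * R), open U -> U x -> (0 < mu U)%E].

Definition basis3 (R : realType) : seq (R * R * R) :=
  [:: (1, 0, 0); (0, 1, 0); (0, 0, 1)].

Fixpoint Ck_on (R : realType) (k : nat) (U : set (R * R * R))
    (g : R * R * R -> R) : Prop :=
  (forall x, U x -> {for x, continuous g}) /\
  (if k is k'.+1 then
     forall e, e \in basis3 R ->
       (forall x, U x -> derivable g x e) /\ Ck_on k' U (fun x => 'D_e g x)
   else True).

(* C^2 on an open subset N of the sphere: near each of its points Q is finite
   and is the restriction of a C^2 function of three variables (the usual
   meaning of differentiability on an embedded surface). *)
Definition C2_on_sphere (R : realType) (N : set (R * R * R))
    (Q : R * R * R -> \bar R) : Prop :=
  forall x, N x -> exists (U : set (R * R * R)) (g : R * R * R -> R),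
    [/\ open U, U x, Ck_on 2 U g & forall y, U y -> N y -> Q y = (g y)%:E].

Definition open_in_sphere (R : realType) (N : set (R * R * R)) : Prop :=
  exists2 U : set (R * R * R), open U & N = U `&` @sphere R.

(* Main.v *)
Require Import Defs.
From HB Require Import structures.
From mathcomp Require Import all_boot all_order all_algebra.
From mathcomp Require Import finmap.
From mathcomp Require Import all_classical all_reals all_analysis.
From mathcomp Require Import measurable_realfun.
From mathcomp Require Import ring lra.

Set Implicit Arguments.
Unset Strict Implicit.
Unset Printing Implicit Defensive.

Import Order.TTheory GRing.Theory Num.Theory.
Import numFieldNormedType.Exports.

Local Open Scope classical_set_scope.
Local Open Scope ring_scope.

(** Write [u] for the potential of the extremal measure [mu] and
    [F = I(mu) + \int Q dmu] for the modified Robin constant. Minimality gives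
    two inequalities: [u + Q <= F] almost everywhere for [mu]
    ([potential_le_robin]), and [F <= \int (u + Q) dnu] for every probability
    [nu] of finite energy and finite field ([first_variation]). Both require
    that the minimal energy be finite, which holds because the uniform measure
    conditioned on a sublevel set of [Q] competes ([finite_weighted_energy]).

    Two properties of [mu] then produce the bounded density.

    The first is the growth bound [mu (ball of radius r) <= K r^2]
    ([ball_growth]). Let [x] be a point of the cap with [u x + Q x <= F]. The
    unit charge at the exterior point [(1 + e) x], swept onto the sphere, gives
    after normalization a probability [nu] that is invariant under the
    half-turn about the axis of [x], is concentrated near [x]
    ([\int |x - y|^2 dnu <= 2 e]) and has a potential at most
    [(1 + e) / |w - (1 + e) x|] at each [w] of the sphere ([test_measure], a
    consequence of Newton's theorem and of an inversion). Since [Q] is C^2 near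
    the cap, its second differences [Q y + Q y' - 2 Q x], with [y'] the image
    of [y] under the half-turn, are [O(|x - y|^2)] uniformly in [x]
    ([second_difference_cap]); hence [\int Q dnu <= Q x + O(e)], and the
    variational inequalities give [u x <= \int u dnu + O(e)]
    ([potential_lower_bound]). But [\int u dnu] is at most [1 + e] times a
    potential of [mu] smoothed at the scale [e], and the smoothed kernel is
    smaller than [1 / |x - w|] by at least [1 / (12 e)] for [|x - w| <= e]. So
    the ball of radius [e] about [x] has mass [O(e^2)].

    The second is invariance under rotations about the polar axis
    ([extremal_rotation]). The rotated measure [p] has the same energy and the
    same field as [mu], so that the first variation bounds the mutual energy of
    [p] and [mu] below by the energy of [mu]. The Coulomb kernel is strictly
    positive definite on the sphere: it is a superposition over [s > 0] of the
    kernels [1 / (s^2 + |x - y|^2) = 1 / (2 + s^2 - 2 x.y)]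
    ([kern_superposition]), whose geometric series has positive coefficients,
    and [(x.y)^n] is a sum of products of monomials. Hence [p] and [mu] have
    the same moments ([energy_moments]) and coincide ([moment_determinacy]).

    A ring of the sphere between two close parallels is covered by balls of
    twice its width, and subdividing rings shows that the mass of a slab of
    heights is at most a constant times its thickness ([slab_bound]); the law
    of the height [x_3] under [mu] thus has a bounded density [h]
    ([height_density]). By symmetry [mu] is the average over that law of the
    uniform measures on the parallels ([disintegration]), and the substitution
    [t = cos phi] turns this into the density [f phi = h (cos phi) / (2 pi)]
    ([polar_formula]). *)

(** * Measurability and the Coulomb kernel *)
Section measurability_kit.
Context d (X : measurableType d) (R : realType).

Lemma meas_preimage d1 (A : measurableType d1) (f : X -> A) B :
  measurable_fun setT f -> measurable B -> measurable (f @^-1` B).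
Proof. by move=> mf mB; rewrite -[X in measurable X]setTI; exact: mf. Qed.

Lemma meas_fst d1 d2 (A : measurableType d1) (B : measurableType d2)
  (f : X -> A * B) : measurable_fun setT f -> measurable_fun setT (fun x => (f x).1).
Proof. by move=> mf; exact: (measurableT_comp measurable_fst mf). Qed.

Lemma meas_snd d1 d2 (A : measurableType d1) (B : measurableType d2)
  (f : X -> A * B) : measurable_fun setT f -> measurable_fun setT (fun x => (f x).2).
Proof. by move=> mf; exact: (measurableT_comp measurable_snd mf). Qed.

Lemma meas_pair d1 d2 (A : measurableType d1) (B : measurableType d2)
  (f : X -> A) (g : X -> B) : measurable_fun setT f -> measurable_fun setT g ->
  measurable_fun setT (fun x => (f x, g x)).
Proof. exact: measurable_fun_pair. Qed.

Lemma meas_continuous (h : R -> R) (f : X -> R) : continuous h ->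
  measurable_fun setT f -> measurable_fun setT (fun x => h (f x)).
Proof.
move=> ch mf; apply: (measurableT_comp _ mf); exact: continuous_measurable_fun.
Qed.

Lemma measurable_invr : measurable_fun [set: R] (@GRing.inv R).
Proof.
rewrite -(setUv [set 0 : R]); apply/measurable_funU => //.
  by apply: measurableC; exact: measurable_set1.
split.
  exact: measurable_fun_set1.
apply: open_continuous_measurable_fun.
  by apply: closed_openC; exact: closed_eq.
by move=> x; rewrite inE /= => /eqP x0; exact: inv_continuous.
Qed.

Lemma meas_inv (f : X -> R) : measurable_fun setT f ->
  measurable_fun setT (fun x => (f x)^-1).
Proof. by move=> mf; exact: (measurableT_comp measurable_invr mf). Qed.

Lemma meas_sqrt (f : X -> R) : measurable_fun setT f ->
  measurable_fun setT (fun x => Num.sqrt (f x)).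
Proof. by move=> mf; apply: meas_continuous => //; exact: sqrt_continuous. Qed.

Lemma meas_einv (f : X -> R) : measurable_fun setT f ->
  measurable_fun setT (fun x => ((f x)%:E^-1)%E).
Proof.
move=> mf.
rewrite (_ : (fun x => _) = (fun x => if f x == 0 then +oo%E else (f x)^-1%:E)).
  apply: measurable_fun_ifT => //.
  - exact: measurable_fun_eqr.
  - by apply/measurable_EFinP; exact: meas_inv.
by apply/funext => x; rewrite inver.
Qed.

End measurability_kit.

(* Dispatching on the shape of the function keeps unification from unfolding
   the structures on products. *)
Ltac meas_step :=
  match goal with
  | mf : measurable_fun _ ?f |- measurable_fun _ ?f => exact: mf
  | _ => lazymatch goal with
    | |- measurable_fun _ (fun _ => ?c) => exact: measurable_cst
    | |- measurable_fun _ (fun p => p) => exact: measurable_id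
    | |- measurable_fun _ fst => exact: measurable_fst
    | |- measurable_fun _ snd => exact: measurable_snd
    | |- measurable_fun _ (fun p => (@?f p, @?g p)) => apply: meas_pair
    | |- measurable_fun _ (fun p => (@?f p).1) => apply: meas_fst
    | |- measurable_fun _ (fun p => (@?f p).2) => apply: meas_snd
    | |- measurable_fun _ (fun p => GRing.add (@?f p) (GRing.opp (@?g p))) =>
      apply: measurable_funB
    | |- measurable_fun _ (fun p => GRing.add (@?f p) (@?g p)) =>
      apply: measurable_funD
    | |- measurable_fun _ (fun p => GRing.opp (@?f p)) =>
      apply: measurable_funN
    | |- measurable_fun _ (fun p => GRing.mul (@?f p) (@?g p)) =>
      apply: measurable_funM
    | |- measurable_fun _ (fun p => GRing.exp (@?f p) _) =>
      apply: measurable_funX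
    | |- measurable_fun _ (fun p => GRing.inv (@?f p)) => apply: meas_inv
    | |- measurable_fun _ (fun p => Num.sqrt (@?f p)) => apply: meas_sqrt
    | |- measurable_fun _ (fun p => inve _) => apply: meas_einv
    | _ => assumption
    end
  end.
Ltac meas := repeat meas_step.

Section geometry.
Context {R : realType}.
Local Notation R3 := (R * R * R)%type.

Definition dot (x y : R3) : R := x.1.1 * y.1.1 + x.1.2 * y.1.2 + x.2 * y.2.
Definition dist2 (x y : R3) : R :=
  (x.1.1 - y.1.1) ^+ 2 + (x.1.2 - y.1.2) ^+ 2 + (x.2 - y.2) ^+ 2.
Definition kern (x y : R3) : \bar R := ((enorm3 (x - y))%:E)^-1%E.

Lemma sphereP (x : R3) : sphere x <-> dot x x = 1.
Proof.
rewrite /sphere /= /enorm3 /dot -!expr2; split => [e|->]; last by rewrite sqrtr1.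
by rewrite -[LHS]sqr_sqrtr ?e ?expr1n// !addr_ge0 ?sqr_ge0.
Qed.

Lemma dist2_ge0 x y : 0 <= dist2 x y.
Proof. by rewrite /dist2 !addr_ge0 ?sqr_ge0. Qed.

Lemma enorm3B (x y : R3) : enorm3 (x - y) = Num.sqrt (dist2 x y).
Proof. by []. Qed.

Lemma dist2C x y : dist2 x y = dist2 y x.
Proof. by rewrite /dist2; ring. Qed.

Lemma kernC x y : kern x y = kern y x.
Proof. by rewrite /kern !enorm3B dist2C. Qed.

Lemma kern_ge0 x y : (0 <= kern x y)%E.
Proof. by rewrite /kern inve_ge0 lee_fin enorm3B sqrtr_ge0. Qed.

Lemma dist2_sphere x y : sphere x -> sphere y -> dist2 x y = 2 - 2 * dot x y.
Proof.
move=> /sphereP xS /sphereP yS.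
have -> : dist2 x y = dot x x + dot y y - 2 * dot x y by rewrite /dist2 /dot; ring.
by rewrite xS yS; ring.
Qed.

Lemma measurable_kern : measurable_fun setT (fun p : R3 * R3 => kern p.1 p.2).
Proof.
rewrite (_ : (fun p => _) = (fun p => ((Num.sqrt (dist2 p.1 p.2))%:E^-1)%E))//.
by rewrite /dist2; meas.
Qed.

Lemma measurable_sphere : measurable (@sphere R).
Proof.
rewrite (_ : sphere (R:=R) = @enorm3 R @^-1` [set 1])//.
by apply: meas_preimage => //; rewrite /enorm3; meas.
Qed.

End geometry.

(** * Integrals as functionals; image, conditional and mixed measures *)
Section functional.
Context d (T : measurableType d) (R : realType).
Local Open Scope ereal_scope.
Import HBNNSimple.

(** Agreement on indicators passes to simple functions by linearity, and to all
    nonnegative functions by monotone limits. *)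
Lemma integral_functional (m : {measure set T -> \bar R})
    (Phi : (T -> \bar R) -> \bar R) :
  (forall A, measurable A -> Phi (fun x => (\1_A x)%:E) = m A) ->
  (forall (c : R) f, measurable_fun setT f -> (forall x, 0 <= f x) ->
     (0 <= c)%R -> Phi (fun x => c%:E * f x) = c%:E * Phi f) ->
  (forall f g, measurable_fun setT f -> measurable_fun setT g ->
     (forall x, 0 <= f x) -> (forall x, 0 <= g x) ->
     Phi (fun x => f x + g x) = Phi f + Phi g) ->
  (forall f_ : (T -> \bar R)^nat, (forall n, measurable_fun setT (f_ n)) ->
     (forall n x, 0 <= f_ n x) ->
     (forall x, {homo f_ ^~ x : a b / (a <= b)%N >-> a <= b}) ->
     Phi (fun x => limn (f_ ^~ x)) = limn (fun n => Phi (f_ n))) ->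
  forall h, measurable_fun setT h -> (forall x, 0 <= h x) ->
  \int[m]_x h x = Phi h.
Proof.
move=> PhiI PhiZ PhiD PhiM h mh h0.
pose f_ := nnsfun_approx measurableT mh.
have hE : h = fun x => limn (fun n => (f_ n x)%:E).
  apply/funext => x; apply/esym/cvg_lim => //.
  by apply: cvg_nnsfun_approx => // y _; exact: h0.
have mf n : measurable_fun setT (fun x => (f_ n x)%:E).
  exact/measurable_EFinP/measurable_funP.
have f0 n x : 0 <= (f_ n x)%:E by rewrite lee_fin.
have ndf x : {homo (fun n => (f_ n x)%:E) : a b / (a <= b)%N >-> a <= b}.
  by move=> a b ab; rewrite lee_fin; exact/lefP/nd_nnsfun_approx.
rewrite [in RHS]hE PhiM// [in LHS]hE monotone_convergence//.
congr (limn _); apply/funext => n.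
have Phi0 : Phi (fun=> 0) = 0.
  rewrite -[in RHS](mul0e (Phi (fun=> 0))) -PhiZ//.
  by congr Phi; apply/funext => x; rewrite mul0e.
have PhiS (s : seq R) : Phi (fun x => \sum_(k <- s)
    (`|k|%:E * (\1_(f_ n @^-1` [set k]) x)%:E)) =
    \sum_(k <- s) `|k|%:E * m (f_ n @^-1` [set k]).
  elim: s => [|k s ih].
    by rewrite big_nil -[RHS]Phi0; congr Phi; apply/funext => x; rewrite big_nil.
  rewrite big_cons -ih -PhiI// -PhiZ//; last first.
    by apply/measurable_EFinP; exact: measurable_indic.
  rewrite -PhiD//.
  - by congr Phi; apply/funext => x; rewrite big_cons.
  - apply: measurable_funeM; apply/measurable_EFinP; exact: measurable_indic.
  - apply: emeasurable_sum => i; apply: measurable_funeM; apply/measurable_EFinP.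
    exact: measurable_indic.
  - by move=> x; apply: sume_ge0 => i _; exact: mule_ge0.
rewrite integralT_nnsfun sintegralE.
have fin : finite_set (range (f_ n)) by exact: fimfunP.
rewrite fsbig_finite//=.
set s := finmap.enum_fset _.
have s0 k : k \in s -> (0 <= k)%R.
  move=> ks; have : k \in fset_set (range (f_ n)) by exact: ks.
  by rewrite in_fset_set// => /set_mem[x _ <-].
transitivity (\sum_(k <- s) (`|k|%:E * m (f_ n @^-1` [set k]))).
  by rewrite big_seq [RHS]big_seq; apply: eq_bigr => k /s0 k0; rewrite ger0_norm.
rewrite -PhiS; congr Phi; apply/funext => x.
rewrite fimfunE fsbig_finite//= -/s -sumEFin.
rewrite big_seq [RHS]big_seq; apply: eq_bigr => k /s0 k0.
by rewrite ger0_norm// EFinM.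
Qed.

End functional.

Section density.
Context d1 d2 (T1 : measurableType d1) (T2 : measurableType d2) (R : realType).
Local Open Scope ereal_scope.
Variables (m : {measure set T1 -> \bar R}) (g : T1 -> R) (f : T1 -> T2).
Hypotheses (mg : measurable_fun setT g) (g0 : forall x, (0 <= g x)%R).
Hypotheses (mf : measurable_fun setT f).

Definition image_density (A : set T2) : \bar R :=
  \int[m]_(x in f @^-1` A) (g x)%:E.

Let mg' : measurable_fun setT (EFin \o g).
Proof. exact/measurable_EFinP. Qed.

Let mpre A : measurable A -> measurable (f @^-1` A).
Proof. by move=> mA; rewrite -[X in measurable X]setTI; exact: mf. Qed.

Let image_density0 : image_density set0 = 0.
Proof. by rewrite /image_density preimage_set0 integral_set0. Qed.

Let image_density_ge0 A : 0 <= image_density A.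
Proof. by apply: integral_ge0 => x _; rewrite lee_fin. Qed.

Let image_density_sigma_additive : semi_sigma_additive image_density.
Proof.
move=> F mF tF mUF; rewrite /image_density preimage_bigcup.
apply: (@semi_sigma_additive_nng_induced _ _ _ m _ mg') => //.
- by move=> n; exact: mpre.
- apply/trivIsetP => /= i j _ _ ij; rewrite -preimage_setI.
  by move/trivIsetP : tF => /(_ _ _ _ _ ij) ->//; rewrite preimage_set0.
- by rewrite -preimage_bigcup; exact: mpre.
Qed.

HB.instance Definition _ := isMeasure.Build _ _ _ image_density
  image_density0 image_density_ge0 image_density_sigma_additive.

(** A density followed by a map: translations, dilations, the polar
    substitutions and the uniform measure of the sphere are all instances. *)
Lemma image_density_measure : exists m' : {measure set T2 -> \bar R},
  (forall A, m' A = image_density A) /\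
  forall h : T2 -> \bar R, measurable_fun setT h -> (forall y, 0 <= h y) ->
  \int[m']_y h y = \int[m]_x (h (f x) * (g x)%:E).
Proof.
exists image_density; split => // h mh h0.
have mc (k : T2 -> \bar R) : measurable_fun setT k ->
    measurable_fun setT (fun x => k (f x)).
  by move=> mk; exact: measurableT_comp.
apply: (@integral_functional _ _ _ _
  (fun h => \int[m]_x (h (f x) * (g x)%:E))) => //.
- move=> A mA; rewrite /= /image_density [RHS]integral_mkcond.
  apply: eq_integral => x _; rewrite /patch indicE.
  case: ifPn => /= Ax.
    by move/set_mem : Ax => /= Ax; rewrite mem_set// mul1e.
  by move/negP : Ax => Ax; rewrite memNset ?mul0e// => Afx; apply: Ax; rewrite mem_set.
- move=> c k mk k0 c0; under eq_integral do rewrite -muleA.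
  rewrite ge0_integralZl//.
  + by apply: emeasurable_funM => //; exact: mc.
  + by move=> x _; rewrite mule_ge0 ?lee_fin.
- move=> k1 k2 mk1 mk2 k10 k20; rewrite -ge0_integralD//.
  + by apply: eq_integral => x _; rewrite ge0_muleDl.
  + by move=> x _; rewrite mule_ge0 ?lee_fin.
  + by apply: emeasurable_funM => //; exact: mc.
  + by move=> x _; rewrite mule_ge0 ?lee_fin.
  + by apply: emeasurable_funM => //; exact: mc.
- move=> f_ mf_ f_0 ndf_.
  rewrite -monotone_convergence//.
  + apply: eq_integral => x _.
    rewrite -limeMr//; apply: ereal_nondecreasing_is_cvgn; exact: ndf_.
  + by move=> n; apply: emeasurable_funM => //; exact: mc.
  + by move=> n x _; rewrite mule_ge0 ?lee_fin.
  + by move=> x _ a b ab; rewrite lee_wpmul2r ?lee_fin//; exact: ndf_.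
Qed.

End density.

Lemma probability_of_measure d (T : measurableType d) (R : realType)
    (m : {measure set T -> \bar R}) :
  m setT = 1%E -> exists p : probability T R, forall A, p A = m A.
Proof.
move=> m1.
pose p : probability T R := mnormalize m point.
exists p => A; rewrite /p /= /mnormalize m1 onee_eq0 /=.
by rewrite invr1 mule1.
Qed.

Section mixture.
Context d (T : measurableType d) (R : realType).
Local Open Scope ereal_scope.

Lemma pushforward_probability d' (T' : measurableType d') (m : probability T R)
    (f : T -> T') : measurable_fun setT f ->
  exists p : probability T' R, (forall A, measurable A -> p A = m (f @^-1` A)) /\
    forall h : T' -> \bar R, measurable_fun setT h -> (forall y, 0 <= h y) ->
      \int[p]_y h y = \int[m]_x h (f x).
Proof.
move=> mf.
have [m' [m'E im']] := @image_density_measure _ _ T T' R m (fun=> 1%R) f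
  (measurable_cst _) (fun=> ler01) mf.
have m'E' A : measurable A -> m' A = m (f @^-1` A).
  move=> mA; rewrite m'E /image_density integral_cst ?mul1e//.
  by rewrite -[X in measurable X]setTI; exact: mf.
have m1 : m' setT = 1 by rewrite m'E'// preimage_setT probability_setT.
have [p pE] := probability_of_measure m1.
exists p; split => [A mA|h mh h0]; first by rewrite pE m'E'.
rewrite (@eq_measure_integral _ _ _ setT m') => [|A mA _]; last exact: pE.
by rewrite im'//; apply: eq_integral => x _; rewrite mule1.
Qed.

Lemma density_probability d' (T' : measurableType d')
    (m : {measure set T -> \bar R}) (g : T -> R) (f : T -> T') :
  measurable_fun setT g -> (forall x, (0 <= g x)%R) -> measurable_fun setT f ->
  \int[m]_x (g x)%:E = 1 ->
  exists p : probability T' R,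
    forall h : T' -> \bar R, measurable_fun setT h -> (forall y, 0 <= h y) ->
      \int[p]_y h y = \int[m]_x (h (f x) * (g x)%:E).
Proof.
move=> mg g0 mf g1.
have [m' [m'E im']] := @image_density_measure _ _ T T' R m g f mg g0 mf.
have m1 : m' setT = 1 by rewrite m'E /image_density preimage_setT.
have [p pE] := probability_of_measure m1.
exists p => h mh h0.
rewrite -im'//; apply: eq_measure_integral => A mA _; exact: pE.
Qed.

Lemma conditional_probability (m : probability T R) (B : set T) :
  measurable B -> m B != 0 ->
  exists p : probability T R,
    forall h : T -> \bar R, measurable_fun setT h -> (forall x, 0 <= h x) ->
      \int[p]_x h x = ((fine (m B))^-1)%:E * \int[m]_(x in B) h x.
Proof.
move=> mB mB0; have vE : m B = (fine (m B))%:E.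
  by rewrite fineK//; exact: fin_num_measure.
set v := fine (m B) in vE *.
have v0 : (0 < v)%R by rewrite -lte_fin -vE lt0e mB0 measure_ge0.
pose g (x : T) : R := (v^-1 * \1_B x)%R.
have mg : measurable_fun setT g by apply: measurable_funM => //; exact: measurable_indic.
have g0 x : (0 <= g x)%R by rewrite mulr_ge0// invr_ge0 ltW.
have gint (h : T -> \bar R) : measurable_fun setT h -> (forall x, 0 <= h x) ->
    \int[m]_x (h x * (g x)%:E) = (v^-1)%:E * \int[m]_(x in B) h x.
  move=> mh h0; rewrite [in RHS]integral_mkcond -ge0_integralZl//; last 3 first.
  - by apply/(measurable_restrictT _ _).1 => //; exact: measurable_funS mh.
  - by move=> x _; exact: erestrict_ge0.
  - by rewrite lee_fin invr_ge0 ltW.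
  apply: eq_integral => x _; rewrite /g /patch indicE; case: ifPn => _.
    by rewrite mulr1 muleC.
  by rewrite mulr0 !mule0.
have g1 : \int[m]_x (g x)%:E = 1.
  transitivity (\int[m]_x (1 * (g x)%:E)).
    by apply: eq_integral => x _; rewrite mul1e.
  rewrite (gint (fun=> 1))// integral_cst// mul1e [X in _ * X]vE -EFinM mulVf//.
  by rewrite gt_eqF.
have [p pE] := density_probability mg g0 (@measurable_id _ T setT) g1.
by exists p => h mh h0; rewrite pE// gint.
Qed.

Lemma mixture_probability (p q : probability T R) (t : R) :
  (0 <= t <= 1)%R ->
  exists r : probability T R,
    forall h : T -> \bar R, measurable_fun setT h -> (forall y, 0 <= h y) ->
      \int[r]_y h y = (1 - t)%:E * \int[p]_y h y + t%:E * \int[q]_y h y.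
Proof.
move=> /andP[t0 t1].
have t1' : (0 <= 1 - t)%R by rewrite subr_ge0.
pose a := NngNum t1'; pose b := NngNum t0.
pose m := measure_add (mscale a p) (mscale b q).
have m1 : m setT = 1.
  rewrite /m /measure_add /= /msum !big_ord_recl big_ord0 /= /mscale /=.
  rewrite !probability_setT !mule1 adde0 -EFinD; congr (_%:E).
  by rewrite /=; ring.
have [r rE] := probability_of_measure m1.
exists r => h mh h0.
rewrite (@eq_measure_integral _ _ _ _ m) => [|A mA _]; last exact: rE.
rewrite ge0_integral_measure_add// !ge0_integral_mscale//.
Qed.

End mixture.

(** * Lebesgue measure of the plane *)
Section lebesgue.
Context {R : realType}.
Local Open Scope ereal_scope.
Local Notation L := (@lebesgue_measure R).

Lemma lebesgue_translate (f : R -> \bar R) (c : R) :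
  measurable_fun setT f -> (forall x, 0 <= f x) ->
  \int[L]_x f (x + c)%R = \int[L]_x f x.
Proof.
move=> mf f0.
have mc : measurable_fun setT (fun x : R => (x + c)%R : measurableTypeR R) by meas.
have [m [mE im]] := @image_density_measure _ _ (measurableTypeR R) (measurableTypeR R) R L (fun=> 1%R) _
  (measurable_cst _) (fun=> ler01) mc.
transitivity (\int[m]_x f x).
  by rewrite im//; apply: eq_integral => x _; rewrite mule1.
apply: eq_measure_integral => A mA _; apply/esym.
apply: lebesgue_measure_unique => // _ [[a b]] _ <-.
rewrite mE /image_density (_ : _ @^-1` _ = `]a - c, b - c]%classic)%R; last first.
  apply/seteqP; split => x /=; rewrite !in_itv /= => /andP[? ?];
    by apply/andP; split; lra.
rewrite integral_cst ?mul1e//= !lebesgue_measure_itv/= !lte_fin ltrD2r.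
by case: ifP => // _; congr (_%:E); ring.
Qed.

Lemma lebesgue_scale (f : R -> \bar R) (c : R) :
  measurable_fun setT f -> (forall x, 0 <= f x) -> (0 < c)%R ->
  \int[L]_x f (c * x)%R = (c^-1)%:E * \int[L]_x f x.
Proof.
move=> mf f0 c0.
have mc : measurable_fun setT (fun x : R => (c * x)%R : measurableTypeR R) by meas.
have [m [mE im]] := @image_density_measure _ _ (measurableTypeR R) (measurableTypeR R) R L (fun=> c) _
  (measurable_cst _) (fun=> ltW c0) mc.
transitivity ((c^-1)%:E * \int[m]_x f x).
  rewrite im// -ge0_integralZl//.
  - apply: eq_integral => x _.
    by rewrite muleC -muleA -EFinM divff ?gt_eqF// mule1.
  - by apply: emeasurable_funM => //; exact: measurableT_comp.
  - by move=> x _; rewrite mule_ge0// lee_fin ltW.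
  - by rewrite lee_fin invr_ge0 ltW.
congr (_ * _).
apply: eq_measure_integral => A mA _; apply/esym.
apply: lebesgue_measure_unique => // _ [[a b]] _ <-.
rewrite mE /image_density (_ : _ @^-1` _ = `](a / c), (b / c)]%classic)%R; last first.
  apply/seteqP; split => x /=; rewrite !in_itv /= ltr_pdivrMr// ler_pdivlMr//;
    by rewrite (mulrC x).
rewrite integral_cst//= !lebesgue_measure_itv/= !lte_fin ltr_pM2r ?invr_gt0//.
case: ifP => // _; last by rewrite mule0.
by rewrite -EFinM; congr (_%:E); rewrite -mulrBl mulrCA divff ?mulr1// gt_eqF.
Qed.

Lemma lebesgue_reflect (f : R -> \bar R) :
  measurable_fun setT f -> (forall x, 0 <= f x) ->
  \int[L]_x f (- x)%R = \int[L]_x f x.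
Proof.
move=> mf f0.
have mc : measurable_fun setT (fun x : R => (- x)%R : measurableTypeR R) by meas.
have [m [mE im]] := @image_density_measure _ _ (measurableTypeR R) (measurableTypeR R) R L (fun=> 1%R) _
  (measurable_cst _) (fun=> ler01) mc.
transitivity (\int[m]_x f x).
  by rewrite im//; apply: eq_integral => x _; rewrite mule1.
apply: eq_measure_integral => A mA _.
have mA' : measurable ((fun x : R => (- x)%R) @^-1` A) by exact: meas_preimage.
rewrite mE /image_density integral_cst// mul1e.
exact: lebesgue_measureN.
Qed.

Definition int2 (f : R -> R -> \bar R) := \int[L]_x \int[L]_y f x y.

Lemma int2_swap (f : R -> R -> \bar R) :
  measurable_fun setT (fun p : R * R => f p.1 p.2) -> (forall x y, 0 <= f x y) ->
  int2 f = int2 (fun x y => f y x).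
Proof.
move=> mf f0; rewrite /int2.
by rewrite (@fubini_tonelli _ _ _ _ _ L L (fun p => f p.1 p.2)).
Qed.

Lemma int2_shearr (f : R -> R -> \bar R) (a : R) :
  measurable_fun setT (fun p : R * R => f p.1 p.2) -> (forall x y, 0 <= f x y) ->
  int2 (fun x y => f x (y + a * x)%R) = int2 f.
Proof.
move=> mf f0; apply: eq_integral => x _.
apply: (@lebesgue_translate (f x)) => //.
exact: (measurableT_comp mf (measurable_pair1 x)).
Qed.

Lemma int2_shearl (f : R -> R -> \bar R) (a : R) :
  measurable_fun setT (fun p : R * R => f p.1 p.2) -> (forall x y, 0 <= f x y) ->
  int2 (fun x y => f (x + a * y)%R y) = int2 f.
Proof.
move=> mf f0.
have ms : measurable_fun setT (fun p : R * R => f p.2 p.1).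
  by apply: (measurableT_comp mf (_ : measurable_fun setT (fun p : R * R => (p.2, p.1)))); meas.
have ms' : measurable_fun setT (fun p : R * R => f (p.1 + a * p.2)%R p.2).
  by apply: (measurableT_comp mf (_ : measurable_fun setT (fun p : R * R => (p.1 + a * p.2, p.2)%R))); meas.
rewrite (int2_swap ms' (fun x y => f0 _ _)).
by rewrite (@int2_shearr (fun x y => f y x))// (int2_swap mf f0).
Qed.

(** Unless it is the identity or the central symmetry, a rotation is a product
    of three shears, and translations along one axis make shears preserve area. *)
Lemma int2_rotation (f : R -> R -> \bar R) (c s : R) :
  measurable_fun setT (fun p : R * R => f p.1 p.2) -> (forall x y, 0 <= f x y) ->
  (c ^+ 2 + s ^+ 2 = 1)%R ->
  int2 (fun x y => f (c * x - s * y)%R (s * x + c * y)%R) = int2 f.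
Proof.
move=> mf f0 cs.
have mF (F : R * R -> R * R) : measurable_fun setT F ->
    measurable_fun setT (fun p => f (F p).1 (F p).2).
  by move=> mF; exact: (measurableT_comp mf mF).
have [s0|s0] := eqVneq s 0%R.
  have : ((c - 1) * (c + 1) = 0)%R by rewrite -subr_sqr; move: cs; rewrite s0; lra.
  move=> /eqP; rewrite mulf_eq0 => /orP[c1|c1].
    have -> : c = 1%R by move/eqP: c1; lra.
    by rewrite s0; apply: eq_integral => x _; apply: eq_integral => y _; congr f; ring.
  have -> : c = (-1)%R by move/eqP: c1; lra.
  transitivity (int2 (fun x y => f (- x) (- y))%R).
    by rewrite s0; apply: eq_integral => x _; apply: eq_integral => y _; congr f; ring.
  transitivity (int2 (fun x y => f (- x) y)%R).
    apply: eq_integral => x _; apply: (@lebesgue_reflect (f (- x)%R)) => //.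
    apply: (@measurableT_comp _ _ _ _ _ _ (fun p : R * R => f (- p.1)%R p.2) _ (pair x)).
    by apply: (mF (fun p => (- p.1, p.2))%R); meas.
    exact: measurable_pair1.
  apply: (@lebesgue_reflect (fun x => \int[L]_y f x y)) => //.
    exact: (@measurable_fun_fubini_tonelli_F _ _ _ _ _ L (fun p => f p.1 p.2)).
  by move=> x; exact: integral_ge0.
(* The shears by [a], [s] and [a] compose to the rotation; [a] is minus the
   tangent of half its angle. *)
pose a := ((c - 1) / s)%R.
have as_ : (a * s = c - 1)%R by rewrite /a divfK.
pose f1 x y := f (x + a * y)%R y.
pose f2 x y := f1 x (y + s * x)%R.
transitivity (int2 (fun x y => f2 (x + a * y)%R y)).
  apply: eq_integral => x _; apply: eq_integral => y _; rewrite /f2 /f1.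
  have e1 : (y + s * (x + a * y) = s * x + c * y)%R.
    by rewrite mulrDr (mulrC s (a * y)%R) mulrAC as_; ring.
  congr f => //; rewrite e1.
  have -> : (x + a * y + a * (s * x + c * y) = x + a * s * x + a * (1 + c) * y)%R by ring.
  rewrite as_ (_ : a * (1 + c) = - s)%R; last first.
    rewrite /a mulrAC -[RHS](mulfK s0); congr (_ / _)%R.
    by move: cs; rewrite expr2; nra.
  by ring.
rewrite int2_shearl ?int2_shearr ?int2_shearl//.
- by apply: (mF (fun p => (p.1 + a * p.2, p.2))%R); meas.
- by move=> x y; exact: f0.
- by apply: (mF (fun p => (p.1 + a * (p.2 + s * p.1), (p.2 + s * p.1)))%R); meas.
- by move=> x y; exact: f0.
Qed.

End lebesgue.

Section polar.
Context {R : realType}.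
Local Open Scope ereal_scope.
Local Notation L := (@lebesgue_measure R).

(** Parametrized by the square of the radius, so that the area is linear in [r]. *)
Definition disc_area (r : R) : \bar R :=
  int2 (fun x y : R => (\1_(`]-oo, r]%classic) (x ^+ 2 + y ^+ 2))%R%:E).

Let mI (A : set R) d (X : measurableType d) (f : X -> R) : measurable A -> measurable_fun setT f ->
  measurable_fun setT (fun x => (\1_A (f x))%:E : \bar R).
Proof.
move=> mA mf; apply/measurable_EFinP.
exact: (measurableT_comp (measurable_indic mA) mf).
Qed.

Lemma int2Z (f : R -> R -> \bar R) (c : R) :
  measurable_fun setT (fun p : R * R => f p.1 p.2) -> (forall x y, 0 <= f x y) ->
  (0 <= c)%R ->
  int2 (fun x y => c%:E * f x y) = c%:E * int2 f.
Proof.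
move=> mf f0 c0; rewrite /int2 -ge0_integralZl//.
- apply: eq_integral => x _; rewrite ge0_integralZl//.
  exact: (measurableT_comp mf (measurable_pair1 x)).
- exact: (@measurable_fun_fubini_tonelli_F _ _ _ _ _ L (fun p => f p.1 p.2)).
- by move=> x _; exact: integral_ge0.
Qed.

Lemma int2_le (f g : R -> R -> \bar R) :
  measurable_fun setT (fun p : R * R => f p.1 p.2) -> (forall x y, 0 <= f x y) ->
  measurable_fun setT (fun p : R * R => g p.1 p.2) -> 
  (forall x y, f x y <= g x y) -> int2 f <= int2 g.
Proof.
move=> mf f0 mg fg.
have g0 x y : 0 <= g x y by exact: le_trans (fg x y).
apply: ge0_le_integral => //.
- by move=> x _; exact: integral_ge0.
- exact: (@measurable_fun_fubini_tonelli_F _ _ _ _ _ L (fun p => f p.1 p.2)).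
- exact: (@measurable_fun_fubini_tonelli_F _ _ _ _ _ L (fun p => g p.1 p.2)).
- move=> x _; apply: ge0_le_integral => //.
  + exact: (measurableT_comp mf (measurable_pair1 x)).
  + exact: (measurableT_comp mg (measurable_pair1 x)).
Qed.

Lemma int2_scale (f : R -> R -> \bar R) (c : R) :
  measurable_fun setT (fun p : R * R => f p.1 p.2) -> (forall x y, 0 <= f x y) ->
  (0 < c)%R ->
  int2 (fun x y => f (c * x) (c * y))%R = (c ^- 2)%:E * int2 f.
Proof.
move=> mf f0 c0.
have c0' : (0 <= c^-1)%R by rewrite invr_ge0 ltW.
transitivity (int2 (fun x y => (c^-1)%:E * f (c * x)%R y)).
  apply: eq_integral => x _; rewrite (@lebesgue_scale _ (f (c * x)%R))//.
    rewrite ge0_integralZl//.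
    exact: (measurableT_comp mf (measurable_pair1 _)).
  exact: (measurableT_comp mf (measurable_pair1 _)).
have mf' : measurable_fun setT (fun p : R * R => f (c * p.1)%R p.2).
  by apply: (measurableT_comp mf (_ : measurable_fun setT (fun p : R * R => (c * p.1, p.2)%R))); meas.
rewrite (int2Z mf' (fun x y => f0 _ _) c0').
rewrite [int2 _](@lebesgue_scale _ (fun x => \int[L]_y f x y))//.
- by rewrite muleA -EFinM expr2 invfM.
- exact: (@measurable_fun_fubini_tonelli_F _ _ _ _ _ L (fun p => f p.1 p.2)).
- by move=> x; exact: integral_ge0.
Qed.

Lemma disc_areaE (r : R) : (0 < r)%R -> disc_area r = r%:E * disc_area 1.
Proof.
move=> r0.
have m1 : measurable_fun setT (fun p : R * R => (\1_(`]-oo, r]%classic) (p.1 ^+ 2 + p.2 ^+ 2))%R%:E : \bar R).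
  by apply: mI => //; meas.
have e := @int2_scale
  (fun x y : R => (\1_(`]-oo, r]%classic) (x ^+ 2 + y ^+ 2))%R%:E) (Num.sqrt r) m1.
rewrite -/(disc_area r) sqrtr_gt0 in e.
have -> : disc_area 1 = int2
    (fun x y => (\1_`]-oo, r] ((Num.sqrt r * x) ^+ 2 + (Num.sqrt r * y) ^+ 2))%R%:E : \bar R).
  apply: eq_integral => x _; apply: eq_integral => y _.
  congr (_%:E); rewrite !indicE; congr (_%:R); congr nat_of_bool.
  rewrite !exprMn sqr_sqrtr ?ltW// -mulrDr; apply/idP/idP; rewrite !inE /= !in_itv /=.
    by move=> h; rewrite -[leRHS]mulr1 ler_pM2l.
  by rewrite -[leRHS]mulr1 ler_pM2l.
rewrite e//.
rewrite sqr_sqrtr ?ltW// muleA -EFinM divff ?gt_eqF// mul1e//.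
Qed.

(** The disc lies between two squares. *)
Lemma disc_area1 : exists2 k : R, (0 < k)%R & disc_area 1 = k%:E.
Proof.
have m1 : measurable_fun setT (fun p : R * R => (\1_(`]-oo, 1%R]%classic) (p.1 ^+ 2 + p.2 ^+ 2))%R%:E : \bar R).
  by apply: mI => //; meas.
have mb (a b : R) : measurable_fun setT (fun p : R * R =>
    (\1_(`[a, b]%classic) p.1)%:E * (\1_(`[a, b]%classic) p.2)%:E : \bar R).
  by apply: emeasurable_funM; apply: mI => //; meas.
have il (a b : R) : (a <= b)%R ->
    \int[L]_x (\1_(`[a, b]%classic) x)%:E = (b - a)%:E.
  move=> ab; rewrite integral_indic// setIT /= lebesgue_measure_itv/= lte_fin.
  by case: ltgtP ab => // -> _; rewrite subrr.
have ib (a b : R) : (a <= b)%R -> int2 (fun x y : R => (\1_(`[a, b]%classic) x)%:E * (\1_(`[a, b]%classic) y)%:E)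
    = ((b - a) ^+ 2)%:E.
  move=> ab; transitivity (\int[L]_x ((\1_(`[a, b]%classic) x)%:E * (b - a)%:E)).
    apply: eq_integral => x _; rewrite ge0_integralZl//.
    - by rewrite il.
    - exact: mI.
  rewrite ge0_integralZr//.
  - by rewrite il// -EFinM -expr2.
  - exact: mI.
  - by rewrite lee_fin subr_ge0.
have up : disc_area 1 <= 4%:E.
  have -> : (4 = (1 - (-1)) ^+ 2 :> R)%R by rewrite expr2; ring.
  rewrite -ib; last lra.
  apply: int2_le => //.
  move=> x y; rewrite -EFinM lee_fin !indicE.
  case: (boolP (_ \in _)); rewrite ?mulr_ge0//.
  rewrite inE /= in_itv /= => xy1.
  have x2 := sqr_ge0 x; have y2 := sqr_ge0 y.
  have ab (z : R) : (z ^+ 2 <= 1 -> z \in `[-1, 1]%classic)%R.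
    by rewrite expr2 => z1; rewrite inE /= in_itv /=; apply/andP; split; nra.
  by rewrite (ab x) ?(ab y) ?mulr1//; lra.
have lo : (1/4)%:E <= disc_area 1.
  have -> : (1/4 = (1/2 - 0) ^+ 2 :> R)%R by rewrite expr2; field.
  rewrite -ib; last lra.
  apply: int2_le => //.
  move=> x y; rewrite -EFinM lee_fin !indicE.
  case: (boolP (x \in _)); rewrite ?mul0r//.
  case: (boolP (y \in _)); rewrite ?mulr0//.
  rewrite !inE /= !in_itv /= => /andP[y0 y1] /andP[x0 x1].
  rewrite mem_set ?mulr1//= in_itv /=; nra.
have fin : disc_area 1 \is a fin_num.
  by rewrite ge0_fin_numE ?(le_lt_trans up) ?ltry// (le_trans _ lo)// lee_fin.
exists (fine (disc_area 1)); last by rewrite fineK.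
by rewrite -lte_fin fineK// (lt_le_trans _ lo)// lte_fin.
Qed.

End polar.

Section radial.
Context {R : realType}.
Local Open Scope ereal_scope.
Local Notation L := (@lebesgue_measure R).

(** The squared radius is distributed as a multiple of Lebesgue measure on the
    half-line, because disc areas are linear in it. *)
Lemma int2_radial : exists2 k : R, (0 < k)%R &
  forall h : R -> \bar R, measurable_fun setT h -> (forall x, 0 <= h x) ->
  int2 (fun x y => h (x ^+ 2 + y ^+ 2)%R) =
  k%:E * \int[L]_x (h x * (\1_`]0%R, +oo[%classic x)%:E).
Proof.
have [k k0 kE] := @disc_area1 R; exists k => // h mh h0.
have msq : measurable_fun setT (fun p : R * R => (p.1 ^+ 2 + p.2 ^+ 2)%R : measurableTypeR R) by meas.
have [m [mE im]] := @image_density_measure _ _ _ (measurableTypeR R) R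
  (L \x L) (fun=> 1%R) _ (measurable_cst _) (fun=> ler01) msq.
have imm (g : R -> \bar R) : measurable_fun setT g -> (forall x, 0 <= g x) ->
    \int[m]_x g x = int2 (fun x y => g (x ^+ 2 + y ^+ 2)%R).
  move=> mg g0; rewrite (im g mg g0).
  have mg' : measurable_fun setT
      (fun p : R * R => g (p.1 ^+ 2 + p.2 ^+ 2)%R * 1%:E).
    by apply: emeasurable_funM => //; exact: (measurableT_comp mg msq).
  rewrite (@fubini_tonelli1 _ _ _ _ _ L L _ mg') => [|p]; last by rewrite mule1.
  by apply: eq_integral => x _; apply: eq_integral => y _ /=; rewrite mule1.
have mle r : m `]-oo, r]%classic = (Num.max r 0 * k)%:E.
  have mr (s : R) : m `]-oo, s]%classic = disc_area s.
    rewrite -(setIT `]-oo, s]%classic) -integral_indic// imm//.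
    by apply/measurable_EFinP; exact: measurable_indic.
  have [r0|r0] := ltP 0%R r.
    by rewrite mr disc_areaE// kE EFinM.
  rewrite mul0r; apply/eqP; rewrite eq_le measure_ge0 andbT.
  apply/lee_addgt0Pr => e e0; rewrite add0e.
  apply: (@le_trans _ _ (m `]-oo, (e / k)%R]%classic)).
    apply: le_measure; rewrite ?inE//.
    by move=> x /=; rewrite !in_itv /= => /le_trans; apply; rewrite (le_trans r0)// divr_ge0// ltW.
  by rewrite mr disc_areaE ?divr_gt0// kE -EFinM divfK// gt_eqF.
(* [m] lives on the half-line; completed on the negative side it becomes a
   multiple of Lebesgue measure, and uniqueness of the latter applies. *)
pose neg := mscale (NngNum (ltW k0)) (mrestr L (@measurable_itv R `]-oo, 0%R])).
have ki : (0 <= k^-1)%R by rewrite invr_ge0 ltW.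
pose tot := mscale (NngNum ki) (measure_add m neg).
have totEx X : tot X = (k^-1)%:E * (m X + k%:E * L (X `&` `]-oo, 0%R]%classic)).
  change ((k^-1)%:E * measure_add m neg X =
          (k^-1)%:E * (m X + k%:E * L (X `&` `]-oo, 0%R]%classic))).
  by rewrite measure_addE.
have totE A : measurable A -> L A = tot A.
  apply: lebesgue_measure_unique => _ [[a b]] _ <-.
  rewrite [RHS]totEx /=.
  have [ab|ba] := ltP a b; last first.
    by rewrite set_itv_ge -?leNgt ?bnd_simp// set0I !measure0 !(mule0, adde0).
  have -> : m `]a, b]%classic = ((Num.max b 0 - Num.max a 0) * k)%:E.
    rewrite (_ : `]a, b]%classic = `]-oo, b]%classic `\` `]-oo, a]%classic); last first.
      apply/seteqP; split => x /=; rewrite !in_itv /=.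
        by move=> /andP[ax xb]; split => //; apply/negP; rewrite -ltNge.
      by move=> [xb] /negP; rewrite -ltNge => ->.
    rewrite measureD//.
    - rewrite (_ : _ `&` _ = `]-oo, a]%classic).
        by rewrite mulrBl EFinB; exact: (congr2 (fun x y => x - y) (mle b) (mle a)).
      apply/seteqP; split => x /=; rewrite !in_itv /=; first by case.
      by move=> xa; split => //; exact: le_trans (ltW ab).
    - by rewrite [X in X < _](mle b) ltry.
  have -> : L (`]a, b]%classic `&` `]-oo, 0%R]%classic) = (Num.min b 0 - Num.min a 0)%:E.
    have [a0|a0] := ltP a 0%R; last first.
      rewrite (_ : _ `&` _ = set0); last first.
        by apply/seteqP; split => x //= []; rewrite !in_itv /= => /andP[? ?] ?; lra.
      by rewrite measure0 min_r ?subrr// (le_trans a0)// ltW.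
    rewrite (_ : _ `&` _ = `]a, (Num.min b 0)%R]%classic); last first.
      apply/seteqP; split => x /=; rewrite !in_itv /= le_min.
        by move=> [/andP[-> ->] ->].
      by move=> /and3P[-> -> ->].
    by rewrite lebesgue_measure_itv/= lte_fin lt_min ab a0.
  rewrite lebesgue_measure_itv/= lte_fin ab.
  do ![rewrite -EFinM|rewrite -EFinD|rewrite -EFinN]; congr (_%:E).
  have mx (z : R) : (Num.max z 0 = z - Num.min z 0)%R.
    by rewrite -[X in (X - _)%R]addr0 -(addr_max_min z 0%R) addrK.
  rewrite !mx.
  by field; rewrite gt_eqF.
pose h' x := h x * (\1_`]0%R, +oo[%classic x)%:E.
have mh' : measurable_fun setT h'.
  by apply: emeasurable_funM => //; apply/measurable_EFinP; exact: measurable_indic.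
have h'0 x : 0 <= h' x by rewrite mule_ge0// lee_fin.
have m0 : m `]-oo, 0%R]%classic = 0 by rewrite mle maxxx mul0r.
have -> : int2 (fun x y => h (x ^+ 2 + y ^+ 2)%R) = \int[m]_x h' x.
  rewrite -imm//; apply: ge0_ae_eq_integral => //.
  exists `]-oo, 0%R]%classic; split => // x /= hx; rewrite in_itv /= leNgt; apply/negP => x0.
  by apply: hx => _; rewrite /h' indicE mem_set ?mule1//= in_itv /= x0.
have -> : \int[L]_x h' x = \int[tot]_x h' x.
  by apply: eq_measure_integral => A mA _; exact: totE.
rewrite ge0_integral_mscale// muleA -EFinM /= divff ?gt_eqF// mul1e.
rewrite ge0_integral_measure_add//.
rewrite [X in _ + X](_ : _ = 0) ?adde0// /neg ge0_integral_mscale//.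
rewrite [X in _ * X](_ : _ = 0) ?mule0//.
rewrite (@ge0_negligible_integral _ _ _ (mrestr L (measurable_itv `]-oo, 0%R])) setT (`]0%R, +oo[%classic : set R))//; last first.
  change (L ((`]0%R, +oo[%classic : set R) `&` `]-oo, 0%R]%classic) = 0).
  rewrite (_ : _ `&` _ = set0) ?measure0//.
  by apply/seteqP; split => x //= []; rewrite !in_itv /= andbT => ? ?; lra.
by apply: integral0_eq => x [_ /= /negP x0]; rewrite /h' indicE memNset ?mule0//; exact/negP.
Qed.

End radial.

(** * Lebesgue measure of space and the hat-box theorem *)
Section archimedes.
Context {R : realType}.
Local Open Scope ereal_scope.
Local Notation L := (@lebesgue_measure R).
Local Notation R3 := (R * R * R)%type.

(** A name of its own lets the planar measure carry the sigma-finiteness under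
    which the third coordinate is integrated. *)
Definition L2 : set (measurableTypeR R * measurableTypeR R) -> \bar R :=
  (L \x L).
HB.instance Definition _ := Measure.on L2.

Let L2_sigma_finite : sigma_finite setT L2.
Proof.
pose I (n : nat) : set R := `[(- n%:R)%R, n%:R%R]%classic.
exists (fun n => I n `*` I n).
  apply/seteqP; split => // -[x y] _.
  pose n := (Num.bound `|x|%R + Num.bound `|y|%R)%N.
  have xn : (`|x| <= n%:R)%R.
    by rewrite (le_trans (ltW (archi_boundP (normr_ge0 x))))// ler_nat leq_addr.
  have yn : (`|y| <= n%:R)%R.
    by rewrite (le_trans (ltW (archi_boundP (normr_ge0 y))))// ler_nat leq_addl.
  by exists n => //; split => /=; rewrite /I /= in_itv /= -ler_norml.
move=> n; split; first by apply: measurableX; exact: measurable_itv.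
have mI : measurable (I n) by exact: measurable_itv.
have -> : L2 (I n `*` I n) = L (I n) * L (I n) by exact: product_measure1E.
rewrite lte_mul_pinfty//.
- by rewrite ge0_fin_numE// lebesgue_measure_itv/=; case: ifP => _; rewrite ?ltry// -EFinB ltry.
- by rewrite lebesgue_measure_itv/=; case: ifP => _; rewrite ?ltry// -EFinB ltry.
Qed.

HB.instance Definition _ := Measure_isSigmaFinite.Build _ _ _ L2 L2_sigma_finite.

Definition L3 : set (measurableTypeR R * measurableTypeR R * measurableTypeR R) -> \bar R :=
  (L2 \x L).
HB.instance Definition _ := Measure.on L3.

Definition rot12 (c s : R) (y : R3) : R3 :=
  (c * y.1.1 - s * y.1.2, s * y.1.1 + c * y.1.2, y.2)%R.
Definition rot23 (c s : R) (y : R3) : R3 :=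
  (y.1.1, c * y.1.2 - s * y.2, s * y.1.2 + c * y.2)%R.

Lemma integral_L3_outer (f : R3 -> \bar R) : measurable_fun setT f -> (forall x, 0 <= f x) ->
  \int[L3]_p f p = \int[L]_z int2 (fun x y => f (x, y, z)).
Proof.
move=> mf f0.
have -> : \int[L3]_p f p = \int[L]_z \int[L2]_p f (p, z).
  exact: (@fubini_tonelli2 _ _ _ _ _ L2 L f mf f0).
apply: eq_integral => z _.
have mfz : measurable_fun setT (fun p => f (p, z)).
  by apply: (measurableT_comp mf); meas.
have fz0 p : 0 <= f (p, z) by [].
rewrite (@fubini_tonelli1 _ _ _ _ _ L L (fun p => f (p, z)) mfz fz0).
by [].
Qed.

Lemma integral_L3_inner (f : R3 -> \bar R) : measurable_fun setT f -> (forall x, 0 <= f x) ->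
  \int[L3]_p f p = \int[L]_x int2 (fun y z => f (x, y, z)).
Proof.
move=> mf f0.
have -> : \int[L3]_p f p = \int[L2]_p \int[L]_z f (p, z).
  exact: (@fubini_tonelli1 _ _ _ _ _ L2 L f mf f0).
have mF : measurable_fun setT (fun p => \int[L]_z f (p, z)).
  exact: (@measurable_fun_fubini_tonelli_F _ _ _ _ _ L f mf f0).
have F0 p : 0 <= \int[L]_z f (p, z) by exact: integral_ge0.
by rewrite (@fubini_tonelli1 _ _ _ _ _ L L _ mF F0).
Qed.

Lemma measurable_rot12 c s : measurable_fun setT (rot12 c s).
Proof. by rewrite /rot12; meas. Qed.

Lemma measurable_rot23 c s : measurable_fun setT (rot23 c s).
Proof. by rewrite /rot23; meas. Qed.

Lemma L3_rot12 (f : R3 -> \bar R) (c s : R) : measurable_fun setT f -> (forall x, 0 <= f x) ->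
  (c ^+ 2 + s ^+ 2 = 1)%R ->
  \int[L3]_p f (rot12 c s p) = \int[L3]_p f p.
Proof.
move=> mf f0 cs.
have mfr : measurable_fun setT (fun p => f (rot12 c s p)).
  by apply: (measurableT_comp mf); exact: measurable_rot12.
rewrite (integral_L3_outer mf f0) (integral_L3_outer mfr (fun p => f0 _)).
apply: eq_integral => z _; rewrite /rot12 /=.
apply: (@int2_rotation _ (fun x y => f (x, y, z))) => //.
by apply: (measurableT_comp mf); meas.
Qed.

Lemma L3_rot23 (f : R3 -> \bar R) (c s : R) : measurable_fun setT f -> (forall x, 0 <= f x) ->
  (c ^+ 2 + s ^+ 2 = 1)%R ->
  \int[L3]_p f (rot23 c s p) = \int[L3]_p f p.
Proof.
move=> mf f0 cs.
have mfr : measurable_fun setT (fun p => f (rot23 c s p)).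
  by apply: (measurableT_comp mf); exact: measurable_rot23.
rewrite (integral_L3_inner mf f0) (integral_L3_inner mfr (fun p => f0 _)).
apply: eq_integral => x _; rewrite /rot23 /=.
apply: (@int2_rotation _ (fun y z => f (x, y, z))) => //.
by apply: (measurableT_comp mf); meas.
Qed.

End archimedes.

Section hat_box.
Context {R : realType}.
Local Open Scope ereal_scope.
Local Notation L := (@lebesgue_measure R).
Local Notation R3 := (R * R * R)%type.

Definition unit_ball_indic (q : R) : R := \1_(`]0%R, 1%R]%classic) q.

Lemma measurable_ball_indic : measurable_fun setT unit_ball_indic.
Proof. exact: measurable_indic. Qed.

(** Exchange the planar radius for the full one: given [q = x^2 + y^2 + z^2], the
    height [z] is uniform on [[-sqrt q, sqrt q]], so that [z / sqrt q] is uniform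
    on [[-1, 1]] and independent of [q]. *)
Lemma ball_hat_box : exists2 Z : R, (0 < Z)%R & forall F : R -> \bar R,
  measurable_fun setT F -> (forall x, 0 <= F x) ->
  \int[L3]_p (F (p.2 / Num.sqrt (dot p p))%R * (unit_ball_indic (dot p p))%:E) =
  Z%:E * \int[L]_(t in `](-1)%R, 1%R[) F t.
Proof.
have [k k0 kE] := @int2_radial R.
(* Bounds on [root], the mean length of the interval of heights up to a factor,
   make the normalizing constant positive and finite. *)
pose root := \int[L]_q ((Num.sqrt q)%:E * (unit_ball_indic q)%:E).
have mroot : measurable_fun setT (fun q : R => (Num.sqrt q)%:E * (unit_ball_indic q)%:E : \bar R).
  apply: emeasurable_funM; apply/measurable_EFinP; first exact: (meas_sqrt (@measurable_id _ _ setT)).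
  exact: measurable_ball_indic.
have root_le : root <= 1.
  apply: (@le_trans _ _ (\int[L]_q (unit_ball_indic q)%:E)); last first.
    rewrite /unit_ball_indic integral_indic// setIT /= lebesgue_measure_itv/= lte_fin ltr01.
    by rewrite oppr0 adde0.
  apply: ge0_le_integral => //.
  - by move=> x _; rewrite mule_ge0// lee_fin ?sqrtr_ge0// /unit_ball_indic.
  - by apply/measurable_EFinP; exact: measurable_ball_indic.
  - move=> q _; rewrite -EFinM lee_fin /unit_ball_indic indicE.
    case: (boolP (q \in _)); rewrite ?mulr0// mulr1 inE /= in_itv /= => /andP[q0 q1].
    by rewrite -[leRHS]sqrtr1 ler_wsqrtr.
have root_ge : (3/8)%:E <= root.
  apply: (@le_trans _ _ (\int[L]_q ((1/2)%:E * (\1_(`](1/4)%R, 1%R]%classic) q)%:E))).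
    rewrite ge0_integralZl//; last first.
      by apply/measurable_EFinP; exact: measurable_indic.
    rewrite integral_indic// setIT /= lebesgue_measure_itv/= lte_fin.
    rewrite (_ : (1/4 < 1 :> R)%R); last by lra.
    by rewrite -EFinB -EFinM lee_fin; lra.
  apply: ge0_le_integral => //.
  - apply: emeasurable_funM; apply/measurable_EFinP => //; exact: measurable_indic.
  - move=> q _; rewrite -!EFinM lee_fin /unit_ball_indic !indicE.
    case: (boolP (q \in `](1/4)%R, 1%R]%classic)); last by rewrite !mulr0 mulr_ge0// sqrtr_ge0.
    rewrite inE /= in_itv /= => /andP[q0 q1]; rewrite mem_set ?mulr1; last first.
      by rewrite /= in_itv /=; apply/andP; split => //; lra.
    rewrite -[leLHS]ger0_norm// -sqrtr_sqr ler_wsqrtr// expr2; lra.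
have root_fin : root \is a fin_num.
  by rewrite ge0_fin_numE ?(le_lt_trans root_le) ?ltry// (le_trans _ root_ge)// lee_fin.
have root_gt0 : (0 < fine root)%R.
  by rewrite -lte_fin fineK// (lt_le_trans _ root_ge)// lte_fin.
exists (k * fine root)%R; first by rewrite mulr_gt0.
move=> F mF F0.
have mB d (X : measurableType d) (f : X -> R) : measurable_fun setT f ->
    measurable_fun setT (fun x => (unit_ball_indic (f x))%:E : \bar R).
  by move=> mf; apply/measurable_EFinP; exact: (measurableT_comp measurable_ball_indic mf).
have mFc d (X : measurableType d) (f : X -> R) : measurable_fun setT f ->
    measurable_fun setT (fun x => F (f x)).
  by move=> mf; exact: (measurableT_comp mF mf).
have mI d (X : measurableType d) (f : X -> R) (A : set R) : measurable A -> measurable_fun setT f ->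
    measurable_fun setT (fun x => (\1_A (f x))%:E : \bar R).
  by move=> mA mf; apply/measurable_EFinP; exact: (measurableT_comp (measurable_indic mA) mf).
have B0 q : 0 <= (unit_ball_indic q)%:E by rewrite lee_fin /unit_ball_indic.
pose ff (p : R3) := F (p.2 / Num.sqrt (dot p p))%R * (unit_ball_indic (dot p p))%:E.
have mff : measurable_fun setT ff.
  by rewrite /ff /dot; apply: emeasurable_funM; [apply: mFc|apply: mB]; meas.
have ff0 p : 0 <= ff p by rewrite /ff mule_ge0.
rewrite (integral_L3_outer mff ff0).
(* In terms of the height [z] and the squared norm [q]; the last factor says
   that [q - z ^+ 2] is a squared planar radius. *)
pose G (z q : R) := F (z / Num.sqrt q)%R * (unit_ball_indic q)%:E *
  (\1_(`]0%R, +oo[%classic) (q - z ^+ 2)%R)%:E.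
have G0 z q : 0 <= G z q by rewrite !mule_ge0// lee_fin.
have mG : measurable_fun setT (fun p : R * R => G p.1 p.2).
  apply: emeasurable_funM; last by apply: mI => //; meas.
  by apply: emeasurable_funM; [apply: mFc|apply: mB]; meas.
transitivity (k%:E * int2 G).
  rewrite -(int2Z mG G0 (ltW k0)) {1}/int2; apply: eq_integral => z _.
  pose h s := F (z / Num.sqrt (s + z ^+ 2))%R * (unit_ball_indic (s + z ^+ 2))%:E.
  have mh : measurable_fun setT h.
    by apply: emeasurable_funM; [apply: mFc|apply: mB]; meas.
  have h0 s : 0 <= h s by rewrite mule_ge0.
  transitivity (int2 (fun x y => h (x ^+ 2 + y ^+ 2)%R)).
    by apply: eq_integral => x _; apply: eq_integral => y _; rewrite /h /dot /= !expr2.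
  have mGz : measurable_fun setT (G z).
    by apply: (measurableT_comp mG (_ : measurable_fun setT (fun q => (z, q)))); meas.
  rewrite kE// ge0_integralZl ?ltW//.
  congr (_ * _).
  rewrite -[RHS](@lebesgue_translate _ (G z) (z ^+ 2))//.
  by apply: eq_integral => s _; rewrite /G /h addrK.
rewrite EFinM fineK// -muleA; congr (_ * _).
rewrite int2_swap// /root -ge0_integralZr//; last 2 first.
- by move=> q _; rewrite mule_ge0// lee_fin sqrtr_ge0.
- exact: integral_ge0.
apply: eq_integral => q _; rewrite /G.
have [q0|q0] := leP q 0%R.
  rewrite /unit_ball_indic indicE memNset; last by rewrite /= in_itv /= ltNge q0.
  by rewrite mule0 mul0e; apply: integral0_eq => z _; rewrite mule0 mul0e.
have sq0 : (0 < Num.sqrt q)%R by rewrite sqrtr_gt0.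
pose g z := F z * (unit_ball_indic q)%:E * (\1_(`](-1)%R, 1%R[%classic) z)%:E.
have mg : measurable_fun setT g.
  apply: emeasurable_funM; last by apply: mI => //; meas.
  by apply: emeasurable_funM => //.
have g0 z : 0 <= g z by rewrite !mule_ge0// lee_fin.
transitivity (\int[L]_z g ((Num.sqrt q)^-1 * z)%R).
  apply: eq_integral => z _; rewrite /g mulrC; congr (_ * _%:E).
  rewrite !indicE; congr (_%:R); congr nat_of_bool.
  have eqv : (`|(Num.sqrt q)^-1 * z| < 1)%R = (0 < q - z ^+ 2)%R.
    rewrite normrM (@gtr0_norm _ (Num.sqrt q)^-1%R) ?invr_gt0// mulrC.
    by rewrite ltr_pdivrMr// mul1r -sqrtr_sqr ltr_sqrt// subr_gt0.
  apply/idP/idP; rewrite !inE /= !in_itv /= ?andbT -ltr_norml -eqv//.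
rewrite lebesgue_scale ?invr_gt0// invrK -muleA; congr (_ * _).
rewrite [in RHS]integral_mkcond -ge0_integralZl//.
- apply: eq_integral => t _; rewrite /g /patch indicE; case: ifP => _.
    by rewrite mule1 muleC.
  by rewrite !mule0.
- by apply/(measurable_restrictT _ _).1 => //; exact: measurable_funS mF.
- by move=> t _; rewrite /patch; case: ifP.
Qed.

End hat_box.

(** * The uniform measure of the sphere *)
Section uniform_sphere.
Context {R : realType}.
Local Open Scope ereal_scope.
Local Notation L := (@lebesgue_measure R).
Local Notation R3 := (R * R * R)%type.

Definition dir (p : R3) : R3 :=
  let r := Num.sqrt (dot p p) in (p.1.1 / r, p.1.2 / r, p.2 / r)%R.

Lemma measurable_dot d (X : measurableType d) (f g : X -> R3) :
  measurable_fun setT f -> measurable_fun setT g ->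
  measurable_fun setT (fun x => dot (f x) (g x)).
Proof. by move=> mf mg; rewrite /dot; meas. Qed.

Lemma measurable_dir : measurable_fun setT dir.
Proof. by rewrite /dir /dot; meas. Qed.

Lemma dir_sphere (p : R3) : (0 < dot p p)%R -> sphere (dir p).
Proof.
move=> p0; apply/sphereP.
have s0 : (0 < Num.sqrt (dot p p))%R by rewrite sqrtr_gt0.
have sE : (Num.sqrt (dot p p) ^+ 2 = dot p p)%R by rewrite sqr_sqrtr ?ltW.
have -> : dot (dir p) (dir p) = (dot p p / Num.sqrt (dot p p) ^+ 2)%R.
  by rewrite /dir; move: s0; set r := Num.sqrt _ => s0; rewrite /dot /=; field; rewrite gt_eqF.
by rewrite sE divff// gt_eqF.
Qed.

Lemma dot_rot12 (c s : R) (p q : R3) : (c ^+ 2 + s ^+ 2 = 1)%R ->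
  dot (rot12 c s p) (rot12 c s q) = dot p q.
Proof.
move=> cs; have -> : (dot p q = (c ^+ 2 + s ^+ 2) * (p.1.1 * q.1.1 + p.1.2 * q.1.2) + p.2 * q.2)%R.
  by rewrite cs mul1r.
by rewrite /dot /rot12 /=; ring.
Qed.

Lemma dot_rot23 (c s : R) (p q : R3) : (c ^+ 2 + s ^+ 2 = 1)%R ->
  dot (rot23 c s p) (rot23 c s q) = dot p q.
Proof.
move=> cs; have -> : (dot p q = (c ^+ 2 + s ^+ 2) * (p.1.2 * q.1.2 + p.2 * q.2) + p.1.1 * q.1.1)%R.
  by rewrite cs mul1r /dot; ring.
by rewrite /dot /rot23 /=; ring.
Qed.

Lemma dir_rot12 (c s : R) (p : R3) : (c ^+ 2 + s ^+ 2 = 1)%R -> dir (rot12 c s p) = rot12 c s (dir p).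
Proof.
by move=> cs; rewrite /dir dot_rot12// /rot12 /=; congr (_, _, _)%R; rewrite ?mulrA -?mulrBl -?mulrDl.
Qed.

Lemma dir_rot23 (c s : R) (p : R3) : (c ^+ 2 + s ^+ 2 = 1)%R -> dir (rot23 c s p) = rot23 c s (dir p).
Proof.
by move=> cs; rewrite /dir dot_rot23// /rot23 /=; congr (_, _, _)%R; rewrite ?mulrA -?mulrBl -?mulrDl.
Qed.

Lemma sphere_rotE (w : R3) : sphere w -> exists c1 s1 c2 s2 : R,
  [/\ c1 ^+ 2 + s1 ^+ 2 = 1, c2 ^+ 2 + s2 ^+ 2 = 1 &
      w = rot12 c1 s1 (rot23 c2 s2 (0, 0, 1))]%R.
Proof.
move=> /sphereP; rewrite /dot; case: w => -[w1 w2] w3 /= w_.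
have r0 : (0 <= w1 ^+ 2 + w2 ^+ 2)%R by rewrite addr_ge0 ?sqr_ge0.
pose r := Num.sqrt (w1 ^+ 2 + w2 ^+ 2).
have rE : (r ^+ 2 = w1 ^+ 2 + w2 ^+ 2)%R by rewrite sqr_sqrtr.
have c2 : (w3 ^+ 2 + (- r) ^+ 2 = 1)%R by rewrite sqrrN rE -w_; ring.
have [r_0|rN] := eqVneq r 0%R.
  exists 1%R, 0%R, w3, (- r)%R; split => //; first by ring.
  have w10 : w1 = 0%R by move: rE; rewrite r_0 => e; nra.
  have w20 : w2 = 0%R by move: rE; rewrite r_0 => e; nra.
  by rewrite /rot12 /rot23 /= r_0 w10 w20; congr (_, _, _)%R; ring.
exists (w2 / r)%R, (- w1 / r)%R, w3, (- r)%R; split => //.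
  have -> : ((w2 / r) ^+ 2 + (- w1 / r) ^+ 2 = (w1 ^+ 2 + w2 ^+ 2) / r ^+ 2)%R by field.
  by rewrite -rE divff// expf_neq0.
by rewrite /rot12 /rot23 /=; congr (_, _, _)%R; field.
Qed.

(** Archimedes' property over every axis determines the integrals of functions of
    the distance to a fixed point, hence all potentials of the measure. *)
Definition archimedean_sphere (m : probability R3 R) :=
  m (@sphere R) = 1 /\
  forall w, sphere w -> forall F : R -> \bar R, measurable_fun setT F ->
    (forall x, 0 <= F x) ->
    \int[m]_y F (dot y w) = (1/2)%:E * \int[L]_(t in `](-1)%R, 1%R[) F t.

Definition axially_symmetric (m : probability R3 R) :=
  forall (c s : R) (h : R3 -> \bar R), (c ^+ 2 + s ^+ 2 = 1)%R ->
    measurable_fun setT h -> (forall x, 0 <= h x) ->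
    \int[m]_y h (rot12 c s y) = \int[m]_y h y.

(** The radial projection of normalized Lebesgue measure on the ball. Rotations
    about two coordinate axes carry the pole to any point, which extends the
    hat-box theorem from the polar axis to all axes. *)
Lemma uniform_sphere : exists sb : probability R3 R,
  archimedean_sphere sb /\ axially_symmetric sb.
Proof.
have [Z Z0 hatbox] := @ball_hat_box R.
pose g (p : R3) : R := (unit_ball_indic (dot p p) / (Z * 2))%R.
have mball : measurable_fun setT (fun p : R3 => unit_ball_indic (dot p p)).
  apply: (measurableT_comp measurable_ball_indic); exact: measurable_dot.
have mg : measurable_fun setT g by rewrite /g; meas.
have g0 p : (0 <= g p)%R.
  by rewrite /g divr_ge0// ?mulr_ge0 ?ltW// /unit_ball_indic.
have hatg (F : R -> \bar R) : measurable_fun setT F -> (forall x, 0 <= F x) ->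
    \int[L3]_p (F (p.2 / Num.sqrt (dot p p))%R * (g p)%:E) =
    (1/2)%:E * \int[L]_(t in `](-1)%R, 1%R[) F t.
  move=> mF F0.
  have mFb : measurable_fun setT (fun p : R3 => F (p.2 / Num.sqrt (dot p p))%R * (unit_ball_indic (dot p p))%:E).
    apply: emeasurable_funM; last exact/measurable_EFinP.
    by apply: (measurableT_comp mF); rewrite /dot; meas.
  transitivity (\int[L3]_p ((Z * 2)^-1%:E * (F (p.2 / Num.sqrt (dot p p))%R * (unit_ball_indic (dot p p))%:E))).
    apply: eq_integral => p _; rewrite /g EFinM muleA muleC.
    by [].
  rewrite ge0_integralZl//; last 2 first.
  - by move=> p _; rewrite mule_ge0// lee_fin /unit_ball_indic.
  - by rewrite lee_fin invr_ge0 mulr_ge0 ?ltW.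
  rewrite hatbox// muleA -EFinM; congr (_%:E * _).
  by field; rewrite gt_eqF.
have g1 : \int[L3]_p (g p)%:E = 1.
  transitivity (\int[L3]_p (1 * (g p)%:E)).
    by apply: eq_integral => p _; rewrite mul1e.
  rewrite (hatg (fun=> 1))// integral_cst//= lebesgue_measure_itv/= lte_fin.
  rewrite (_ : (-1 < 1 :> R)%R); last by lra.
  by rewrite -EFinB mul1e -EFinM; congr (_%:E); field.
have [sb sbE] := @density_probability _ _ R _ R3 L3 g dir mg g0 measurable_dir g1.
have g_rot12 c s p : (c ^+ 2 + s ^+ 2 = 1)%R -> g (rot12 c s p) = g p.
  by move=> cs; rewrite /g dot_rot12.
have g_rot23 c s p : (c ^+ 2 + s ^+ 2 = 1)%R -> g (rot23 c s p) = g p.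
  by move=> cs; rewrite /g dot_rot23.
have mE (k : R3 -> R3) (h : R3 -> \bar R) : measurable_fun setT k -> measurable_fun setT h ->
   measurable_fun setT (fun p : R3 => h (k (dir p)) * (g p)%:E).
  move=> mk mh; apply: emeasurable_funM; last exact/measurable_EFinP.
  by apply: (measurableT_comp mh); apply: (measurableT_comp mk); exact: measurable_dir.
exists sb; split; first split.
- rewrite -(setIT (sphere (R:=R))) -integral_indic//; last exact: measurable_sphere.
  rewrite sbE//; last first.
    by apply/measurable_EFinP; apply: measurable_indic; exact: measurable_sphere.
  rewrite -[RHS]g1; apply: eq_integral => p _.
  rewrite -EFinM indicE; congr (_%:E).
  have [p0|p0] := ltP 0%R (dot p p).
    by rewrite mem_set ?mul1r//; exact: dir_sphere.
  have -> : g p = 0%R; last by rewrite mulr0.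
  rewrite /g /unit_ball_indic indicE memNset ?mul0r//= in_itv /=.
  by move=> /andP[]; rewrite ltNge p0.
- move=> w wS F mF F0.
  have mFw : measurable_fun setT (fun y : R3 => F (dot y w)).
    by apply: (measurableT_comp mF); exact: measurable_dot.
  rewrite sbE//.
  have [c1 [s1 [c2 [s2 [cs1 cs2 wE]]]]] := sphere_rotE wS.
  have mH : measurable_fun setT (fun p : R3 => F (dot (dir p) w) * (g p)%:E).
    by apply: (mE id (fun y => F (dot y w))) => //; meas.
  have H0 p : 0 <= F (dot (dir p) w) * (g p)%:E by rewrite mule_ge0// lee_fin.
  rewrite -(L3_rot12 mH H0 cs1).
  have mH1 : measurable_fun setT
      (fun p : R3 => F (dot (dir (rot12 c1 s1 p)) w) * (g (rot12 c1 s1 p))%:E).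
    by apply: (measurableT_comp mH); exact: measurable_rot12.
  rewrite -(L3_rot23 mH1 (fun p => H0 _) cs2) -hatg//.
  apply: eq_integral => p _; rewrite g_rot12// g_rot23//; congr (F _ * _).
  rewrite wE dir_rot12// dir_rot23// dot_rot12// dot_rot23//.
  by rewrite /dot /dir /=; ring.
- move=> c s h cs mh h0.
  have mhr : measurable_fun setT (fun y => h (rot12 c s y)).
    by apply: (measurableT_comp mh); exact: measurable_rot12.
  rewrite !sbE//.
  have mH : measurable_fun setT (fun p : R3 => h (dir p) * (g p)%:E).
    by apply: (mE id h) => //; meas.
  have H0 p : 0 <= h (dir p) * (g p)%:E by rewrite mule_ge0// lee_fin.
  rewrite -(L3_rot12 mH H0 cs); apply: eq_integral => p _.
  by rewrite dir_rot12// g_rot12.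
Qed.

End uniform_sphere.

(** * Newton's theorem *)
Section newton.
Context {R : realType}.
Local Notation L := (@lebesgue_measure R).

Lemma FTC_is_derive (f F : R -> R) (a b : R) : a < b ->
  (forall x, a <= x <= b -> is_derive x 1 F (f x)) ->
  (forall x, a <= x <= b -> {for x, continuous f}) ->
  (\int[L]_(x in `[a, b]) (f x)%:E = (F b - F a)%:E)%E.
Proof.
move=> ab dF cf.
have cF x : a <= x <= b -> {for x, continuous F}.
  move=> /dF [dFx _]; apply: differentiable_continuous.
  exact/derivable1_diffP.
rewrite (@continuous_FTC2 _ f F a b)//.
- apply: continuous_in_subspaceT => x; rewrite inE /= in_itv /=; exact: cf.
- split.
  + by move=> x; rewrite in_itv /= => /andP[? ?]; have [] := dF x; rewrite ?ltW.
  + by apply: cvg_at_right_filter; apply: cF; rewrite lexx ltW.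
  + by apply: cvg_at_left_filter; apply: cF; rewrite lexx ltW.
- move=> x; rewrite in_itv /= => /andP[ax xb].
  have := dF x; rewrite !ltW// => /(_ isT) [_ <-].
  by rewrite derive1E.
Qed.

Lemma is_derive_sqrt_lin (c e x : R) : 0 < c - e * x ->
  is_derive x 1 (fun t => Num.sqrt (c - e * t)) (- e / (2 * Num.sqrt (c - e * x))).
Proof.
move=> h0.
have h1 : is_derive x 1 (fun t : R => c - e * t) (- e).
  by apply: is_derive_eq; rewrite /GRing.scale /=; ring.
have h2 := is_derive1_sqrt h0.
by apply: is_derive_eq (is_derive1_comp _ _) _; rewrite mulrC.
Qed.

Lemma continuous_lin (c e x : R) : {for x, continuous (fun t : R => c - e * t)}.
Proof.
have h1 : is_derive x 1 (fun t : R => c - e * t) (- e).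
  by apply: is_derive_eq; rewrite /GRing.scale /=; ring.
by apply: differentiable_continuous; apply/derivable1_diffP; have [] := h1.
Qed.

Lemma integral_inv_sqrt (c e a b : R) : a < b -> 0 < e -> 0 < c - e * b ->
  (\int[L]_(t in `[a, b]) ((Num.sqrt (c - e * t))^-1)%:E =
   (2 / e * (Num.sqrt (c - e * a) - Num.sqrt (c - e * b)))%:E)%E.
Proof.
move=> ab e0 cb.
have pos x : a <= x <= b -> 0 < c - e * x by move=> /andP[ax xb]; nra.
have hd x : a <= x <= b ->
    is_derive x 1 (fun t => - (2 / e) * Num.sqrt (c - e * t)) (Num.sqrt (c - e * x))^-1.
  move=> xab; have d := is_derive_sqrt_lin (pos x xab).
  apply: is_derive_eq; rewrite /GRing.scale /=.
  have : Num.sqrt (c - e * x) != 0 by rewrite gt_eqF// sqrtr_gt0 pos.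
  by move=> s0; field; rewrite s0 gt_eqF.
rewrite (FTC_is_derive ab hd).
  by congr (_%:E); ring.
move=> x xab; apply: (@continuous_comp _ _ _ _ (@GRing.inv R)).
    apply: continuous_comp; first exact: continuous_lin.
    exact: sqrt_continuous.
  by apply: inv_continuous; rewrite gt_eqF// sqrtr_gt0 pos.
Qed.

Lemma integral_inv_sqrt3 (c e a b : R) : a < b -> 0 < e -> 0 < c - e * b ->
  (\int[L]_(t in `[a, b]) (((c - e * t) * Num.sqrt (c - e * t))^-1)%:E =
   (2 / e * ((Num.sqrt (c - e * b))^-1 - (Num.sqrt (c - e * a))^-1))%:E)%E.
Proof.
move=> ab e0 cb.
have pos x : a <= x <= b -> 0 < c - e * x by move=> /andP[ax xb]; nra.
have hd x : a <= x <= b ->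
    is_derive x 1 (fun t => (2 / e) * (Num.sqrt (c - e * t))^-1)
      ((c - e * x) * Num.sqrt (c - e * x))^-1.
  move=> xab; have d := is_derive_sqrt_lin (pos x xab).
  have s0 : Num.sqrt (c - e * x) != 0 by rewrite gt_eqF// sqrtr_gt0 pos.
  have d1 : is_derive x 1 (fun t => (Num.sqrt (c - e * t))^-1)
     (- (Num.sqrt (c - e * x)) ^- 2 * (- e / (2 * Num.sqrt (c - e * x)))).
    by apply: is_derive_eq (is_deriveV _ _) _.
  apply: is_derive_eq; rewrite /GRing.scale /=.
  rewrite -[X in _ = (X * _)^-1](sqr_sqrtr (ltW (pos _ xab))).
  by field; rewrite s0 gt_eqF.
rewrite (FTC_is_derive ab hd).
  by congr (_%:E); ring.
move=> x xab; have s0 : Num.sqrt (c - e * x) != 0 by rewrite gt_eqF// sqrtr_gt0 pos.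
  apply: (@continuous_comp _ _ _ _ (@GRing.inv R)).
    apply: continuousM; first exact: continuous_lin.
    apply: continuous_comp; first exact: continuous_lin.
    exact: sqrt_continuous.
  by apply: inv_continuous; rewrite mulf_neq0// gt_eqF// pos.
Qed.

End newton.

Section on_sphere.
Context {R : realType}.
Local Open Scope ereal_scope.
Local Notation R3 := (R * R * R)%type.

Lemma ae_on_set d (T : measurableType d) (m : probability T R) (S : set T) (P : T -> Prop) :
  measurable S -> m S = 1 -> (forall x, S x -> P x) -> {ae m, forall x, P x}.
Proof.
move=> mS m1 SP; exists (~` S); split.
- exact: measurableC.
- by rewrite probability_setC// m1 subee.
- by move=> x /= nPx Sx; apply: nPx; exact: SP.
Qed.

Lemma eq_integral_on d (T : measurableType d) (m : probability T R) (S : set T)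
    (f g : T -> \bar R) : measurable S -> m S = 1 ->
  measurable_fun setT f -> measurable_fun setT g ->
  (forall x, 0 <= f x) -> (forall x, 0 <= g x) ->
  (forall x, S x -> f x = g x) -> \int[m]_x f x = \int[m]_x g x.
Proof.
move=> mS m1 mf mg f0 g0 fg; apply: ge0_ae_eq_integral => //.
by apply: (ae_on_set mS m1) => x Sx _; exact: fg.
Qed.

Lemma le_integral_on d (T : measurableType d) (m : probability T R) (S : set T)
    (f g : T -> \bar R) : measurable S -> m S = 1 ->
  measurable_fun setT f -> measurable_fun setT g ->
  (forall x, 0 <= f x) -> (forall x, 0 <= g x) ->
  (forall x, S x -> f x <= g x) -> \int[m]_x f x <= \int[m]_x g x.
Proof.
move=> mS m1 mf mg f0 g0 fg; apply: ae_ge0_le_integral => //.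
by apply: (ae_on_set mS m1) => x Sx _; exact: fg.
Qed.

Lemma kern_sphere (x y : R3) : sphere x -> sphere y ->
  kern x y = ((Num.sqrt (2 - 2 * dot x y))%:E)^-1.
Proof. by move=> xS yS; rewrite /kern enorm3B dist2_sphere. Qed.

Lemma measurable_kernl (x : R3) : measurable_fun setT (kern x).
Proof.
apply: (measurableT_comp measurable_kern (_ : measurable_fun setT (fun y => (x, y)))).
by meas.
Qed.

Lemma dot_le1 (x y : R3) : sphere x -> sphere y -> (-1 <= dot x y <= 1)%R.
Proof.
move=> xS yS; have := dist2_ge0 x y; rewrite dist2_sphere// => h1.
have : (0 <= dot x x + dot y y + 2 * dot x y)%R.
  have -> : (dot x x + dot y y + 2 * dot x y =
    (x.1.1 + y.1.1) ^+ 2 + (x.1.2 + y.1.2) ^+ 2 + (x.2 + y.2) ^+ 2)%R.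
    by rewrite /dot; ring.
  by rewrite !addr_ge0 ?sqr_ge0.
move/sphereP: xS => ->; move/sphereP: yS => -> h2.
by apply/andP; split; lra.
Qed.

Lemma dotC (x y : R3) : dot x y = dot y x.
Proof. by rewrite /dot; ring. Qed.

End on_sphere.

Section newton_theorem.
Context {R : realType}.
Local Open Scope ereal_scope.
Local Notation L := (@lebesgue_measure R).
Local Notation R3 := (R * R * R)%type.

Variables (sb : probability R3 R).
Hypothesis sbU : archimedean_sphere sb.

Lemma integral_itv_oo (f : R -> R) : measurable_fun setT f ->
  \int[L]_(t in `](-1)%R, 1%R[) (f t)%:E = \int[L]_(t in `[(-1)%R, 1%R]) (f t)%:E.
Proof.
move=> mf; rewrite [RHS]integral_itv_bndoo//.
by apply/measurable_EFinP; apply: measurable_funS mf.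
Qed.

(** The height over the axis of [w] is uniform, which leaves an elementary
    integral. *)
Lemma newton_outside (b : R) (w : R3) : (1 < b)%R -> sphere w ->
  \int[sb]_y ((Num.sqrt (1 + b ^+ 2 - 2 * b * dot y w))^-1)%:E = (b^-1)%:E.
Proof.
move=> b1 wS.
have mf : measurable_fun setT (fun t : R => (Num.sqrt (1 + b ^+ 2 - 2 * b * t))^-1)%R by meas.
rewrite (proj2 sbU w wS (fun t => ((Num.sqrt (1 + b ^+ 2 - 2 * b * t))^-1)%:E)).
- rewrite integral_itv_oo// integral_inv_sqrt; [|lra|lra|nra].
  have -> : (1 + b ^+ 2 - 2 * b * -1 = (b + 1) ^+ 2)%R by ring.
  have -> : (1 + b ^+ 2 - 2 * b * 1 = (b - 1) ^+ 2)%R by ring.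
  rewrite !sqrtr_sqr !ger0_norm; [|lra|lra].
  by rewrite -EFinM; congr (_%:E); field; lra.
- exact/measurable_EFinP.
- by move=> x; rewrite lee_fin invr_ge0 sqrtr_ge0.
Qed.

Lemma newton_outside3 (b : R) (w : R3) : (1 < b)%R -> sphere w ->
  \int[sb]_y (((1 + b ^+ 2 - 2 * b * dot y w) * Num.sqrt (1 + b ^+ 2 - 2 * b * dot y w))^-1)%:E
    = ((b * (b ^+ 2 - 1))^-1)%:E.
Proof.
move=> b1 wS.
pose D t : R := (1 + b ^+ 2 - 2 * b * t)%R.
have mf : measurable_fun setT (fun t : R => (D t * Num.sqrt (D t))^-1)%R by rewrite /D; meas.
have D0 t : (0 <= D t * Num.sqrt (D t))%R.
  have [Dt|Dt] := leP 0%R (D t); first by rewrite mulr_ge0 ?sqrtr_ge0.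
  by rewrite ler0_sqrtr ?mulr0// ltW.
rewrite (proj2 sbU w wS (fun t => ((D t * Num.sqrt (D t))^-1)%:E)).
- rewrite integral_itv_oo// /D integral_inv_sqrt3; [|lra|lra|nra].
  have -> : (1 + b ^+ 2 - 2 * b * -1 = (b + 1) ^+ 2)%R by ring.
  have -> : (1 + b ^+ 2 - 2 * b * 1 = (b - 1) ^+ 2)%R by ring.
  rewrite !sqrtr_sqr !ger0_norm; [|lra|lra].
  rewrite -EFinM; congr (_%:E); field.
  by apply/and3P; split; nra.
- exact/measurable_EFinP.
- by move=> x; rewrite lee_fin invr_ge0.
Qed.

(** Integration stops short of the singularity at [w], and the heights kept
    exhaust the interval. *)
Lemma newton_surface (w : R3) : sphere w -> \int[sb]_y kern y w <= 1.
Proof.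
move=> wS.
pose F (t : R) : \bar R := ((Num.sqrt (2 - 2 * t))%:E)^-1.
have mF : measurable_fun setT F by rewrite /F; meas.
have F0 t : 0 <= F t by rewrite /F inve_ge0 lee_fin sqrtr_ge0.
have mFw : measurable_fun setT (fun y => F (dot y w)).
  by apply: (measurableT_comp mF); exact: measurable_dot.
have mk : measurable_fun setT (fun y => kern y w).
  by under eq_fun do rewrite kernC; exact: measurable_kernl.
rewrite (@eq_integral_on _ _ _ sb (@sphere R) _ (fun y => F (dot y w)))//; last 4 first.
- exact: measurable_sphere.
- exact: (proj1 sbU).
- by move=> y; exact: kern_ge0.
- by move=> y yS; rewrite kern_sphere.
rewrite (proj2 sbU w wS F mF F0).
have -> : 1 = (1/2)%:E * 2%:E :> \bar R by rewrite -EFinM; congr (_%:E); field.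
rewrite lee_pmul2l ?lte_fin//.
pose I (n : nat) : set R := `[(-1)%R, (1 - n.+2%:R^-1)%R]%classic.
have IU : `](-1)%R, 1%R[%classic `<=` \bigcup_n I n.
  move=> t /=; rewrite in_itv /= => /andP[t0 t1].
  have e0 : (0 < 1 - t)%R by lra.
  have := @archi_boundP R (1 - t)^-1; rewrite invr_ge0 ltW// => /(_ isT) h.
  set n := Num.bound _ in h.
  exists n => //; rewrite /I /= in_itv /= ltW//=.
  rewrite lerBrDr addrC -lerBrDr -[leRHS]invrK lef_pV2 ?posrE// ?invr_gt0//.
  by rewrite (le_trans (ltW h))// ler_nat ltnW// ltnW.
have nnI : nondecreasing_seq I.
  apply/nondecreasing_seqP => n; apply/subsetPset => t /=; rewrite /I /= !in_itv /= => /andP[-> h] /=.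
  by rewrite (le_trans h)// lerB// lef_pV2 ?posrE// ler_nat.
apply: (@le_trans _ _ (\int[L]_(x in \bigcup_n I n) F x)).
  apply: ge0_subset_integral => //.
  - by apply: bigcupT_measurable => n; exact: measurable_itv.
  - exact: measurable_funTS.
apply: (cvge_le _ (@ge0_nondecreasing_set_cvg_integral _ (measurableTypeR R) R I F L nnI
  (fun n => measurable_itv _) (fun n => measurable_funTS mF) (fun n x _ => F0 x))).
apply: nearW => n; rewrite /I.
have n0 : (0 < n.+2%:R^-1 :> R)%R by rewrite invr_gt0.
have n1 : (n.+2%:R^-1 < 1 :> R)%R by rewrite invf_lt1// ltr1n.
move: (n.+2%:R^-1)%R n0 n1 => e e0 e1.
have pos (u : R) : (u <= 1 - e)%R -> (0 < 2 - 2 * u)%R by move=> ?; lra.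
have -> : \int[L]_(x in `[(-1)%R, (1 - e)%R]) F x =
    \int[L]_(t in `[(-1)%R, (1 - e)%R]) ((Num.sqrt (2 - 2 * t))^-1)%:E.
  apply: eq_integral => t; rewrite inE /= in_itv /= => /andP[_ t1].
  by rewrite /F inver gt_eqF// sqrtr_gt0; exact: pos.
rewrite integral_inv_sqrt; [|lra|lra|lra].
rewrite lee_fin divff// mul1r.
have -> : (2 - 2 * -1 = 2 ^+ 2 :> R)%R by rewrite expr2; ring.
by rewrite sqrtr_sqr ger0_norm// lerBlDr lerDl sqrtr_ge0.
Qed.

End newton_theorem.

(** * Sweeping an exterior charge onto the sphere *)
Section kelvin.
Context {R : realType}.
Local Open Scope ereal_scope.
Local Notation R3 := (R * R * R)%type.

Definition lincomb (a : R) (x : R3) (c : R) (y : R3) : R3 :=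
  (a * x.1.1 + c * y.1.1, a * x.1.2 + c * y.1.2, a * x.2 + c * y.2)%R.

Lemma dot_lincomb a x c y z : dot (lincomb a x c y) z = (a * dot x z + c * dot y z)%R.
Proof. by rewrite /dot /lincomb /=; ring. Qed.

Lemma dist2E (u v : R3) : dist2 u v = (dot u u + dot v v - 2 * dot u v)%R.
Proof. by rewrite /dist2 /dot; ring. Qed.

Variables (x : R3) (b : R).
Hypotheses (xS : sphere x) (b1 : (1 < b)%R).

(** This is [|y - b x|^2] when [y] is on the sphere. *)
Definition poisson_den (y : R3) : R := (1 + b ^+ 2 - 2 * b * dot y x)%R.
(** The inversion centred at [b x] whose power is that of the sphere: it exchanges
    the two points where a line through [b x] meets the sphere. *)
Definition inversion (y : R3) : R3 :=
  let k := ((b ^+ 2 - 1) / poisson_den y)%R in lincomb (b - k * b)%R x k y.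
(** The half-turn about the axis of [x]. *)
Definition axial_refl (y : R3) : R3 := lincomb (2 * dot y x)%R x (-1)%R y.

Let xx : dot x x = 1%R. Proof. exact/sphereP. Qed.

Lemma poisson_den_gt0 y : sphere y -> (0 < poisson_den y)%R.
Proof.
move=> yS; have /andP[_ h] := dot_le1 yS xS.
have -> : (poisson_den y = (b - 1) ^+ 2 + 2 * b * (1 - dot y x))%R.
  by rewrite /poisson_den; ring.
apply: ltr_pwDl; first by rewrite exprn_gt0// subr_gt0.
by apply: mulr_ge0; rewrite ?subr_ge0// mulr_ge0// ltW// (lt_trans _ b1).
Qed.

Lemma inversion_sphere y : sphere y -> sphere (inversion y).
Proof.
move=> yS; apply/sphereP; have D0 := poisson_den_gt0 yS.
move/sphereP : yS => yy.
rewrite /inversion dot_lincomb !(dotC _ (lincomb _ _ _ _)) !dot_lincomb xx yy (dotC x y).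
move: D0; rewrite /poisson_den => D0; field; rewrite gt_eqF//.
Qed.

(** The formula for distances under an inversion, at [y] and at the image of [w]. *)
Lemma dist2_inversion y w : sphere y -> sphere w ->
  dist2 (inversion y) w = (poisson_den w / poisson_den y * dist2 y (inversion w))%R.
Proof.
move=> yS wS; have D0 := poisson_den_gt0 yS; have D0' := poisson_den_gt0 wS.
rewrite !dist2_sphere//; try exact: inversion_sphere.
rewrite /inversion (dotC y) !dot_lincomb (dotC x w) (dotC x y) (dotC w y).
move: D0 D0'; rewrite /poisson_den => D0 D0'; field; rewrite !gt_eqF//.
Qed.

Lemma dist2_inversion_axis y : sphere y ->
  (dist2 x (inversion y) <= (b ^+ 2 - 1) ^+ 2 / (b * poisson_den y))%R.
Proof.
move=> yS; have D0 := poisson_den_gt0 yS.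
rewrite dist2_sphere//; last exact: inversion_sphere.
rewrite (dotC x) /inversion !dot_lincomb xx.
have -> : (2 - 2 * ((b - (b ^+ 2 - 1) / poisson_den y * b) * 1 +
      (b ^+ 2 - 1) / poisson_den y * dot y x) =
    (b ^+ 2 - 1) ^+ 2 / (b * poisson_den y) - (b - 1) ^+ 2 / b)%R.
  have -> : dot y x = ((1 + b ^+ 2 - poisson_den y) / (2 * b))%R.
    by rewrite /poisson_den; field; rewrite gt_eqF// (lt_trans _ b1).
  by field; rewrite !gt_eqF// (lt_trans _ b1).
by rewrite gerBl divr_ge0 ?sqr_ge0// ltW// (lt_trans _ b1).
Qed.

Lemma axial_refl_dotx y : dot (axial_refl y) x = dot y x.
Proof. by rewrite /axial_refl dot_lincomb xx; ring. Qed.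

Lemma axial_refl_norm y : dot (axial_refl y) (axial_refl y) = dot y y.
Proof.
rewrite {1}/axial_refl dot_lincomb (dotC x) axial_refl_dotx (dotC y (axial_refl y)).
by rewrite /axial_refl dot_lincomb (dotC x y); ring.
Qed.

Lemma axial_reflK y : axial_refl (axial_refl y) = y.
Proof.
rewrite {1}/axial_refl axial_refl_dotx /axial_refl /lincomb /=.
by case: y => -[y1 y2] y3; congr (_, _, _)%R => /=; ring.
Qed.

Lemma axial_refl_sphere y : sphere y -> sphere (axial_refl y).
Proof. by move=> /sphereP yy; apply/sphereP; rewrite axial_refl_norm. Qed.

Lemma dist2_axial_refl y w : dist2 (axial_refl y) w = dist2 y (axial_refl w).
Proof.
rewrite !dist2E !axial_refl_norm; congr (_ - 2 * _)%R.
by rewrite (dotC y) /axial_refl !dot_lincomb (dotC x w) (dotC w y) (dotC x y); ring.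
Qed.

Lemma measurable_poisson_den : measurable_fun setT poisson_den.
Proof. by rewrite /poisson_den /dot; meas. Qed.

Lemma measurable_inversion : measurable_fun setT inversion.
Proof.
have mD := measurable_poisson_den.
by rewrite /inversion /lincomb; meas.
Qed.

Lemma measurable_axial_refl : measurable_fun setT axial_refl.
Proof. by rewrite /axial_refl /lincomb /dot; meas. Qed.

End kelvin.

Section test_measure.
Context {R : realType}.
Local Open Scope ereal_scope.
Local Notation R3 := (R * R * R)%type.

Lemma inve_scale (c r : R) : (0 < c)%R ->
  ((c * r)%:E)^-1 = (c^-1)%:E * (r%:E)^-1.
Proof.
move=> c0; rewrite !inver mulf_eq0 gt_eqF//=.
case: ifPn => _; first by rewrite gt0_muley// lte_fin invr_gt0.
by rewrite -EFinM invfM.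
Qed.

Lemma kern_scale (u v u' v' : R3) (c : R) : (0 < c)%R ->
  dist2 u v = (c * dist2 u' v')%R -> kern u v = ((Num.sqrt c)^-1)%:E * kern u' v'.
Proof.
move=> c0 h; rewrite /kern !enorm3B h sqrtrM ?ltW// inve_scale// sqrtr_gt0//.
Qed.

Lemma measurable_kernr (w : R3) : measurable_fun setT (kern^~ w).
Proof. by under eq_fun do rewrite kernC; exact: measurable_kernl. Qed.

Lemma measurable_dist2l (x : R3) : measurable_fun setT (dist2 x).
Proof. by rewrite /dist2; meas. Qed.

(** The uniform measure is given the density [b / |y - b x|], normalized by Newton's
    theorem, moved by the inversion, and averaged with its half-turn about [x].
    The formula for distances makes its potential at [w] equal to [b / |w - b x|]
    times the uniform potential at the image of [w], and reduces the mean of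
    [|x - y|^2] to [newton_outside3]. *)
Lemma test_measure (sb : probability R3 R) (x : R3) (b : R) :
  archimedean_sphere sb -> sphere x -> (1 < b)%R ->
  exists nu : probability R3 R,
  [/\ nu (@sphere R) = 1,
      forall w, sphere w ->
        \int[nu]_y kern y w <= (b / Num.sqrt (poisson_den x b w))%:E,
      \int[nu]_y (dist2 x y)%:E <= (2 * (b - 1))%:E &
      forall h : R3 -> \bar R, measurable_fun setT h -> (forall y, 0 <= h y) ->
        \int[nu]_y h (axial_refl x y) = \int[nu]_y h y].
Proof.
move=> sbU xS b1.
have b0 : (0 < b)%R by rewrite (lt_trans _ b1).
have mS := @measurable_sphere R.
have [sbS sbA] := sbU.
pose D := poisson_den x b.
pose g (y : R3) : R := (b * (Num.sqrt (D y))^-1)%R.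
have mD : measurable_fun setT D by exact: measurable_poisson_den.
have mg : measurable_fun setT g by rewrite /g; meas.
have g0 y : (0 <= g y)%R by rewrite /g mulr_ge0 ?invr_ge0 ?sqrtr_ge0// ltW.
have g1 : \int[sb]_y (g y)%:E = 1.
  transitivity (\int[sb]_y (b%:E * ((Num.sqrt (D y))^-1)%:E)).
    by apply: eq_integral => y _; rewrite EFinM.
  rewrite ge0_integralZl//; last 2 first.
  - by apply/measurable_EFinP; meas.
  - by rewrite lee_fin ltW.
  by rewrite (newton_outside sbU b1 xS) -EFinM divff// gt_eqF.
have mT := measurable_inversion x b; have mA := measurable_axial_refl x.
have [n0 n0E] := @density_probability _ R3 R _ R3 sb g (inversion x b) mg g0 mT g1.
have [n1 [n1A n1E]] := @pushforward_probability _ R3 R _ R3 n0 (axial_refl x) mA.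
have h2 : (0 <= (1 / 2 : R) <= 1)%R by apply/andP; split; lra.
have [nu nuE] := @mixture_probability _ R3 R n0 n1 (1/2) h2.
have half (c : \bar R) : (1 - 1 / 2)%:E * c + (1 / 2)%:E * c = c.
  rewrite -ge0_muleDl ?lee_fin; [|lra|lra].
  by rewrite -EFinD (_ : 1 - 1/2 + 1/2 = 1)%R ?mul1e//; field.
have halfle (c d e : \bar R) : c <= e -> d <= e -> (1 - 1 / 2)%:E * c + (1 / 2)%:E * d <= e.
  by move=> ce de; rewrite -[leRHS]half leeD// lee_wpmul2l// lee_fin; lra.
have intS (n : probability R3 R) : n (@sphere R) = \int[n]_y (\1_(@sphere R) y)%:E.
  by rewrite integral_indic// setIT.
have mI : measurable_fun setT (fun y : R3 => (\1_(@sphere R) y)%:E : \bar R).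
  by apply/measurable_EFinP; exact: measurable_indic.
have n0S : n0 (@sphere R) = 1.
  rewrite intS n0E// -g1.
  apply: (eq_integral_on mS sbS) => //.
  - apply: emeasurable_funM; last exact/measurable_EFinP.
    exact: (measurableT_comp mI mT).
  - exact/measurable_EFinP.
  - by move=> y; rewrite mule_ge0// lee_fin.
  - by move=> y yS; rewrite indicE mem_set ?mul1e//; exact: inversion_sphere.
have n0k w : sphere w -> \int[n0]_y kern y w <= (b / Num.sqrt (D w))%:E.
  move=> wS; have mk := measurable_kernr w.
  have Dw := poisson_den_gt0 xS b1 wS.
  rewrite n0E//; last by move=> y; exact: kern_ge0.
  have c0 : (0 < b / Num.sqrt (D w))%R by rewrite divr_gt0// sqrtr_gt0.
  have TwS := inversion_sphere xS b1 wS.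
  apply: (@le_trans _ _ (\int[sb]_y ((b / Num.sqrt (D w))%:E * kern y (inversion x b w)))).
    apply: (le_integral_on mS sbS).
    - apply: emeasurable_funM; last exact/measurable_EFinP.
      exact: (measurableT_comp mk mT).
    - by apply: measurable_funeM; exact: measurable_kernr.
    - by move=> y; rewrite mule_ge0 ?kern_ge0// lee_fin.
    - by move=> y; rewrite mule_ge0 ?kern_ge0// lee_fin ltW.
    - move=> y yS; have Dy := poisson_den_gt0 xS b1 yS.
      rewrite (@kern_scale _ _ y (inversion x b w) (D w / D y)%R); last 2 first.
      + by rewrite divr_gt0.
      + exact: dist2_inversion.
      rewrite muleAC -EFinM /g.
      rewrite (_ : ((Num.sqrt (D w / D y))^-1 * (b * (Num.sqrt (D y))^-1) = b / Num.sqrt (D w))%R)//.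
      rewrite sqrtrM ?ltW// sqrtrV ?ltW//.
      by field; rewrite !gt_eqF ?sqrtr_gt0.
  have c0' : 0 <= (b / Num.sqrt (D w))%:E by rewrite lee_fin ltW.
  rewrite ge0_integralZl//; last 2 first.
  - exact: measurable_kernr.
  - by move=> y _; exact: kern_ge0.
  by rewrite -[leRHS]mule1 lee_pmul2l ?lte_fin//; exact: newton_surface.
have n0d : \int[n0]_y (dist2 x y)%:E <= (2 * (b - 1))%:E.
  have md : measurable_fun setT (fun y : R3 => (dist2 x y)%:E).
    by apply/measurable_EFinP; exact: measurable_dist2l.
  rewrite n0E//; last by move=> y; rewrite lee_fin dist2_ge0.
  have mN : measurable_fun setT (fun y => ((D y * Num.sqrt (D y))^-1)%:E : \bar R).
    by apply/measurable_EFinP; meas.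
  have N0 y : (0 <= (D y * Num.sqrt (D y))^-1)%R.
    rewrite invr_ge0; have [Dt|Dt] := leP 0%R (D y); first by rewrite mulr_ge0 ?sqrtr_ge0.
    by rewrite ler0_sqrtr ?mulr0// ltW.
  apply: (@le_trans _ _ (\int[sb]_y (((b ^+ 2 - 1) ^+ 2)%:E * ((D y * Num.sqrt (D y))^-1)%:E))).
    apply: (le_integral_on mS sbS).
    - apply: emeasurable_funM; last exact/measurable_EFinP.
      exact: (measurableT_comp md mT).
    - exact: measurable_funeM.
    - by move=> y; rewrite mule_ge0 ?lee_fin ?dist2_ge0.
    - by move=> y; rewrite mule_ge0// lee_fin ?sqr_ge0.
    - move=> y yS; have Dy := poisson_den_gt0 xS b1 yS.
      rewrite -!EFinM lee_fin.
      apply: (le_trans (ler_wpM2r (g0 y) (dist2_inversion_axis xS b1 yS))).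
      rewrite /g -/(D y) le_eqVlt; apply/orP; left; apply/eqP.
      by field; rewrite !gt_eqF ?sqrtr_gt0.
  rewrite ge0_integralZl//; last 2 first.
  - by move=> y _; rewrite lee_fin.
  - by rewrite lee_fin sqr_ge0.
  rewrite (newton_outside3 sbU b1 xS) -EFinM lee_fin.
  have b21 : (0 < b ^+ 2 - 1)%R by rewrite subr_gt0 expr2; nra.
  rewrite (_ : ((b ^+ 2 - 1) ^+ 2 * (b * (b ^+ 2 - 1))^-1 = (b ^+ 2 - 1) / b)%R); last first.
    by field; rewrite !gt_eqF.
  by rewrite ler_pdivrMr// expr2; nra.
exists nu; split.
- have -> : nu (@sphere R) = \int[nu]_y (\1_(@sphere R) y)%:E by exact: intS.
  rewrite nuE// n1E//.
  suff -> : \int[n0]_y (\1_(@sphere R) (axial_refl x y))%:E = \int[n0]_y (\1_(@sphere R) y)%:E.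
    by rewrite half -intS.
  apply: eq_integral => y _; congr (_%:E); rewrite !indicE; congr (_%:R); congr nat_of_bool.
  apply/idP/idP; rewrite !inE => yS; last exact: axial_refl_sphere.
  by rewrite -(axial_reflK xS y); exact: axial_refl_sphere.
- move=> w wS; have mk := measurable_kernr w.
  rewrite nuE//; last by move=> y; exact: kern_ge0.
  apply: halfle; first exact: n0k.
  rewrite n1E//; last by move=> y; exact: kern_ge0.
  rewrite (eq_integral (fun y => kern y (axial_refl x w))); last first.
    by move=> y _; rewrite /kern !enorm3B dist2_axial_refl.
  apply: le_trans (n0k _ (axial_refl_sphere xS wS)) _.
  by rewrite /D /poisson_den axial_refl_dotx.
- have md : measurable_fun setT (fun y : R3 => (dist2 x y)%:E).
    by apply/measurable_EFinP; exact: measurable_dist2l.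
  have d0 y : 0 <= (dist2 x y)%:E by rewrite lee_fin dist2_ge0.
  rewrite nuE//; apply: halfle => //.
  rewrite n1E// (eq_integral (fun y => (dist2 x y)%:E))// => y _.
  congr (_%:E); rewrite dist2C dist2_axial_refl// dist2C /axial_refl.
  congr dist2; rewrite (proj1 (sphereP x) xS) /lincomb.
  by case: (x) => -[x1 x2] x3 /=; congr (_, _, _)%R; ring.
- move=> h mh h0.
  have mhA : measurable_fun setT (fun y => h (axial_refl x y)).
    exact: (measurableT_comp mh mA).
  rewrite !nuE// !n1E//.
  have -> : \int[n0]_y h (axial_refl x (axial_refl x y)) = \int[n0]_y h y.
    by apply: eq_integral => y _; rewrite axial_reflK.
  rewrite addeC; congr (_%:E * _ + _%:E * _); lra.
Qed.

End test_measure.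

(** * The variational inequalities *)
Lemma probability_setC0 d (T : measurableType d) (R : realType) (m : probability T R)
  (A : set T) : measurable A -> m A = 1%E -> m (~` A) = 0%E.
Proof. by move=> mA m1; rewrite probability_setC// m1 subee. Qed.

Section variational.
Context {R : realType}.
Local Open Scope ereal_scope.
Local Notation R3 := (R * R * R)%type.
Local Notation S := (@sphere R).

Definition potential (m : probability R3 R) (x : R3) : \bar R := \int[m]_y kern x y.
Definition mutual (m1 m2 : probability R3 R) : \bar R := \int[m1]_x potential m2 x.

Lemma potential_ge0 m x : 0 <= potential m x.
Proof. by apply: integral_ge0 => y _; exact: kern_ge0. Qed.

Lemma measurable_potential m : measurable_fun setT (potential m).
Proof.
exact: (@measurable_fun_fubini_tonelli_F _ _ _ _ _ m (fun p => kern p.1 p.2)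
  measurable_kern (fun p => kern_ge0 p.1 p.2)).
Qed.

Lemma mutual_ge0 m1 m2 : 0 <= mutual m1 m2.
Proof. by apply: integral_ge0 => y _; exact: potential_ge0. Qed.

Lemma mutualC m1 m2 : mutual m1 m2 = mutual m2 m1.
Proof.
rewrite /mutual /potential.
rewrite (@fubini_tonelli _ _ _ _ _ m1 m2 (fun p => kern p.1 p.2) measurable_kern
  (fun p => kern_ge0 p.1 p.2)).
by apply: eq_integral => y _; apply: eq_integral => x _; rewrite kernC.
Qed.

Lemma integral_carrier d (T : measurableType d) (m : probability T R) (A : set T) (f : T -> \bar R) :
  measurable A -> m A = 1 -> measurable_fun setT f -> (forall x, 0 <= f x) ->
  \int[m]_(x in A) f x = \int[m]_x f x.
Proof.
move=> mA m1 mf f0; rewrite [RHS](@ge0_negligible_integral _ _ _ m setT (~` A))//.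
- by rewrite setTD setCK.
- exact: measurableC.
- exact: probability_setC0.
Qed.

Lemma energyE (m : probability R3 R) : unit_measure m -> energy m = mutual m m.
Proof.
move=> mS; have meS := @measurable_sphere R.
transitivity (\int[m]_(x in S) potential m x).
  apply: eq_integral => x _; apply: (integral_carrier meS mS).
    exact: measurable_kernl.
  by move=> y; exact: kern_ge0.
apply: (integral_carrier meS mS); first exact: measurable_potential.
by move=> x; exact: potential_ge0.
Qed.

Variables (Q : R3 -> \bar R) (mu : probability R3 R).
Hypotheses (Q0 : forall x, S x -> 0 <= Q x) (mQ : measurable_fun S Q).
Hypotheses (mumin : extremal_measure Q mu) (mufin : weighted_energy Q mu < +oo).

(** The field is extended by 0, its values off the sphere being arbitrary, so that
    its integrals can run over the whole space. *)
Definition sphere_field : R3 -> \bar R := Q \_ S.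
Let Qs := sphere_field.

Lemma sphere_field_ge0 x : 0 <= Qs x.
Proof. by apply: erestrict_ge0. Qed.

Lemma measurable_sphere_field : measurable_fun setT Qs.
Proof. by apply/(measurable_restrictT _ _).1 => //; exact: measurable_sphere. Qed.

Lemma weighted_energyE (m : probability R3 R) : unit_measure m ->
  weighted_energy Q m = mutual m m + 2%:E * \int[m]_x Qs x.
Proof.
move=> mS; rewrite /weighted_energy energyE//; congr (_ + _ * _).
by rewrite integral_mkcond.
Qed.

Let intQ0 (m : probability R3 R) : 0 <= \int[m]_x Qs x.
Proof. by apply: integral_ge0 => x _; exact: sphere_field_ge0. Qed.

Lemma finite_energy : mutual mu mu \is a fin_num /\ \int[mu]_x Qs x \is a fin_num.
Proof.
have [muS _] := mumin; move: mufin; rewrite weighted_energyE//.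
rewrite !ge0_fin_numE ?mutual_ge0//.
move: (mutual_ge0 mu mu) (intQ0 mu).
case: (mutual mu mu) => [a||] //=; case: (\int[mu]_x Qs x) => [q||] //= _ _.
- by rewrite !ltry.
- by rewrite gt0_muley ?lte_fin// addey.
- by rewrite gt0_muley ?lte_fin// addey.
Qed.

(** The modified Robin constant: the multiplier of the constraint of unit mass. *)
Definition robin_constant : R := fine (mutual mu mu) + fine (\int[mu]_x Qs x).

Lemma robin_constantE : robin_constant%:E = mutual mu mu + \int[mu]_x Qs x.
Proof. by have [? ?] := finite_energy; rewrite /robin_constant EFinD !fineK. Qed.

Lemma robin_constant_ge0 : (0 <= robin_constant)%R.
Proof. by rewrite -lee_fin robin_constantE adde_ge0// mutual_ge0. Qed.

(** The weighted energy along the segment from [mu] to [nu] is a quadratic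
    polynomial in the parameter, minimal at 0, and its derivative there is twice
    the difference of the two sides. *)
Lemma first_variation (nu : probability R3 R) : unit_measure nu ->
  mutual nu nu < +oo -> \int[nu]_x Qs x < +oo ->
  robin_constant%:E <= \int[nu]_x (potential mu x + Qs x).
Proof.
move=> nuS dfin pfin; have [muS mumin'] := mumin.
have [afin qfin] := finite_energy.
have mP := measurable_potential; have mQs := measurable_sphere_field.
rewrite ge0_integralD//; last 2 first.
- by move=> x _; exact: potential_ge0.
- by move=> x _; exact: sphere_field_ge0.
rewrite -/(mutual nu mu).
case: (ltP (mutual nu mu) +oo) => [cfin|]; last first.
  by rewrite leye_eq => /eqP ->; rewrite addye ?leey// gt_eqF// (lt_le_trans _ (intQ0 nu)).
have num (z : \bar R) : 0 <= z -> z < +oo -> exists2 r : R, z = r%:E & (0 <= r)%R.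
  by case: z => [r||]// r0 _; exists r.
have afin' : mutual mu mu < +oo by rewrite -ge0_fin_numE// mutual_ge0.
have qfin' : \int[mu]_x Qs x < +oo by rewrite -ge0_fin_numE.
have [a aE a0] := num _ (mutual_ge0 mu mu) afin'.
have [q qE q0] := num _ (intQ0 mu) qfin'.
have [c cE c0] := num _ (mutual_ge0 nu mu) cfin.
have [e eE e0] := num _ (mutual_ge0 nu nu) dfin.
have [p pE p0] := num _ (intQ0 nu) pfin.
rewrite robin_constantE aE qE cE pE -!EFinD lee_fin.
have key (t : R) : (0 <= t <= 1)%R ->
   (a + 2 * q <= (1 - t) ^+ 2 * a + 2 * t * (1 - t) * c + t ^+ 2 * e +
      2 * ((1 - t) * q + t * p))%R.
  move=> t01; have [r rE] := @mixture_probability _ _ R mu nu t t01.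
  have [t0 t1] := andP t01.
  have rS : unit_measure r.
    have intS (n : probability R3 R) : n S = \int[n]_y (\1_S y)%:E.
      by rewrite integral_indic// ?setIT//; exact: measurable_sphere.
    have rSE : r S = (1 - t)%:E * mu S + t%:E * nu S.
      rewrite !intS rE//; apply/measurable_EFinP; apply: measurable_indic.
      exact: measurable_sphere.
    by rewrite /unit_measure rSE muS nuS !mule1 -EFinD subrK.
  have : weighted_energy Q mu <= weighted_energy Q r.
    by rewrite mumin'; apply: ereal_inf_lbound; exists r.
  rewrite !weighted_energyE// aE qE.
  have -> : \int[r]_x Qs x = ((1 - t) * q + t * p)%:E.
    by rewrite rE ?qE ?pE -?EFinM -?EFinD// => x; exact: sphere_field_ge0.
  have pot x : potential r x = (1 - t)%:E * potential mu x + t%:E * potential nu x.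
    rewrite /potential rE//; first exact: measurable_kernl.
    by move=> y; exact: kern_ge0.
  have -> : mutual r r = ((1 - t) ^+ 2 * a + 2 * t * (1 - t) * c + t ^+ 2 * e)%:E.
    rewrite {1}/mutual rE//; last by move=> x; exact: potential_ge0.
    have mixed (n : probability R3 R) :
        \int[n]_x potential r x = (1 - t)%:E * mutual n mu + t%:E * mutual n nu.
      rewrite (eq_integral (fun x => (1 - t)%:E * potential mu x + t%:E * potential nu x)); last first.
        by move=> x _; rewrite pot.
      rewrite ge0_integralD//; last 4 first.
      - by move=> x _; rewrite mule_ge0 ?potential_ge0// lee_fin subr_ge0.
      - exact: measurable_funeM.
      - by move=> x _; rewrite mule_ge0 ?potential_ge0// lee_fin.
      - exact: measurable_funeM.
      rewrite !ge0_integralZl ?lee_fin ?subr_ge0//; by move=> x _; exact: potential_ge0.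
    rewrite !mixed aE (mutualC mu nu) cE eE.
    do ![rewrite -EFinM|rewrite -EFinD]; congr (_%:E); ring.
  by rewrite -!EFinM -!EFinD lee_fin.
rewrite leNgt; apply/negP => K0.
pose K := (c + p - (a + q))%R; have {}K0 : (K < 0)%R by rewrite /K; lra.
pose M := (a - 2 * c + e)%R.
have key2 (t : R) : (0 < t <= 1)%R -> (0 <= 2 * K + t * M)%R.
  move=> /andP[t0 t1]; have := key t; rewrite (ltW t0) t1 => /(_ isT) h.
  have : (0 <= t * (2 * K + t * M))%R.
    rewrite (_ : t * (2 * K + t * M) = ((1 - t) ^+ 2 * a + 2 * t * (1 - t) * c + t ^+ 2 * e +
      2 * ((1 - t) * q + t * p)) - (a + 2 * q))%R; first by rewrite subr_ge0.
    by rewrite /K /M; ring.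
  by rewrite pmulr_rge0.
have [M0|M0] := leP M 0%R.
  have := key2 1%R; rewrite ltr01 lexx => /(_ isT); lra.
(* For this [t] the quadratic term compensates at most half of the linear one. *)
pose t := Num.min 1%R (- K / M)%R.
have t0 : (0 < t)%R by rewrite lt_min ltr01 divr_gt0// oppr_gt0.
have := key2 t; rewrite t0 ge_min lexx => /(_ isT).
have : (t * M <= - K)%R by rewrite -ler_pdivlMr// ge_min lexx orbT.
lra.
Qed.

(** The first variation for [nu] conditioned on [B]; its energy is finite because
    its density with respect to [nu] is bounded. *)
Lemma first_variation_restr (nu : probability R3 R) (B : set R3) : unit_measure nu ->
  mutual nu nu < +oo -> measurable B -> \int[nu]_(x in B) Qs x < +oo ->
  robin_constant%:E * nu B <= \int[nu]_(x in B) (potential mu x + Qs x).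
Proof.
move=> nuS dfin mB pfin.
have mP := measurable_potential; have mQs := measurable_sphere_field.
have mF : measurable_fun setT (fun x => potential mu x + Qs x).
  by apply: emeasurable_funD.
have F0 x : 0 <= potential mu x + Qs x by rewrite adde_ge0 ?potential_ge0 ?sphere_field_ge0.
have [->|nuB] := eqVneq (nu B) 0; first by rewrite mule0 integral_ge0.
have nuBfin : nu B \is a fin_num by exact: fin_num_measure.
pose v := fine (nu B).
have vE : nu B = v%:E by rewrite fineK.
have v0 : (0 < v)%R by rewrite -lte_fin -vE lt0e nuB measure_ge0.
have int1 : \int[nu]_(x in B) 1 = v%:E.
  by rewrite integral_cst// mul1e; exact: vE.
have [n nE] := conditional_probability mB nuB; rewrite -/v in nE.
have vi : 0 <= (v^-1)%:E by rewrite lee_fin invr_ge0 ltW.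
have nle (h : R3 -> \bar R) : measurable_fun setT h -> (forall x, 0 <= h x) ->
    \int[n]_x h x <= (v^-1)%:E * \int[nu]_x h x.
  move=> mh h0; rewrite nE// lee_wpmul2l//; apply: ge0_subset_integral => //.
have nS : unit_measure n.
  have mI : measurable_fun setT (fun y : R3 => (\1_S y)%:E : \bar R).
    by apply/measurable_EFinP; apply: measurable_indic; exact: measurable_sphere.
  rewrite /unit_measure -(setIT S) -integral_indic//; last exact: measurable_sphere.
  rewrite nE// (@ge0_negligible_integral _ _ _ nu B (~` S))//; last 3 first.
  - by apply: measurableC; exact: measurable_sphere.
  - exact: measurable_funS mI.
  - by apply: probability_setC0 => //; exact: measurable_sphere.
  have -> : \int[nu]_(x in B `\` ~` S) (\1_S x)%:E = \int[nu]_(x in B `\` ~` S) 1.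
    apply: eq_integral => x; rewrite inE /= => -[_ /contrapT xS].
    by rewrite indicE mem_set.
  rewrite -(@ge0_negligible_integral _ _ _ nu B (~` S))//; last 2 first.
  - by apply: measurableC; exact: measurable_sphere.
  - by apply: probability_setC0 => //; exact: measurable_sphere.
  by rewrite int1 -EFinM mulVf// gt_eqF.
have fin_scale z : 0 <= z -> z < +oo -> (v^-1)%:E * z < +oo.
  by case: z => [r||]// _ _; rewrite -EFinM ltry.
have nn : mutual n n < +oo.
  apply: le_lt_trans (fin_scale _ _ (fin_scale _ (mutual_ge0 nu nu) dfin)); last first.
    by rewrite mule_ge0// mutual_ge0.
  rewrite {1}/mutual; apply: (le_trans (nle _ (mP _) (potential_ge0 _))).
  rewrite lee_wpmul2l// -ge0_integralZl//; last by move=> x _; exact: potential_ge0.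
  apply: ge0_le_integral => //.
  - by move=> x _; exact: potential_ge0.
  - exact: measurable_funeM.
  - move=> x _; apply: nle; first exact: measurable_kernl.
    by move=> y; exact: kern_ge0.
have nQ : \int[n]_x Qs x < +oo.
  rewrite nE//; last exact: sphere_field_ge0.
  by apply: fin_scale => //; apply: integral_ge0 => x _; exact: sphere_field_ge0.
have := first_variation nS nn nQ; rewrite nE// => h.
rewrite vE muleC -[leRHS]mul1e -(_ : v%:E * (v^-1)%:E = 1) -?muleA; last first.
  by rewrite -EFinM divff// gt_eqF.
by rewrite lee_wpmul2l// lee_fin ltW.
Qed.

(** The mean of [potential mu + Q] is the constant itself. On a set where that
    function exceeded the constant by a fixed amount the excess would not be
    compensated, by the first variation on the complement. *)
Lemma potential_le_robin :
  {ae mu, forall x, potential mu x + Qs x <= robin_constant%:E}.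
Proof.
have mP := measurable_potential; have mQs := measurable_sphere_field.
have mF : measurable_fun setT (fun x => potential mu x + Qs x).
  by apply: emeasurable_funD.
have F0 x : 0 <= potential mu x + Qs x by rewrite adde_ge0 ?potential_ge0 ?sphere_field_ge0.
have [muS _] := mumin; have [afin qfin] := finite_energy.
set F := robin_constant.
pose A (n : nat) : set R3 := [set x | (F + n.+1%:R^-1)%:E <= potential mu x + Qs x].
have mA n : measurable (A n).
  by rewrite -[A n]setTI; exact: emeasurable_fun_c_infty.
have A0 n : mu (A n) = 0.
  have mAC : measurable (~` A n) by exact: measurableC.
  have h1 : F%:E * mu (~` A n) <= \int[mu]_(x in ~` A n) (potential mu x + Qs x).
    apply: first_variation_restr => //.
      by rewrite -ge0_fin_numE// mutual_ge0.
    apply: (@le_lt_trans _ _ (\int[mu]_x Qs x)).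
      by apply: ge0_subset_integral => // x _; exact: sphere_field_ge0.
    by rewrite -ge0_fin_numE.
  have h2 : (F + n.+1%:R^-1)%:E * mu (A n) <= \int[mu]_(x in A n) (potential mu x + Qs x).
    rewrite -integral_cst//; apply: ge0_le_integral => //.
    - by move=> x _; rewrite lee_fin addr_ge0 ?robin_constant_ge0.
    - exact: measurable_funS mF.
  have tot : \int[mu]_x (potential mu x + Qs x) = F%:E.
    rewrite ge0_integralD//; last 2 first.
    - by move=> x _; exact: potential_ge0.
    - by move=> x _; exact: sphere_field_ge0.
    by rewrite robin_constantE.
  have split_ : \int[mu]_(x in A n) (potential mu x + Qs x) +
      \int[mu]_(x in ~` A n) (potential mu x + Qs x) = F%:E.
    rewrite -tot -ge0_integral_setU//; first by rewrite setUv.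
    - by rewrite setUv.
    - by apply/disj_set2P; rewrite setICr.
  have v1 := fin_num_measure mu (A n) (mA n).
  have : (F + n.+1%:R^-1)%:E * mu (A n) + F%:E * mu (~` A n) <= F%:E.
    by rewrite -[leRHS]split_ leeD.
  rewrite probability_setC// -(fineK v1) -EFinB -!EFinM -EFinD lee_fin => h3.
  have v0 : (0 <= fine (mu (A n)))%R by exact: fine_ge0.
  have e0 : (0 < n.+1%:R^-1 :> R)%R by rewrite invr_gt0.
  congr (_%:E); apply/eqP; rewrite eq_le v0 andbT.
  move: (n.+1%:R^-1)%R e0 (fine _) v0 h3 => e e0 v v0 h3; nra.
apply: (@negligibleS _ _ _ mu (\bigcup_n A n)); last first.
  by apply: negligible_bigcup => n; exists (A n); split => //; exact: A0.
- move=> x /= /negP; rewrite -ltNge => Fx.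
  have [e e0 he] : exists2 e : R, (0 < e)%R & (F + e)%:E <= potential mu x + Qs x.
    move: Fx; case: (potential mu x + Qs x) => [r||]// Fx.
      by exists (r - F)%R; [rewrite subr_gt0 -lte_fin|rewrite lee_fin subrKC].
    by exists 1%R => //; rewrite leey.
  exists (Num.bound e^-1) => //=; apply: le_trans he; rewrite lee_fin lerD2l.
  rewrite invf_ple ?posrE//; rewrite (le_trans (ltW (archi_boundP _)))// ?invr_ge0 ?ltW//.
  by rewrite ltr_nat.
Qed.

End variational.

(** * Open sets, supports and semicontinuous functions *)
Lemma negligible_countable_bigcup d (T : sigmaRingType d) (R : realFieldType)
    (mu : {measure set T -> \bar R}) (I : countType) (F : I -> set T) :
  (forall i, mu.-negligible (F i)) -> mu.-negligible (\bigcup_i F i).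
Proof.
move=> mF; pose G n := if choice.unpickle n is Some i then F i else set0.
apply: (@negligibleS _ _ _ mu (\bigcup_n G n)).
  by move=> x [i _ ix]; exists (choice.pickle i); rewrite // /G choice.pickleK.
apply: negligible_bigcup => n; rewrite /G.
by case: choice.unpickle => [i|]; [exact: mF|exact: negligible_set0].
Qed.

Section topology3.
Context {R : realType}.
Local Notation R3 := (R * R * R)%type.
Local Notation S := (@sphere R).

Definition box (q : R3) (r : R) : set R3 :=
  [set y | [/\ `|y.1.1 - q.1.1| < r, `|y.1.2 - q.1.2| < r & `|y.2 - q.2| < r]].

Lemma measurable_box q r : measurable (box q r).
Proof.
rewrite (_ : box q r = [set y : R3 | `|y.1.1 - q.1.1| < r] `&`
  ([set y | `|y.1.2 - q.1.2| < r] `&` [set y | `|y.2 - q.2| < r])); last first.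
  by apply/seteqP; split => y /= => [[? ? ?]|[? [? ?]]].
have mlt (f : R3 -> R) : measurable_fun setT f -> measurable [set y | `|f y| < r].
  move=> mf; rewrite (_ : [set y | _] = f @^-1` `](- r), r[%classic).
    exact: meas_preimage.
  by apply/seteqP; split => y /=; rewrite in_itv /= ltr_norml.
by apply: measurableI; [|apply: measurableI]; apply: mlt; meas.
Qed.

Lemma boxP (x : R3) (U : set R3) :
  nbhs x U <-> exists2 r, 0 < r & box x r `<=` U.
Proof.
split => [/nbhs_ballP[r /= r0 rU]|[r r0 rU]].
  exists r => // y [h1 h2 h3]; apply: rU; split => /=; [split|] => /=;
    by rewrite /ball /= distrC.
apply/nbhs_ballP; exists r => //= y [[/= h1 h2] h3]; apply: rU.
by split; rewrite distrC.
Qed.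

Definition rat_box (i : (rat * rat * rat) * nat) : set R3 :=
  box (ratr i.1.1.1, ratr i.1.1.2, ratr i.1.2) (i.2.+1%:R^-1).

Lemma rat_approx (x e : R) : 0 < e -> exists q : rat, `|x - ratr q| < e.
Proof.
move=> e0; have : x - e < x + e by lra.
move=> /rat_in_itvoo[q]; rewrite in_itv /= => h; exists q.
by rewrite distrC ltr_distl.
Qed.

Lemma rat_boxP (x : R3) (U : set R3) : nbhs x U ->
  exists i, rat_box i x /\ rat_box i `<=` U.
Proof.
move=> /boxP[r r0 rU].
pose n := Num.bound (2 / r).
have n0 : (0 < n.+1%:R^-1 :> R) by rewrite invr_gt0.
have nr : 2 * n.+1%:R^-1 < r.
  rewrite ltr_pdivrMr// -ltr_pdivrMl// mulrC.
  apply: lt_trans (archi_boundP _) _; first by rewrite divr_ge0// ltW.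
  by rewrite ltr_nat.
have [q1 h1] := rat_approx x.1.1 n0.
have [q2 h2] := rat_approx x.1.2 n0.
have [q3 h3] := rat_approx x.2 n0.
exists ((q1, q2, q3), n); split; first by split.
move=> y [/= k1 k2 k3]; apply: rU.
have tri (a b c : R) : `|b - c| < n.+1%:R^-1 -> `|a - c| < n.+1%:R^-1 -> `|a - b| < r.
  move=> bc ac; rewrite (le_lt_trans (ler_distD c _ _))//.
  by rewrite (lt_trans _ nr)// mulr_natl mulr2n ltrD// distrC.
by split; [exact: tri h1 k1|exact: tri h2 k2|exact: tri h3 k3].
Qed.

Lemma open_rat_boxE (U : set R3) : open U ->
  U = \bigcup_(i in [set i | rat_box i `<=` U]) rat_box i.
Proof.
move=> oU; apply/seteqP; split => x.
  move=> Ux; have [i [ix iU]] := rat_boxP (open_nbhs_nbhs (conj oU Ux)).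
  by exists i.
by move=> [i iU ix]; exact: iU.
Qed.

Lemma open_measurable3 (U : set R3) : open U -> measurable U.
Proof.
move=> oU; rewrite (open_rat_boxE oU) bigcup_mkcond.
apply: countable_bigcupT_measurable => [|i]; first exact: countableP.
by case: ifP => _ //; exact: measurable_box.
Qed.

(** The complement of the support is a union of null boxes from a countable base. *)
Lemma support_null (mu : probability R3 R) : mu (~` measure_support mu) = 0%E.
Proof.
have -> : ~` measure_support mu = \bigcup_(i in [set i | mu (rat_box i) = 0%E]) rat_box i.
  apply/seteqP; split => x.
    rewrite /measure_support /= -existsNP => -[U].
    rewrite not_implyE => -[oU]; rewrite not_implyE => -[Ux /negP].
    rewrite -leNgt => mU0.
    have [i [ix iU]] := rat_boxP (open_nbhs_nbhs (conj oU Ux)).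
    exists i => //=; apply/eqP; rewrite eq_le measure_ge0 andbT.
    apply: le_trans mU0; apply: le_measure => //; rewrite inE.
      exact: measurable_box.
    exact: open_measurable3.
  move=> [i /= mi ix]; rewrite /measure_support /= => h.
  have oi : open (rat_box i).
    rewrite openE => y yi; apply/boxP; move: yi.
    rewrite /rat_box; move: (ratr _, ratr _, ratr _) (_^-1) => q r [k1 k2 k3].
    pose e := Num.min (r - `|y.1.1 - q.1.1|) (Num.min (r - `|y.1.2 - q.1.2|) (r - `|y.2 - q.2|)).
    exists e; first by rewrite !lt_min !subr_gt0 k1 k2 k3.
    have tri (a b c s : R) : `|a - b| < s -> s <= r - `|b - c| -> `|a - c| < r.
      move=> ab sr; rewrite (le_lt_trans (ler_distD b _ _))//.
      by move: (`|a - b|) (`|b - c|) ab sr => u v; lra.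
    move=> z [l1 l2 l3]; split.
    - by apply: tri l1 _; rewrite /e ge_min lexx.
    - by apply: tri l2 _; rewrite /e !ge_min lexx orbT.
    - by apply: tri l3 _; rewrite /e !ge_min lexx !orbT.
  by have := h _ oi ix; rewrite mi ltxx.
apply: measure_negligible.
  rewrite bigcup_mkcond; apply: countable_bigcupT_measurable => [|i]; first exact: countableP.
  by case: ifP => _ //; exact: measurable_box.
rewrite bigcup_mkcond.
apply: (@negligible_countable_bigcup _ _ _ mu (rat * rat * rat * nat)%type) => i.
case: ifPn => [|_]; last exact: negligible_set0.
rewrite inE /= => mi; exists (rat_box i); split => //; exact: measurable_box.
Qed.

Lemma lsc_measurable (Q : R3 -> \bar R) :
  lower_semicontinuous (Q : subspace S -> \bar R) -> measurable_fun S Q.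
Proof.
move=> /lower_semicontinuousP lsc.
have meS := @measurable_sphere R.
apply: (measurability _ (ErealGenOInfty.measurableE R)).
move=> /= _ [_ [r ->]] <-.
have /open_subspaceP[V oV VE] := lsc r.
rewrite (_ : S `&` Q @^-1` _ = V `&` S); last first.
  by rewrite VE setIC preimage_itvoy.
by apply: measurableI => //; exact: open_measurable3.
Qed.

End topology3.

(** * Second differences of a C^2 field on the cap *)
Section second_difference.
Context {R : realType}.
Local Notation R3 := (R * R * R)%type.
Local Notation S := (@sphere R).
Local Notation e1 := ((1, 0, 0) : R3).
Local Notation e2 := ((0, 1, 0) : R3).
Local Notation e3 := ((0, 0, 1) : R3).

(** The coordinates of two points of a box come in either order, and later steps
    compare the intermediate point with the first endpoint. *)
Lemma mvt_unordered (f df : R -> R) (z r a b : R) :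
  (forall t, `|t - z| < r -> is_derive t 1 f (df t)) ->
  `|a - z| < r -> `|b - z| < r ->
  exists c, [/\ `|c - z| < r, `|c - a| <= `|b - a| & f b - f a = df c * (b - a)].
Proof.
move=> dfd.
suff main u v : u <= v -> `|u - z| < r -> `|v - z| < r ->
    exists c, [/\ `|c - z| < r, u <= c <= v & f v - f u = df c * (v - u)].
  move=> az bz; have [ab|/ltW ba] := leP a b.
    have [c [cz /andP[ac cb] fE]] := main a b ab az bz; exists c; split => //.
    by rewrite !ger0_norm ?subr_ge0// lerD2r.
  have [c [cz /andP[bc ca] fE]] := main b a ba bz az; exists c; split => //.
    by rewrite !ler0_norm ?subr_le0// lerN2 lerD2r.
  by rewrite -opprB fE -mulrN opprB.
move=> uv uz vz.
have ball t : u <= t <= v -> `|t - z| < r.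
  move=> /andP[at_ tb]; move: uz vz; rewrite !ltr_norml => /andP[? ?] /andP[? ?].
  by apply/andP; split; lra.
have [||c] := @MVT_segment R f df u v uv.
- move=> t; rewrite in_itv /= => /andP[h1 h2]; apply: dfd; apply: ball.
  by rewrite !ltW.
- apply: continuous_in_subspaceT => t; rewrite inE /= in_itv /= => h.
  have := dfd t (ball t h) => -[d _].
  by apply: differentiable_continuous; apply/derivable1_diffP.
- rewrite in_itv /= => h fE; exists c; split => //; exact: ball.
Qed.

Lemma is_derive_coord1 (f : R3 -> R) (p2 p3 t : R) : derivable f (t, p2, p3) e1 ->
  is_derive t 1 (fun s => f (s, p2, p3)) ('D_e1 f (t, p2, p3)).
Proof.
have E : (fun h : R => h^-1 *: (((fun s => f (s, p2, p3)) \o shift t) (h *: 1) - f (t, p2, p3)))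
   = (fun h : R => h^-1 *: ((f \o shift (t, p2, p3)) (h *: e1) - f (t, p2, p3))).
  apply/funext => h; congr (_ *: (f _ - _)); rewrite /shift /=.
  by rewrite -[RHS]/(h * 1 + t, h * 0 + p2, h * 0 + p3) !mulr0 !add0r.
by move=> df; apply: DeriveDef; rewrite /derivable /derive E.
Qed.

Lemma is_derive_coord2 (f : R3 -> R) (p1 p3 t : R) : derivable f (p1, t, p3) e2 ->
  is_derive t 1 (fun s => f (p1, s, p3)) ('D_e2 f (p1, t, p3)).
Proof.
have E : (fun h : R => h^-1 *: (((fun s => f (p1, s, p3)) \o shift t) (h *: 1) - f (p1, t, p3)))
   = (fun h : R => h^-1 *: ((f \o shift (p1, t, p3)) (h *: e2) - f (p1, t, p3))).
  apply/funext => h; congr (_ *: (f _ - _)); rewrite /shift /=.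
  by rewrite -[RHS]/(h * 0 + p1, h * 1 + t, h * 0 + p3) !mulr0 !add0r.
by move=> df; apply: DeriveDef; rewrite /derivable /derive E.
Qed.

Lemma is_derive_coord3 (f : R3 -> R) (p1 p2 t : R) : derivable f (p1, p2, t) e3 ->
  is_derive t 1 (fun s => f (p1, p2, s)) ('D_e3 f (p1, p2, t)).
Proof.
have E : (fun h : R => h^-1 *: (((fun s => f (p1, p2, s)) \o shift t) (h *: 1) - f (p1, p2, t)))
   = (fun h : R => h^-1 *: ((f \o shift (p1, p2, t)) (h *: e3) - f (p1, p2, t))).
  apply/funext => h; congr (_ *: (f _ - _)); rewrite /shift /=.
  by rewrite -[RHS]/(h * 0 + p1, h * 0 + p2, h * 1 + t) !mulr0 !add0r.
by move=> df; apply: DeriveDef; rewrite /derivable /derive E.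
Qed.

Definition between (p q c : R3) :=
  [/\ `|c.1.1 - p.1.1| <= `|q.1.1 - p.1.1|, `|c.1.2 - p.1.2| <= `|q.1.2 - p.1.2|
    & `|c.2 - p.2| <= `|q.2 - p.2|].

(** The coordinates are moved one at a time, within the box spanned by the two
    points; this locates the intermediate points closely enough for a second use. *)
Lemma mvt3 (f : R3 -> R) (x0 : R3) (r : R) (p q : R3) :
  (forall z, box x0 r z -> [/\ derivable f z e1, derivable f z e2 & derivable f z e3]) ->
  box x0 r p -> box x0 r q ->
  exists c1 c2 c3, [/\ box x0 r c1 /\ between p q c1, box x0 r c2 /\ between p q c2,
    box x0 r c3 /\ between p q c3 & f q - f p = 'D_e1 f c1 * (q.1.1 - p.1.1) +
      'D_e2 f c2 * (q.1.2 - p.1.2) + 'D_e3 f c3 * (q.2 - p.2)].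
Proof.
move=> df; move: p q => [[p1 p2] p3] [[q1 q2] q3] [/= hp1 hp2 hp3] [/= hq1 hq2 hq3].
have [c1 [h1 k1 E1]] := @mvt_unordered (fun s => f (s, p2, p3))
  (fun s => 'D_e1 f (s, p2, p3)) x0.1.1 r p1 q1
  (fun t ht => is_derive_coord1 (let: And3 d _ _ := df (t, p2, p3) (And3 ht hp2 hp3) in d)) hp1 hq1.
have [c2 [h2 k2 E2]] := @mvt_unordered (fun s => f (q1, s, p3))
  (fun s => 'D_e2 f (q1, s, p3)) x0.1.2 r p2 q2
  (fun t ht => is_derive_coord2 (let: And3 _ d _ := df (q1, t, p3) (And3 hq1 ht hp3) in d)) hp2 hq2.
have [c3 [h3 k3 E3]] := @mvt_unordered (fun s => f (q1, q2, s))
  (fun s => 'D_e3 f (q1, q2, s)) x0.2 r p3 q3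
  (fun t ht => is_derive_coord3 (let: And3 _ _ d := df (q1, q2, t) (And3 hq1 hq2 ht) in d)) hp3 hq3.
exists (c1, p2, p3), (q1, c2, p3), (q1, q2, c3).
have z (a : R) : `|a - a| = 0 by rewrite subrr normr0.
split; try by split; split => //=; rewrite z.
by rewrite /= -E1 -E2 -E3; ring.
Qed.

Definition grad_on (x0 : R3) (r M : R) (f : R3 -> R) := forall z, box x0 r z ->
  [/\ derivable f z e1, derivable f z e2 & derivable f z e3] /\
  [/\ `|'D_e1 f z| <= M, `|'D_e2 f z| <= M & `|'D_e3 f z| <= M].

Lemma lin3_bound (M a b c u v w : R) : `|a| <= M -> `|b| <= M -> `|c| <= M ->
  `|a * u + b * v + c * w| <= M * (`|u| + `|v| + `|w|).
Proof.
move=> ha hb hc; rewrite !mulrDr.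
apply: (le_trans (ler_normD _ _)); apply: lerD; last by rewrite normrM ler_wpM2r.
by apply: (le_trans (ler_normD _ _)); apply: lerD; rewrite normrM ler_wpM2r.
Qed.

Lemma lipschitz_box f x0 r M p q : grad_on x0 r M f -> box x0 r p -> box x0 r q ->
  `|f q - f p| <= M * (`|q.1.1 - p.1.1| + `|q.1.2 - p.1.2| + `|q.2 - p.2|).
Proof.
move=> gf hp hq.
have [c1 [c2 [c3 [[h1 _] [h2 _] [h3 _] ->]]]] := mvt3 (fun z hz => proj1 (gf z hz)) hp hq.
have [_ [b1 _ _]] := gf _ h1; have [_ [_ b2 _]] := gf _ h2; have [_ [_ _ b3]] := gf _ h3.
exact: lin3_bound.
Qed.

(** The derivatives of [f] at the intermediate points of [mvt3] are compared with
    those at [p] by the Lipschitz bound. *)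
Lemma taylor_box f x0 r M p q : grad_on x0 r M f ->
  grad_on x0 r M (fun z => 'D_e1 f z) -> grad_on x0 r M (fun z => 'D_e2 f z) ->
  grad_on x0 r M (fun z => 'D_e3 f z) -> box x0 r p -> box x0 r q ->
  `|f q - f p - ('D_e1 f p * (q.1.1 - p.1.1) + 'D_e2 f p * (q.1.2 - p.1.2) + 'D_e3 f p * (q.2 - p.2))|
    <= 3 * M * dist2 p q.
Proof.
move=> gf g1 g2 g3 hp hq.
have M0 : 0 <= M by have [_ [h _ _]] := gf _ hp; rewrite (le_trans _ h).
have [c1 [c2 [c3 [[h1 k1] [h2 k2] [h3 k3] ->]]]] := mvt3 (fun z hz => proj1 (gf z hz)) hp hq.
have bd h c : grad_on x0 r M h -> box x0 r c -> between p q c ->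
    `|h c - h p| <= M * (`|q.1.1 - p.1.1| + `|q.1.2 - p.1.2| + `|q.2 - p.2|).
  move=> gh hc [u1 u2 u3]; apply: (le_trans (lipschitz_box gh hp hc)).
  by rewrite ler_wpM2l// !lerD.
have := bd _ _ g1 h1 k1; have := bd _ _ g2 h2 k2; have := bd _ _ g3 h3 k3.
rewrite /dist2; move: ('D_e1 f c1) ('D_e2 f c2) ('D_e3 f c3) => A1 A2 A3.
move: ('D_e1 f p) ('D_e2 f p) ('D_e3 f p) => B1 B2 B3.
have sq (a b : R) : (a - b) ^+ 2 = `|b - a| ^+ 2 by rewrite real_normK ?num_real// -sqrrN opprB.
rewrite !sq; move: (q.1.1 - p.1.1) (q.1.2 - p.1.2) (q.2 - p.2) => u v w b3 b2 b1.
have -> : A1 * u + A2 * v + A3 * w - (B1 * u + B2 * v + B3 * w) =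
  (A1 - B1) * u + (A2 - B2) * v + (A3 - B3) * w by ring.
apply: (le_trans (lin3_bound _ _ _ b1 b2 b3)).
rewrite (mulrC 3) -!mulrA ler_wpM2l//.
move: `|u| `|v| `|w| => a b c.
have := sqr_ge0 (a - b); have := sqr_ge0 (a - c); have := sqr_ge0 (b - c); nra.
Qed.

Lemma near_bounded (h : R3 -> R) (x0 : R3) : {for x0, continuous h} ->
  \forall z \near x0, `|h z| <= `|h x0| + 1.
Proof.
move=> ch; have := ch; move=> /cvgrPdist_lt /(_ 1 ltr01); apply: filterS => z hz.
have := ler_normD (h z - h x0) (h x0); rewrite subrK distrC => /le_trans; apply.
by rewrite addrC lerD2l ltW// distrC.
Qed.

Lemma C1_grad_on (U : set R3) f x0 : open U -> U x0 -> Ck_on 1 U f ->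
  exists M, \forall r \near 0^'+, grad_on x0 r M f.
Proof.
move=> oU Ux [_ hf].
have m1 : e1 \in basis3 R by rewrite !inE eqxx.
have m2 : e2 \in basis3 R by rewrite !inE eqxx ?orbT.
have m3 : e3 \in basis3 R by rewrite !inE eqxx ?orbT.
have [d1 [c1 _]] := hf _ m1; have [d2 [c2 _]] := hf _ m2; have [d3 [c3 _]] := hf _ m3.
have bd (h : R3 -> R) : {for x0, continuous h} -> exists K : R, \forall z \near x0, `|h z| <= K.
  by move=> ch; exists (`|h x0| + 1); exact: near_bounded.
have [M1 n1] := bd _ (c1 _ Ux); have [M2 n2] := bd _ (c2 _ Ux); have [M3 n3] := bd _ (c3 _ Ux).
have n0 : \forall z \near x0, U z by exact: open_nbhs_nbhs.
exists (Num.max M1 (Num.max M2 M3)).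
have : nbhs x0 [set z | [/\ U z, `|'D_e1 f z| <= M1, `|'D_e2 f z| <= M2 & `|'D_e3 f z| <= M3]].
  near=> z; split; near: z; [exact: n0|exact: n1|exact: n2|exact: n3].
move=> /boxP[r0 r00 hr].
near=> r => z [h1 h2 h3].
have rr : r <= r0 by near: r; exact: nbhs_right_le.
have [Uz b1 b2 b3] := hr z (And3 (lt_le_trans h1 rr) (lt_le_trans h2 rr) (lt_le_trans h3 rr)).
split; first by split; [exact: d1|exact: d2|exact: d3].
split; [apply: le_trans b1 _|apply: le_trans b2 _|apply: le_trans b3 _];
by rewrite !le_max lexx ?orbT.
Unshelve. all: by end_near.
Qed.

Lemma grad_onW x0 r M M' f : M <= M' -> grad_on x0 r M f -> grad_on x0 r M' f.
Proof.
move=> MM h z hz; have [d [b1 b2 b3]] := h z hz.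
by split => //; split; [exact: le_trans b1 MM|exact: le_trans b2 MM|exact: le_trans b3 MM].
Qed.

Lemma Ck_on_pred k U (f : R3 -> R) : Ck_on k.+1 U f -> Ck_on k U f.
Proof.
elim: k f => [|k IH] f [cf hf]; first by split.
split => // e he; have [h1 h2] := hf e he; split => //; exact: IH.
Qed.

Lemma dist2_axial x y : S x -> S y -> dist2 x (axial_refl x y) = dist2 x y.
Proof.
move=> xS yS; have y'S := axial_refl_sphere xS yS.
by rewrite !dist2_sphere// dotC axial_refl_dotx// dotC.
Qed.

Lemma sphere_coord_le1 (x : R3) : S x -> [/\ `|x.1.1| <= 1, `|x.1.2| <= 1 & `|x.2| <= 1].
Proof.
move=> /sphereP; rewrite /dot => e.
have sq (a b c : R) : a * a + b * b + c * c = 1 -> `|a| <= 1.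
  move=> h; rewrite -(@ler_pXn2r _ 2) ?nnegrE// real_normK ?num_real// expr1n expr2.
  by rewrite -h -addrA lerDl addr_ge0// -expr2 sqr_ge0.
move: x.1.1 x.1.2 x.2 e => a b c e.
by split; [apply: (sq _ b c)|apply: (sq _ a c)|apply: (sq _ a b)] => //; rewrite -e; ring.
Qed.

(** As [y + axial_refl x y - 2 x] is [- dist2 x y] times [x], the first-order terms
    do not cancel but are of second order in the distance. *)
Lemma second_difference_box (g : R3 -> R) (U : set R3) (x0 : R3) :
  open U -> U x0 -> Ck_on 2 U g ->
  exists C, \forall r \near 0^'+, 0 <= C /\ forall x y, S x -> S y ->
    box x0 r x -> box x0 r y -> box x0 r (axial_refl x y) ->
    g y + g (axial_refl x y) <= 2 * g x + C * dist2 x y.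
Proof.
move=> oU Ux gU; have [_ hg] := gU.
have m1 : e1 \in basis3 R by rewrite !inE eqxx.
have m2 : e2 \in basis3 R by rewrite !inE eqxx ?orbT.
have m3 : e3 \in basis3 R by rewrite !inE eqxx ?orbT.
have [M0 n0] := C1_grad_on oU Ux (Ck_on_pred gU).
have [M1 n1] := C1_grad_on oU Ux (proj2 (hg _ m1)).
have [M2 n2] := C1_grad_on oU Ux (proj2 (hg _ m2)).
have [M3 n3] := C1_grad_on oU Ux (proj2 (hg _ m3)).
pose M := Num.max (Num.max M0 M1) (Num.max M2 M3).
have [l0 [l1 [l2 l3]]] : M0 <= M /\ M1 <= M /\ M2 <= M /\ M3 <= M.
  by rewrite /M !le_max !lexx ?orbT.
exists (9 * M).
apply: filterS (filterI (filterI (filterI n0 n1) (filterI n2 n3)) (nbhs_right_gt 0)).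
move=> r [[[k0 k1] [k2 k3]] r0].
have g0 := grad_onW l0 k0; have g1 := grad_onW l1 k1.
have g2 := grad_onW l2 k2; have g3 := grad_onW l3 k3.
have Mge : 0 <= M.
  have x0b : box x0 r x0 by split; rewrite subrr normr0.
  by have [_ [h _ _]] := g0 x0 x0b; rewrite (le_trans _ h).
split; first by rewrite mulr_ge0.
move=> x y xS yS hx hy hy'.
have t1 := taylor_box g0 g1 g2 g3 hx hy.
have t2 := taylor_box g0 g1 g2 g3 hx hy'.
have [_ [b1 b2 b3]] := g0 x hx.
have d2 := dist2_axial xS yS.
have dE := dist2_sphere xS yS.
move: t1 t2; rewrite d2 !ler_norml => /andP[_ t1] /andP[_ t2].
have [x1 x2 x3] := sphere_coord_le1 xS.
have bound (a b : R) : `|a| <= M -> `|b| <= 1 -> - (a * b) <= M.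
  move=> ha hb; rewrite (le_trans (ler_norm _))// normrN normrM.
  by rewrite -[leRHS]mulr1 ler_pM.
have {x1}B1 := bound _ _ b1 x1; have {x2}B2 := bound _ _ b2 x2; have {x3}B3 := bound _ _ b3 x3.
have dge := dist2_ge0 x y.
have y2E : [/\ (axial_refl x y).1.1 = (2 - dist2 x y) * x.1.1 - y.1.1,
   (axial_refl x y).1.2 = (2 - dist2 x y) * x.1.2 - y.1.2 &
   (axial_refl x y).2 = (2 - dist2 x y) * x.2 - y.2].
  by rewrite dE dotC /axial_refl /lincomb /=; split; ring.
case: y2E => y1 y2 y3.
move: t1 t2 B1 B2 B3; rewrite y1 y2 y3 => {gU hg m1 m2 m3 n0 n1 n2 n3 g0 g1 g2 g3 k0 k1 k2 k3 l0 l1 l2 l3 bound}.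
move: (g y) (g (axial_refl x y)) (g x) ('D_e1 g x) ('D_e2 g x) ('D_e3 g x) => a b c G1 G2 G3.
move: (dist2 x y) dge => d dge t1 t2 B1 B2 B3.
have H : d * (- (G1 * x.1.1) + - (G2 * x.1.2) + - (G3 * x.2)) <= d * (M + M + M).
  by rewrite ler_wpM2l// !lerD.
have := lerD t1 t2; clear -H.
set l := (X in X <= _ -> _); have -> : l = a + b - 2 * c -
    d * (- (G1 * x.1.1) + - (G2 * x.1.2) + - (G3 * x.2)) by rewrite /l; ring.
rewrite lerBlDr lerBlDr => h; apply: (le_trans h).
rewrite addrC lerD2l; apply: (le_trans (lerD (lexx _) H)).
by rewrite le_eqVlt; apply/orP; left; apply/eqP; ring.
Qed.

Lemma spherical_sphere (t p : R) : S (spherical 1 t p).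
Proof.
apply/sphereP; rewrite /dot /spherical /= !mul1r.
have := cos2Dsin2 t; have := cos2Dsin2 p; rewrite !expr2.
move: (cos t) (sin t) (cos p) (sin p) => a b c d h1 h2.
have -> : d * a * (d * a) + d * b * (d * b) + c * c = d * d * (a * a + b * b) + c * c by ring.
by rewrite h2 mulr1 addrC.
Qed.

Lemma compact_south_cap (alpha : R) : compact (@south_cap R alpha).
Proof.
have -> : @south_cap R alpha =
    (fun p : R * R => spherical 1 p.1 p.2) @` (`[0, 2 * pi] `*` `[alpha, pi]).
  apply/seteqP; split => x.
    by move=> [t [p [h1 h2 ->]]]; exists (t, p) => //; split; rewrite /= in_itv.
  by move=> [[t p] [/= h1 h2] <-]; exists t, p; move: h1 h2; rewrite !in_itv.
apply: continuous_compact; last by apply: compact_setX; exact: segment_compact.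
apply: continuous_subspaceT => p; rewrite /spherical.
have c1 : {for p, continuous (fun p : R * R => p.1)} by exact: cvg_fst.
have c2 : {for p, continuous (fun p : R * R => p.2)} by exact: cvg_snd.
have s1 : {for p, continuous (fun p : R * R => sin p.1)}.
  by apply: continuous_comp => //; exact: continuous_sin.
have s2 : {for p, continuous (fun p : R * R => sin p.2)}.
  by apply: continuous_comp => //; exact: continuous_sin.
have k1 : {for p, continuous (fun p : R * R => cos p.1)}.
  by apply: continuous_comp => //; exact: continuous_cos.
have k2 : {for p, continuous (fun p : R * R => cos p.2)}.
  by apply: continuous_comp => //; exact: continuous_cos.
have m (f : R * R -> R) : {for p, continuous f} -> {for p, continuous (fun p => 1 * f p)}.
  by move=> cf; apply: continuousM => //; exact: cvg_cst.
have pairc : forall (A B : topologicalType) (f : R * R -> A) (g : R * R -> B),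
    {for p, continuous f} -> {for p, continuous g} -> {for p, continuous (fun p => (f p, g p))}.
  by move=> A B f g cf cg; exact: (cvg_pair cf cg).
apply: (pairc); last exact: m.
by apply: (pairc); apply: continuousM => //; exact: m.
Qed.

(** Finiteness of [Q] at the three points is part of the statement. *)
Definition second_difference (Q : R3 -> \bar R) (C : R) (x y : R3) : Prop :=
  exists a b c, [/\ Q x = c%:E, Q y = a%:E, Q (axial_refl x y) = b%:E &
    a + b <= 2 * c + C * dist2 x y].

Lemma dist2_box (x y : R3) (r : R) : 0 < r -> dist2 x y < r ^+ 2 -> @box R x r y.
Proof.
move=> r0 h.
have sq (a b c d : R) : (a - b) ^+ 2 <= dist2 x y -> `|b - a| < r.
  move=> ab; rewrite -(@ltr_pXn2r _ 2) ?nnegrE//; last exact: ltW.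
  by rewrite real_normK ?num_real// -sqrrN opprB (le_lt_trans ab).
by split; apply: sq; rewrite // /dist2 ?lerDr ?lerDl ?addr_ge0 ?sqr_ge0// -addrA ?lerDl ?addr_ge0 ?sqr_ge0// addrCA lerDl addr_ge0 ?sqr_ge0.
Qed.

(** Compactness of the cap makes the local bounds uniform. *)
Lemma second_difference_cap (Q : R3 -> \bar R) (alpha : R) (N : set R3) :
  open_in_sphere N -> south_cap alpha `<=` N -> C2_on_sphere N Q ->
  exists2 C, 0 < C & forall x y, south_cap alpha x -> S y -> dist2 x y < C^-1 ->
    second_difference Q C x y.
Proof.
move=> [V oV NE] capN C2.
pose P (C : R) (x : R3) := 0 < C /\ (S x -> forall y, S y -> dist2 x y < C^-1 ->
   second_difference Q C x y).
have /compact_near_coveringP/(_ R (pinfty_nbhs R) P) := @compact_south_cap alpha.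
case.
  move=> x0 cx0; have Nx0 := capN _ cx0.
  have [U [g [oU Ux0 gU gQ]]] := C2 _ Nx0.
  have [C0 hC0] := second_difference_box oU Ux0 gU.
  have Vx0 : V x0 by move: Nx0; rewrite NE => -[].
  have : nbhs x0 (U `&` V) by apply: filterI; apply: open_nbhs_nbhs.
  move=> /boxP[r1 r10 hr1].
  have [r [[C00 hr] [r0 rr1]]] : exists r, (0 <= C0 /\ forall x y : R3, S x -> S y ->
    box x0 r x -> box x0 r y -> box x0 r (axial_refl x y) ->
    g y + g (axial_refl x y) <= 2 * g x + C0 * dist2 x y) /\ 0 < r /\ r <= r1.
    have [r [? [? ?]]] := @filter_ex _ _ (at_right_proper_filter 0) _
      (filterI hC0 (filterI (nbhs_right_gt 0) (nbhs_right_le r10))).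
    by exists r.
  exists (box x0 (r / 2), [set C | Num.max C0 (4 / r ^+ 2) < C]).
    split; first by apply/boxP; exists (r / 2) => //; rewrite divr_gt0.
    by exists (Num.max C0 (4 / r ^+ 2)); split => //; rewrite num_real.
  move=> [x C] [/= hx]; rewrite gt_max => /andP[C0C rC].
  have C_gt0 : 0 < C by exact: le_lt_trans C0C.
  split => // xS y yS xy.
  have xyr : dist2 x y < (r / 2) ^+ 2.
    apply: (lt_le_trans xy); rewrite -[leRHS]invrK lef_pV2 ?posrE ?invr_gt0 ?exprn_gt0 ?divr_gt0//.
    by rewrite (le_trans _ (ltW rC))// exprMn exprVn invfM invrK -natrX mulrC.
  have inb z : box x (r / 2) z -> box x0 r z.
    move: hx => [h1 h2 h3] [k1 k2 k3].
    have tri (a b c : R) : `|b - c| < r / 2 -> `|a - b| < r / 2 -> `|a - c| < r.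
      move=> bc ab; rewrite (le_lt_trans (ler_distD b _ _))//.
      by rewrite (splitr r) ltrD.
    by split; [exact: tri h1 k1|exact: tri h2 k2|exact: tri h3 k3].
  have r20 : 0 < r / 2 by rewrite divr_gt0.
  have by_ : box x0 r y by apply: inb; exact: dist2_box.
  have by' : box x0 r (axial_refl x y) by apply: inb; apply: dist2_box; rewrite ?dist2_axial.
  have bx : box x0 r x by apply: inb; split; rewrite subrr normr0.
  have QE z : S z -> box x0 r z -> Q z = (g z)%:E.
    move=> zS [h1 h2 h3].
    have [Uz Vz] := hr1 z (And3 (lt_le_trans h1 rr1) (lt_le_trans h2 rr1) (lt_le_trans h3 rr1)).
    by apply: gQ => //; rewrite NE.
  exists (g y), (g (axial_refl x y)), (g x); split.
  - exact: QE.
  - exact: QE.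
  - by apply: QE => //; exact: axial_refl_sphere.
  - by rewrite (le_trans (hr x y _ _ _ _ _))// lerD2l ler_wpM2r ?dist2_ge0// ltW.
move=> M [Mr hM]; have hM1 : M < M + 1 by rewrite ltrDl.
have key x : south_cap alpha x -> P (M + 1) x by exact: hM.
exists (Num.max 1 (M + 1)); first by rewrite lt_max ltr01.
move=> x y cx yS; have [M0 h] := key x cx.
have xS : S x by have [t [p [_ _ ->]]] := cx; exact: spherical_sphere.
move=> xy; have [a [b [c [? ? ? le]]]] : second_difference Q (M + 1) x y.
  apply: h => //; apply: (lt_le_trans xy).
  by rewrite lef_pV2 ?posrE ?lt_max ?ltr01// le_max lexx orbT.
exists a, b, c; split => //; apply: (le_trans le).
by rewrite lerD2l ler_wpM2r ?dist2_ge0// le_max lexx orbT.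
Qed.

End second_difference.

(** * Growth of the extremal measure on balls *)
Section growth.
Context {R : realType}.
Local Open Scope ereal_scope.
Local Notation R3 := (R * R * R)%type.
Local Notation S := (@sphere R).

Lemma poisson_denE (x y : R3) (b : R) : S x -> S y ->
  poisson_den x b y = (b * dist2 x y + (b - 1) ^+ 2)%R.
Proof. by move=> xS yS; rewrite /poisson_den dist2_sphere// (dotC y); ring. Qed.

Lemma measurable_dball (x : R3) (r : R) : measurable [set w | (dist2 x w <= r)%R].
Proof.
rewrite (_ : [set w | _] = (dist2 x) @^-1` `]-oo, r]%classic).
  by apply: meas_preimage => //; exact: measurable_dist2l.
by apply/seteqP; split => w /=; rewrite in_itv.
Qed.

(** With [b = 1 + e] the smoothed kernel bounds the potential of the test measure
    up to a factor; the loss at short distance is what limits the mass of [mu]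
    near [x]. *)
Lemma smoothing_gain (e d b : R) : (0 < e)%R -> (1 < b <= 2)%R -> (0 < d <= e ^+ 2)%R ->
  ((Num.sqrt (d + e ^+ 2 / b))^-1 + (12 * e)^-1 <= (Num.sqrt d)^-1)%R.
Proof.
move=> e0 /andP[b1 b2] /andP[d0 de].
set t := Num.sqrt (_ + _); set s := Num.sqrt d.
have eb : (0 < e ^+ 2 / b)%R by rewrite divr_gt0 ?exprn_gt0//; lra.
have s0 : (0 < s)%R by rewrite sqrtr_gt0.
have t0 : (0 < t)%R by rewrite sqrtr_gt0 addr_gt0.
have s2 : (s ^+ 2 = d)%R by rewrite sqr_sqrtr// ltW.
have t2 : (t ^+ 2 = d + e ^+ 2 / b)%R by rewrite sqr_sqrtr// ltW// addr_gt0.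
have eb1 : (e ^+ 2 / 2 <= e ^+ 2 / b)%R.
  by rewrite ler_pM2l ?exprn_gt0// lef_pV2// posrE; lra.
have eb2 : (e ^+ 2 / b <= e ^+ 2)%R.
  by rewrite ler_pdivrMr ?ler_peMr ?sqr_ge0//; lra.
have se : (s <= e)%R by rewrite -(@ler_pXn2r _ 2) ?nnegrE ?(ltW s0) ?(ltW e0)// s2.
have te : (t <= 2 * e)%R.
  rewrite -(@ler_pXn2r _ 2) ?nnegrE ?(ltW t0) ?mulr_ge0 ?(ltW e0)// t2 exprMn.
  move: (e ^+ 2)%R (e ^+ 2 / b)%R de eb2 eb1 => u v; lra.
(* As [s + t <= 3 e] this gives [t - s >= e / 6], and [s t <= 2 e^2]. *)
have key : (e ^+ 2 / 2 <= (t - s) * (s + t))%R.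
  have -> : ((t - s) * (s + t) = t ^+ 2 - s ^+ 2)%R by ring.
  by rewrite t2 s2 addrAC subrr add0r.
clearbody s t.
have st0 : (0 < s * t)%R by rewrite mulr_gt0.
rewrite -lerBrDl.
have -> : (s^-1 - t^-1 = (t - s) / (s * t))%R by field; rewrite !gt_eqF.
rewrite ler_pdivlMr// mulrC ler_pdivrMr ?mulr_gt0//.
have ts : (0 <= t - s)%R.
  rewrite leNgt; apply/negP => h.
  have : ((t - s) * (s + t) < 0)%R by rewrite nmulr_rlt0// addr_gt0.
  have : (0 < e ^+ 2)%R by rewrite exprn_gt0.
  by move: key; move: (e ^+ 2)%R ((t - s) * (s + t))%R => u v; lra.
have st : (s + t <= 3 * e)%R by lra.
have h1 : (e ^+ 2 / 2 <= (t - s) * (3 * e))%R by rewrite (le_trans key)// ler_wpM2l.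
have h2 : (e / 6 <= t - s)%R.
  rewrite -(ler_pM2r (mulr_gt0 (ltr0n _ 3) e0)) (le_trans _ h1)//.
  by rewrite le_eqVlt; apply/orP; left; apply/eqP; field.
apply: (@le_trans _ _ (e * (2 * e))%R).
  by rewrite ler_pM// ltW.
have -> : (e * (2 * e) = e / 6 * (12 * e))%R by field.
by rewrite ler_wpM2r// mulr_ge0// ltW.
Qed.

Variables (sb : probability R3 R) (Q : R3 -> \bar R) (mu : probability R3 R).
Hypotheses (sbU : archimedean_sphere sb).
Hypotheses (Q0 : forall x, S x -> 0 <= Q x) (mQ : measurable_fun S Q).
Hypotheses (mumin : extremal_measure Q mu) (mufin : weighted_energy Q mu < +oo).
Local Notation F := (robin_constant Q mu).
Local Notation Qs := (sphere_field Q).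

(** The first variation is integrated against [nu] near [x], where half-turn
    invariance replaces [Q] by its second differences, of order [e] in the mean;
    the mass of [nu] elsewhere is of order [e] by Chebyshev's inequality. *)
Lemma potential_lower_bound (nu : probability R3 R) (x : R3) (C e p : R) :
  S x -> (0 < C)%R -> (0 <= e)%R ->
  (forall y, S y -> (dist2 x y < C^-1)%R -> second_difference Q C x y) ->
  potential mu x = p%:E -> p%:E + Qs x <= F%:E ->
  nu S = 1 -> mutual nu nu < +oo ->
  \int[nu]_y (dist2 x y)%:E <= (2 * e)%:E ->
  (forall h : R3 -> \bar R, measurable_fun setT h -> (forall y, 0 <= h y) ->
     \int[nu]_y h (axial_refl x y) = \int[nu]_y h y) ->
  p%:E <= mutual nu mu + (C * (2 * F + 1) * e)%:E.
Proof.
move=> xS C0 e0 sd pE pF nuS nufin nud nusym.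
have Ci : (0 < C^-1)%R by rewrite invr_gt0.
have [c [c0 QxE]] : exists c : R, (0 <= c)%R /\ Q x = c%:E.
  have : dist2 x x = 0%R by rewrite /dist2 !subrr expr0n !addr0.
  move=> xx; have [|a [b [c [Qx _ _ _]]]] := sd x xS; first by rewrite xx.
  by exists c; split => //; rewrite -lee_fin -Qx Q0.
have QsE y : S y -> Qs y = Q y by move=> yS; rewrite /sphere_field patchE mem_set.
have mP := measurable_potential mu; have mQs := measurable_sphere_field mQ.
have Qs0 := sphere_field_ge0 Q0.
have F0 := robin_constant_ge0 Q0 mumin mufin.
have p0 : (0 <= p)%R by rewrite -lee_fin -pE potential_ge0.
have {}pF : (p + c <= F)%R by move: pF; rewrite QsE// QxE -EFinD lee_fin.
have meS := @measurable_sphere R.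
pose B := S `&` [set y | (dist2 x y < C^-1)%R].
have mB : measurable B.
  apply: measurableI => //.
  rewrite (_ : [set w | _] = (dist2 x) @^-1` `]-oo, (C^-1)%R[%classic).
    by apply: meas_preimage => //; exact: measurable_dist2l.
  by apply/seteqP; split => w /=; rewrite in_itv.
have symB y : B (axial_refl x y) <-> B y.
  have imp z : B z -> B (axial_refl x z).
    by move=> [zS zd]; split; [exact: axial_refl_sphere|rewrite /= dist2_axial].
  by split => [/imp|/imp//]; rewrite axial_reflK.
have mrefl : measurable_fun setT (axial_refl x) by exact: measurable_axial_refl.
have mind (h : R3 -> \bar R) : measurable_fun setT h -> measurable_fun setT (h \_ B).
  by move=> mh; apply/(measurable_restrictT _ _).1 => //; exact: measurable_funS mh.
have mdist : measurable_fun setT (fun y => (dist2 x y)%:E : \bar R).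
  by apply/measurable_EFinP; exact: measurable_dist2l.
have dE0 y : 0 <= (dist2 x y)%:E by rewrite lee_fin dist2_ge0.
have nuBfin : nu B \is a fin_num by exact: fin_num_measure.
pose v := fine (nu B); have vE : nu B = v%:E by rewrite fineK.
have v01 : (0 <= v <= 1)%R by rewrite -!lee_fin -vE measure_ge0 probability_le1.
have QB : \int[nu]_(y in B) Qs y <= (c * v + C * e)%:E.
  have -> : \int[nu]_(y in B) Qs y =
      (2^-1)%:E * (\int[nu]_y ((Qs \_ B) y + (Qs \_ B) (axial_refl x y))).
    have mQB := mind _ mQs.
    have QB0 y : 0 <= (Qs \_ B) y by apply: erestrict_ge0.
    rewrite ge0_integralD//; last exact: (measurableT_comp mQB mrefl).
    rewrite nusym// -integral_mkcond.
    have : 0 <= \int[nu]_(y in B) Qs y by apply: integral_ge0.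
    case: (\int[nu]_(y in B) Qs y) => [r||]// _; last by rewrite addye// gt0_muley// lte_fin invr_gt0.
    by rewrite -EFinD -EFinM; congr (_%:E); field.
  apply: (@le_trans _ _ ((2^-1)%:E * \int[nu]_y (((2 * c)%:E * (\1_B y)%:E + C%:E * (dist2 x y)%:E)))).
    rewrite lee_wpmul2l ?lee_fin//; apply: ge0_le_integral => //.
    - by move=> y _; rewrite adde_ge0//; apply: erestrict_ge0.
    - apply: emeasurable_funD; first exact: mind.
      exact: (measurableT_comp (mind _ mQs) mrefl).
    - apply: emeasurable_funD; apply: measurable_funeM => //.
      by apply/measurable_EFinP; exact: measurable_indic.
    - move=> y _; rewrite !patchE indicE.
      have [yB|yB] := pselect (B y); last first.
        rewrite !memNset//; last by rewrite symB.
        by rewrite mule0 add0e add0e mule_ge0// lee_fin ltW.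
      have y'B : B (axial_refl x y) by rewrite symB.
      rewrite !mem_set// mule1; case: yB => yS yd.
      have [a [b [c' [Qx Qy Qy' le]]]] := sd y yS yd.
      move: Qx le; rewrite QxE => -[<-] le.
      by rewrite !QsE// ?Qy ?Qy'; [rewrite -EFinM -!EFinD lee_fin|exact: axial_refl_sphere].
  rewrite ge0_integralD//; last 4 first.
  - by move=> y _; rewrite mule_ge0// lee_fin mulr_ge0.
  - by apply: measurable_funeM; apply/measurable_EFinP; exact: measurable_indic.
  - by move=> y _; rewrite mule_ge0// lee_fin ltW.
  - exact: measurable_funeM.
  rewrite !ge0_integralZl//; last 3 first.
  - by rewrite lee_fin ltW.
  - by apply/measurable_EFinP; exact: measurable_indic.
  - by rewrite lee_fin mulr_ge0.
  have -> : \int[nu]_y (\1_B y)%:E = v%:E by rewrite integral_indic// setIT; exact: vE.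
  apply: (@le_trans _ _ ((2^-1)%:E * ((2 * c)%:E * v%:E + C%:E * (2 * e)%:E))).
    by rewrite lee_wpmul2l ?lee_fin// leeD2l// lee_wpmul2l// lee_fin ltW.
  rewrite -[leLHS]/((2^-1 * (2 * c * v + C * (2 * e)))%:E) lee_fin le_eqVlt; apply/orP; left; apply/eqP; field.
  by [].
have vlow : (1 - 2 * C * e <= v)%R.
  have mBC : measurable (S `\` B) by exact: measurableD.
  have h1 : (C^-1)%:E * nu (S `\` B) <= (2 * e)%:E.
    rewrite -integral_cst//; apply: le_trans nud.
    apply: (@le_trans _ _ (\int[nu]_(y in S `\` B) (dist2 x y)%:E)).
      apply: ge0_le_integral => //.
      - by move=> y _; rewrite lee_fin ltW.
      - exact: measurable_funS mdist.
      - move=> y [yS yB]; rewrite lee_fin leNgt; apply/negP => h; exact: yB.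
    exact: ge0_subset_integral.
  have h2 : nu (S `\` B) = (1 - v)%:E.
    have mD : nu (S `\` B) = nu S - nu (S `&` B).
      by apply: measureD => //; rewrite -ge0_fin_numE// fin_num_measure.
    by rewrite mD nuS (_ : S `&` B = B) ?vE// /B setIA setIid.
  move: h1; rewrite h2 -EFinM lee_fin ler_pdivrMl// => h1.
  by rewrite lerBlDr -lerBlDl (le_trans h1)// le_eqVlt; apply/orP; left; apply/eqP; ring.
have uB : \int[nu]_(y in B) potential mu y <= mutual nu mu.
  by apply: ge0_subset_integral => // y _; exact: potential_ge0.
have QBfin : \int[nu]_(y in B) Qs y < +oo by rewrite (le_lt_trans QB)// ltry.
have := first_variation_restr Q0 mQ mumin mufin nuS nufin mB QBfin.
rewrite ge0_integralD//; last 3 first.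
- by move=> y _; exact: potential_ge0.
- exact: measurable_funS mP.
- exact: measurable_funS mQs.
rewrite vE -EFinM => h.
have {h} : (F * v)%:E <= mutual nu mu + (c * v + C * e)%:E by rewrite (le_trans h)// leeD.
have : 0 <= mutual nu mu by exact: mutual_ge0.
case: (mutual nu mu) => [m||]// _; last by move=> _; rewrite addye// leey.
rewrite -!EFinD !lee_fin => h.
move: v01 => /andP[v0 v1].
have h3 : (p * (1 - 2 * C * e) <= p * v)%R by rewrite ler_wpM2l.
have h4 : (p * v <= (F - c) * v)%R by rewrite ler_wpM2r//; lra.
have h5 : (p * (2 * C * e) <= F * (2 * C * e))%R.
  by apply: ler_wpM2r; [rewrite !mulr_ge0// ltW|lra].
move: h3 h4 h5; rewrite !mulrBr !mulrBl mulr1 => h3 h4 h5.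
have -> : (C * (2 * F + 1) * e = F * (2 * C * e) + C * e)%R by ring.
lra.
Qed.

(** The potential of [mu] at [x] exceeds the smoothed one by at least the mass of
    the ball over [12 e], whereas [potential_lower_bound] for the test measure at
    scale [e] bounds the excess by [O(e)]. *)
Lemma ball_growth_at (x : R3) (C e : R) : S x -> (0 < C)%R -> (0 < e <= 1)%R ->
  (forall y, S y -> (dist2 x y < C^-1)%R -> second_difference Q C x y) ->
  potential mu x + Qs x <= F%:E ->
  mu [set w | (dist2 x w <= e ^+ 2)%R] <= (12 * (C * (2 * F + 1) + F) * e ^+ 2)%:E.
Proof.
move=> xS C0 /andP[e0 e1] sd xF.
have meS := @measurable_sphere R; have [muS _] := mumin.
have Qs0 := sphere_field_ge0 Q0.
have F0 := robin_constant_ge0 Q0 mumin mufin.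
have [p [p0 pE]] : exists p : R, (0 <= p)%R /\ potential mu x = p%:E.
  have := potential_ge0 mu x; have : potential mu x <= F%:E.
    by apply: le_trans xF; rewrite leeDl.
  by case: (potential mu x) => [p||]// _ p0; exists p.
have pF : (p <= F)%R by rewrite -lee_fin -pE (le_trans _ xF)// leeDl.
have b1 : (1 < 1 + e)%R by lra.
have [nu [nuS nuU nud nusym]] := test_measure sbU xS b1.
have bE : (1 + e - 1 = e)%R by ring.
rewrite bE in nud.
have denE w : S w -> poisson_den x (1 + e) w = ((1 + e) * dist2 x w + e ^+ 2)%R.
  by move=> wS; rewrite poisson_denE// bE.
have den0 w : S w -> (e ^+ 2 <= poisson_den x (1 + e) w)%R.
  by move=> wS; rewrite denE// lerDr mulr_ge0 ?dist2_ge0//; lra.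
have nuP w : S w -> potential nu w <= ((1 + e) / Num.sqrt (poisson_den x (1 + e) w))%:E.
  move=> wS; apply: le_trans (nuU w wS); rewrite /potential.
  by apply: ge0_le_integral => //;
    [move=> y _; exact: kern_ge0|exact: measurable_kernl|exact: measurable_kernr|
     move=> y _; rewrite kernC].
have mPn := measurable_potential nu.
have nufin : mutual nu nu < +oo.
  apply: (@le_lt_trans _ _ (\int[nu]_w ((1 + e) / e)%:E)); last first.
    have -> : \int[nu]_w ((1 + e) / e)%:E = ((1 + e) / e)%:E.
      by rewrite integral_cst// -[RHS]mule1; congr (_ * _); exact: probability_setT.
    exact: ltry.
  apply: (@le_integral_on _ _ _ nu S) => //.
  - by move=> w; exact: potential_ge0.
  - by move=> w; rewrite lee_fin divr_ge0//; lra.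
  - move=> w wS; apply: (le_trans (nuP w wS)); rewrite lee_fin ler_pM2l; last lra.
    rewrite lef_pV2 ?posrE ?sqrtr_gt0 ?(lt_le_trans _ (den0 w wS)) ?exprn_gt0//.
    rewrite -[leLHS](ger0_norm (ltW e0)) -sqrtr_sqr ler_wsqrtr// den0//.
pose h (w : R3) : R := (Num.sqrt (dist2 x w + e ^+ 2 / (1 + e)))^-1%R.
have mh : measurable_fun setT h.
  by rewrite /h; apply: meas_inv; apply: meas_sqrt; apply: measurable_funD => //;
    exact: measurable_dist2l.
have mhE : measurable_fun setT (fun w => (h w)%:E) by exact/measurable_EFinP.
have eps0 : (0 < e ^+ 2 / (1 + e))%R by rewrite divr_gt0 ?exprn_gt0//; lra.
have h0 w : (0 <= h w)%R by rewrite invr_ge0 sqrtr_ge0.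
have hE0 w : 0 <= (h w)%:E by rewrite lee_fin.
have kernE w : (0 < dist2 x w)%R -> kern x w = ((Num.sqrt (dist2 x w))^-1)%:E.
  by move=> d0; rewrite /kern enorm3B inver gt_eqF// sqrtr_gt0.
have kern0 w : (dist2 x w <= 0)%R -> kern x w = +oo.
  move=> d0; rewrite /kern enorm3B (_ : dist2 x w = 0%R) ?sqrtr0 ?inve0//.
  by apply/eqP; rewrite eq_le d0 dist2_ge0.
have hk w : (h w)%:E <= kern x w.
  have [d0|d0] := ltP 0%R (dist2 x w); last by rewrite kern0// leey.
  have hd : (0 < dist2 x w + e ^+ 2 / (1 + e))%R by exact: addr_gt0.
  rewrite kernE// lee_fin /h lef_pV2 ?posrE ?sqrtr_gt0//.
  by apply: ler_wsqrtr; rewrite lerDl ltW.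
have ball : measurable [set w | (dist2 x w <= e ^+ 2)%R] by exact: measurable_dball.
set A := [set w | _] in ball *.
have mA : measurable_fun setT (fun w : R3 => (\1_A w)%:E : \bar R).
  by apply/measurable_EFinP; exact: measurable_indic.
have gain : \int[mu]_w ((h w)%:E + ((12 * e)^-1)%:E * (\1_A w)%:E) <= p%:E.
  rewrite -pE; apply: ge0_le_integral => //.
  - by move=> w _; rewrite adde_ge0// mule_ge0// lee_fin invr_ge0 mulr_ge0// ltW.
  - by apply: emeasurable_funD => //; exact: measurable_funeM.
  - exact: measurable_kernl.
  - move=> w _; rewrite indicE; have [wA|wA] := boolP (w \in A); last by rewrite mule0 adde0.
    have [d0|d0] := ltP 0%R (dist2 x w); last by rewrite kern0// leey.
    rewrite kernE// mule1 -EFinD lee_fin; apply: smoothing_gain => //.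
      by apply/andP; split; lra.
    by rewrite d0/=; move: wA; rewrite inE.
have hfin : \int[mu]_w (h w)%:E <= p%:E.
  rewrite -pE; apply: ge0_le_integral => //; exact: measurable_kernl.
have loss : mutual nu mu <= (1 + e)%:E * \int[mu]_w (h w)%:E.
  have e10 : 0 <= (1 + e)%:E by rewrite lee_fin; lra.
  rewrite mutualC -ge0_integralZl//.
  apply: (@le_integral_on _ _ _ mu S) => //.
  - exact: measurable_funeM.
  - by move=> w; exact: potential_ge0.
  - by move=> w; rewrite mule_ge0.
  - move=> w wS; apply: (le_trans (nuP w wS)); rewrite -EFinM lee_fin ler_pM2l; last lra.
    have hd : (0 < dist2 x w + e ^+ 2 / (1 + e))%R by rewrite ltr_wpDl ?dist2_ge0.
    rewrite lef_pV2 ?posrE ?sqrtr_gt0 ?(lt_le_trans _ (den0 w wS)) ?exprn_gt0//.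
    rewrite ler_wsqrtr// denE//.
    have -> : ((1 + e) * dist2 x w + e ^+ 2 =
        (1 + e) * (dist2 x w + e ^+ 2 / (1 + e)))%R by field; lra.
    by rewrite ler_peMl// ?ltW//.
have := potential_lower_bound xS C0 (ltW e0) sd pE _ nuS nufin nud nusym.
rewrite -pE => /(_ xF); rewrite pE => low.
move: gain; rewrite ge0_integralD//; last 2 first.
- by move=> w _; rewrite mule_ge0// lee_fin invr_ge0 mulr_ge0// ltW.
- exact: measurable_funeM.
rewrite ge0_integralZl//; last by rewrite lee_fin invr_ge0 mulr_ge0// ltW.
have muAfin : mu A \is a fin_num by exact: fin_num_measure.
pose m := fine (mu A); have muAE : mu A = m%:E by rewrite fineK.
have -> : \int[mu]_y (\1_A y)%:E = m%:E by rewrite integral_indic// setIT; exact: muAE.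
rewrite muAE.
have : 0 <= \int[mu]_w (h w)%:E by apply: integral_ge0.
move: hfin loss low; case: (\int[mu]_w (h w)%:E) => [H||]// hfin loss low _.
rewrite -EFinM -EFinD lee_fin => gain.
have {loss low} : (p <= (1 + e) * H + C * (2 * F + 1) * e)%R.
  by rewrite -lee_fin EFinD EFinM (le_trans low)// leeD2r.
rewrite lee_fin in hfin * => low.
have eH : (e * H <= e * F)%R by rewrite ler_pM2l// (le_trans hfin).
have h2 : ((12 * e)^-1 * m <= (C * (2 * F + 1) + F) * e)%R.
  have E1 : ((1 + e) * H = H + e * H)%R by ring.
  have E2 : ((C * (2 * F + 1) + F) * e = C * (2 * F + 1) * e + e * F)%R by ring.
  move: gain low; rewrite E1 E2.
  move: ((12 * e)^-1 * m)%R (e * H)%R (e * F)%R (C * (2 * F + 1) * e)%R eH => *; lra.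
move: h2; rewrite ler_pdivrMl ?mulr_gt0// => h2.
by rewrite lee_fin (le_trans h2)// le_eqVlt; apply/orP; left; apply/eqP; ring.
Qed.

(** A ball that contains a point where [ball_growth_at] applies lies in the ball of
    twice its radius about that point; any other ball is null. *)
Lemma ball_growth (C : R) (G : set R3) : (0 < C)%R -> G `<=` S -> mu.-negligible (~` G) ->
  (forall x, G x -> (forall y, S y -> (dist2 x y < C^-1)%R -> second_difference Q C x y)) ->
  exists2 K : R, (0 < K)%R & forall q r, (0 < r)%R ->
    mu [set w | (dist2 q w <= r ^+ 2)%R] <= (K * r ^+ 2)%:E.
Proof.
move=> C0 GS G0 sd.
have F0 := robin_constant_ge0 Q0 mumin mufin.
have [E [mE muE EF]] := potential_le_robin Q0 mQ mumin mufin.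
pose K1 := (12 * (C * (2 * F + 1) + F))%R.
have K10 : (0 <= K1)%R.
  have c1 : (0 <= C * (2 * F + 1))%R by rewrite mulr_ge0// ?ltW//; lra.
  by rewrite /K1 mulr_ge0// addr_ge0.
exists (4 * K1 + 4)%R; first by rewrite ltr_wpDl// mulr_ge0.
move=> q r r0; have mball := measurable_dball q (r ^+ 2).
have r2 : (0 < r ^+ 2)%R by rewrite exprn_gt0.
have [r1|r1] := ltP 1%R (2 * r)%R.
  apply: (le_trans (probability_le1 mu mball)); rewrite lee_fin mulrDl.
  have : (1 <= 4 * r ^+ 2)%R.
    have -> : (4 * r ^+ 2 = (2 * r) ^+ 2)%R by ring.
    by rewrite exprn_ege1// ltW.
  by move=> h; rewrite (le_trans h)// lerDr; exact: mulr_ge0 (mulr_ge0 _ K10) (ltW r2).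
have [[x [[Gx nEx] qx]]|none] := pselect (exists x, (G x /\ ~ E x) /\ (dist2 q x <= r ^+ 2)%R).
  have h : mu [set w | (dist2 x w <= (2 * r) ^+ 2)%R] <= (K1 * (2 * r) ^+ 2)%:E.
    apply: ball_growth_at => //.
    - exact: GS.
    - by rewrite mulr_gt0.
    - exact: sd.
    - by apply: contrapT => /EF.
  apply: (@le_trans _ _ (K1 * (2 * r) ^+ 2)%:E).
    apply: le_trans h; apply: le_measure; rewrite ?inE//; first exact: measurable_dball.
    move=> w /= qw.
    apply: (@le_trans _ _ (2 * (dist2 q x + dist2 q w))%R).
      (* The parallelogram law. *)
      have := @dist2_ge0 R (lincomb 1 x 1 w) (lincomb 1 q 1 q); rewrite /lincomb /dist2 /= => h1.
      rewrite -subr_ge0 (le_trans h1)// le_eqVlt; apply/orP; left; apply/eqP; ring.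
    rewrite exprMn; move: (r ^+ 2)%R (dist2 q x) (dist2 q w) qx qw => a b c; lra.
  rewrite lee_fin exprMn mulrDl; apply: (@le_trans _ _ (4 * K1 * r ^+ 2)%R).
    by rewrite le_eqVlt; apply/orP; left; apply/eqP; ring.
  by rewrite lerDl mulr_ge0// ltW.
apply: (@le_trans _ _ 0); last first.
  by rewrite lee_fin; exact: mulr_ge0 (addr_ge0 (mulr_ge0 _ K10) _) (ltW r2).
rewrite le_eqVlt; apply/orP; left; apply/eqP.
apply: measure_negligible => //.
apply: (@negligibleS _ _ _ mu (~` G `|` E)).
  move=> w wq; have [Gw|] := pselect (G w); last by left.
  by right; apply: contrapT => nEw; apply: none; exists w.
by apply: negligibleU; [exact: G0|exists E; split].
Qed.

End growth.

(** * Positive definiteness of the Coulomb kernel *)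
Section bounded_means.
Context d (T : measurableType d) (R : realType) (m : probability T R).

Definition bounded_measurable (f : T -> R) :=
  measurable_fun setT f /\ exists M, forall x, `|f x| <= M.
Local Notation bdd := bounded_measurable.

Lemma bdd_integrable f : bdd f -> m.-integrable setT (EFin \o f).
Proof.
move=> [mf [M fM]]; apply: measurable_bounded_integrable => //.
  by rewrite (le_lt_trans (probability_le1 _ _))// ltry.
exists M; split; first by rewrite num_real.
by move=> x Mx y _; apply: (le_trans (fM y)); exact: ltW.
Qed.

Lemma bdd_cst c : bdd (fun=> c).
Proof. by split => //; exists `|c|. Qed.

Lemma bddD f g : bdd f -> bdd g -> bdd (fun x => f x + g x).
Proof.
move=> [mf [M fM]] [mg [N gN]]; split; first exact: measurable_funD.
by exists (M + N) => x; rewrite (le_trans (ler_normD _ _))// lerD.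
Qed.

Lemma bddM f g : bdd f -> bdd g -> bdd (fun x => f x * g x).
Proof.
move=> [mf [M fM]] [mg [N gN]]; split; first exact: measurable_funM.
by exists (M * N) => x; rewrite normrM ler_pM.
Qed.

Lemma bdd_sum I (r : seq I) (P : pred I) (F : I -> T -> R) :
  (forall i, bdd (F i)) -> bdd (fun x => \sum_(i <- r | P i) F i x).
Proof.
move=> bF; elim: r => [|i r IH]; first by under eq_fun do rewrite big_nil; exact: bdd_cst.
under eq_fun do rewrite big_cons.
by case: (P i) => //; exact: bddD.
Qed.

Lemma bdd_prod I (r : seq I) (P : pred I) (F : I -> T -> R) :
  (forall i, bdd (F i)) -> bdd (fun x => \prod_(i <- r | P i) F i x).
Proof.
move=> bF; elim: r => [|i r IH]; first by under eq_fun do rewrite big_nil; exact: bdd_cst.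
under eq_fun do rewrite big_cons.
by case: (P i) => //; exact: bddM.
Qed.

Lemma mean_EFin f : bdd f -> (\int[m]_x f x)%:E = (\int[m]_x (f x)%:E)%E.
Proof. by move=> bf; rewrite /Rintegral fineK//; apply: integrable_fin_num => //; exact: bdd_integrable. Qed.

Lemma mean_cst c : \int[m]_x c = c.
Proof.
rewrite Rintegral_cst// [X in fine X](_ : _ = 1%E) ?mulr1//.
exact: probability_setT.
Qed.

Lemma mean_sum I (r : seq I) (P : pred I) (F : I -> T -> R) :
  (forall i, bdd (F i)) ->
  \int[m]_x (\sum_(i <- r | P i) F i x) = \sum_(i <- r | P i) \int[m]_x F i x.
Proof.
move=> bF; elim: r => [|i r IH].
  by rewrite big_nil; under eq_Rintegral do rewrite big_nil; exact: mean_cst.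
rewrite big_cons; under eq_Rintegral do rewrite big_cons.
case: (P i) => //; rewrite RintegralD ?IH//; apply: bdd_integrable => //.
exact: bdd_sum.
Qed.

Lemma meanZl c f : bdd f -> \int[m]_x (c * f x) = c * \int[m]_x f x.
Proof. by move=> bf; rewrite RintegralZl//; exact: bdd_integrable. Qed.

Lemma meanZr c f : bdd f -> \int[m]_x (f x * c) = (\int[m]_x f x) * c.
Proof. by move=> bf; rewrite RintegralZr//; exact: bdd_integrable. Qed.

Lemma le_mean f g : bdd f -> bdd g -> (forall x, f x <= g x) ->
  \int[m]_x f x <= \int[m]_x g x.
Proof. by move=> bf bg fg; apply: le_Rintegral => //; exact: bdd_integrable. Qed.

Lemma mean_dist f g e : bdd f -> bdd g -> (forall x, `|f x - g x| <= e) ->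
  `|\int[m]_x f x - \int[m]_x g x| <= e.
Proof.
move=> bf bg fg; rewrite ler_distl; apply/andP; split.
  rewrite -[X in _ - X]mean_cst -RintegralB//; try exact: bdd_integrable.
    apply: le_mean => //; first by apply: bddD => //; exact: bdd_cst.
    by move=> x; have := fg x; rewrite ler_distl => /andP[].
  exact/bdd_integrable/bdd_cst.
rewrite -[X in _ + X]mean_cst -RintegralD//; try exact: bdd_integrable.
  apply: le_mean => //; first by apply: bddD => //; exact: bdd_cst.
  by move=> x; have := fg x; rewrite ler_distl => /andP[].
exact/bdd_integrable/bdd_cst.
Qed.

Lemma bdd_mean (d' : measure_display) (T' : measurableType d') (f : T' -> T -> R) M :
  measurable_fun setT (fun p : T' * T => f p.1 p.2) -> (forall x y, 0 <= f x y <= M) ->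
  measurable_fun setT (fun x => \int[m]_y f x y) /\ forall x, `|\int[m]_y f x y| <= M.
Proof.
move=> mf f0M.
have bf x : bdd (f x).
  split; last by exists M => y; have /andP[h1 h2] := f0M x y; rewrite ger0_norm.
  apply: (measurableT_comp mf (_ : measurable_fun setT (fun y => (x, y)))); meas.
split; last first.
  move=> x; rewrite ger0_norm; last by apply: Rintegral_ge0 => y _; have /andP[] := f0M x y.
  rewrite -[leRHS]mean_cst; apply: le_mean => //; first exact: bdd_cst.
  by move=> y; have /andP[] := f0M x y.
apply/measurable_EFinP.
rewrite (_ : _ \o _ = fun x => (\int[m]_y (f x y)%:E)%E); last first.
  by apply/funext => x; rewrite -mean_EFin.
apply: (@measurable_fun_fubini_tonelli_F _ _ _ _ _ m (fun p => (f p.1 p.2)%:E)).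
  exact/measurable_EFinP.
by move=> p; rewrite lee_fin; have /andP[] := f0M p.1 p.2.
Qed.

End bounded_means.

Section words.
Context {R : realType}.
Local Notation R3 := (R * R * R)%type.
Local Notation S := (@sphere R).

(** Cut off outside the sphere, so as to be bounded on the whole space. *)
Definition cut_coord (j : 'I_3) (x : R3) : R :=
  (if j == ord0 then x.1.1 else if j == ord_max then x.2 else x.1.2) * \1_S x.
(** Monomials are indexed by words rather than by exponents: powers of the inner
    product then expand without multinomial coefficients. *)
Definition word n (w : {ffun 'I_n -> 'I_3}) (x : R3) : R := \prod_(i < n) cut_coord (w i) x.
Definition dotS (x y : R3) : R := \sum_(j < 3) cut_coord j x * cut_coord j y.

Lemma dotSE x y : dotS x y = dot x y * (\1_S x * \1_S y).
Proof.
rewrite /dotS /cut_coord !big_ord_recr big_ord0 /= /dot.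
by ring.
Qed.

Lemma dotS_sphere x y : S x -> S y -> dotS x y = dot x y.
Proof. by move=> xS yS; rewrite dotSE !indicE !mem_set// !mulr1. Qed.

Lemma dotS_le1 x y : `|dotS x y| <= 1.
Proof.
rewrite dotSE !indicE; have [|] := boolP (x \in S); last by rewrite mul0r mulr0 normr0.
rewrite inE => xS; have [|] := boolP (y \in S); last by rewrite mulr0 mulr0 normr0.
by rewrite inE => yS; rewrite !mulr1 ler_norml dot_le1.
Qed.

Lemma coord_le1 j (x : R3) : `|cut_coord j x| <= 1.
Proof.
rewrite /cut_coord normrM indicE; have [|] := boolP (x \in S); last by rewrite normr0 mulr0.
rewrite inE => /sphere_coord_le1[h1 h2 h3]; rewrite normr1 mulr1.
by do 2 case: ifP => // _.
Qed.

Lemma bdd_coord j : bounded_measurable (cut_coord j).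
Proof.
have mS : measurable_fun setT (fun x : R3 => \1_S x : R).
  by apply: measurable_indic; exact: measurable_sphere.
split.
  rewrite /cut_coord; apply: measurable_funM => //.
  by case: (j == ord0); [meas|case: (j == ord_max); meas].
by exists 1 => x; exact: coord_le1.
Qed.

Lemma bdd_word n w : bounded_measurable (@word n w).
Proof. by rewrite /word; apply: bdd_prod => i; exact: bdd_coord. Qed.

Lemma dotSX x y n : dotS x y ^+ n = \sum_(w : {ffun 'I_n -> 'I_3}) word w x * word w y.
Proof.
rewrite -[in LHS](card_ord n) -prodr_const /dotS bigA_distr_bigA /=.
by apply: eq_bigr => w _; rewrite -big_split.
Qed.

Definition moment n (w : {ffun 'I_n -> 'I_3}) (p : probability R3 R) : R := \int[p]_x word w x.

(** On the sphere, [1 / (s^2 + |x - y|^2)] for [A = 2 + s^2]. *)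
Definition smooth_kernel (A : R) (x y : R3) : R := (A - 2 * dotS x y)^-1.
(** A partial sum of the geometric series of [smooth_kernel]. *)
Definition partial_kernel (A : R) (N : nat) (x y : R3) : R :=
  \sum_(n < N) A^-1 * (2 / A) ^+ n * dotS x y ^+ n.

Lemma bdd_word_comb N (a : nat -> R) (c : forall n, {ffun 'I_n -> 'I_3} -> R) :
  bounded_measurable (fun x =>
    \sum_(n < N) a n * \sum_(w : {ffun 'I_n -> 'I_3}) word w x * c n w).
Proof.
apply: bdd_sum => n; apply: bddM; first exact: bdd_cst.
by apply: bdd_sum => w; apply: bddM; [exact: bdd_word|exact: bdd_cst].
Qed.

Lemma mean_word_comb (m : probability R3 R) N (a : nat -> R)
    (c : forall n, {ffun 'I_n -> 'I_3} -> R) :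
  \int[m]_x (\sum_(n < N) a n * \sum_(w : {ffun 'I_n -> 'I_3}) word w x * c n w) =
  \sum_(n < N) a n * \sum_(w : {ffun 'I_n -> 'I_3}) moment w m * c n w.
Proof.
have bw n w : bounded_measurable (fun x => @word n w x * c n w).
  by apply: bddM; [exact: bdd_word|exact: bdd_cst].
rewrite mean_sum; last first.
  by move=> n; apply: bddM; [exact: bdd_cst|exact: bdd_sum].
apply: eq_bigr => n _; rewrite meanZl; last exact: bdd_sum.
congr (_ * _); rewrite mean_sum//.
by apply: eq_bigr => w _; rewrite meanZr//; exact: bdd_word.
Qed.

Lemma partial_kernelE A N x y : partial_kernel A N x y = \sum_(n < N)
  A^-1 * (2 / A) ^+ n * \sum_(w : {ffun 'I_n -> 'I_3}) word w y * word w x.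
Proof.
apply: eq_bigr => n _; rewrite dotSX; congr (_ * _).
by apply: eq_bigr => w _; rewrite mulrC.
Qed.

Lemma partial_kernel_potential A N (q : probability R3 R) x :
  \int[q]_y partial_kernel A N x y = \sum_(n < N)
    A^-1 * (2 / A) ^+ n * \sum_(w : {ffun 'I_n -> 'I_3}) word w x * moment w q.
Proof.
under eq_Rintegral do rewrite partial_kernelE.
rewrite (mean_word_comb _ _ (fun n => A^-1 * (2 / A) ^+ n) (fun n w => word w x)).
by apply: eq_bigr => n _; congr (_ * _); apply: eq_bigr => w _; rewrite mulrC.
Qed.

Lemma partial_kernel_mean A N (p q : probability R3 R) :
  \int[p]_x \int[q]_y partial_kernel A N x y =
  \sum_(n < N) A^-1 * (2 / A) ^+ n * \sum_(w : {ffun 'I_n -> 'I_3}) moment w p * moment w q.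
Proof.
under eq_Rintegral do rewrite partial_kernel_potential.
exact: (mean_word_comb _ _ (fun n => A^-1 * (2 / A) ^+ n) (fun n w => moment w q)).
Qed.

Lemma smooth_kernel_approx A N x y : 2 < A ->
  `|smooth_kernel A x y - partial_kernel A N x y| <= (2 / A) ^+ N / (A - 2).
Proof.
move=> A2; have A0 : 0 < A by lra.
set t := dotS x y; have /andP[t1 t2] : -1 <= t <= 1 by rewrite -ler_norml dotS_le1.
have E : partial_kernel A N x y = A^-1 * \sum_(n < N) (2 / A * t) ^+ n.
  rewrite /partial_kernel mulr_sumr; apply: eq_bigr => n _.
  by rewrite -/t [(2 / A * t) ^+ n]exprMn mulrA.
have D : 0 < A - 2 * t by lra.
have r1 : 1 - 2 / A * t = (A - 2 * t) / A by field; lra.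
have G : (1 - 2 / A * t) * \sum_(n < N) (2 / A * t) ^+ n = 1 - (2 / A * t) ^+ N.
  by rewrite -[in LHS]opprB mulNr -subrX1 opprB.
have -> : smooth_kernel A x y - partial_kernel A N x y = (2 / A * t) ^+ N / (A - 2 * t).
  rewrite /smooth_kernel -/t E; move: G; rewrite r1; set s := \sum_(_ < _) _ => G.
  have -> : (2 / A * t) ^+ N = 1 - (A - 2 * t) / A * s by rewrite G; ring.
  by field; lra.
rewrite normrM normfV (gtr0_norm D) normrX normrM (gtr0_norm (divr_gt0 _ A0))//.
apply: ler_pM; rewrite ?exprn_ge0 ?mulr_ge0 ?invr_ge0 ?(ltW A0) ?(ltW D)//.
  rewrite lerXn2r ?nnegrE ?mulr_ge0 ?invr_ge0 ?(ltW A0)//.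
  by rewrite ler_piMr ?dotS_le1// divr_ge0 ?(ltW A0).
by rewrite lef_pV2 ?posrE//; lra.
Qed.

Lemma smooth_kernel_bound A x y : 2 < A -> 0 <= smooth_kernel A x y <= (A - 2)^-1.
Proof.
move=> A2; have /andP[t1 t2] : -1 <= dotS x y <= 1 by rewrite -ler_norml dotS_le1.
by rewrite /smooth_kernel invr_ge0 lef_pV2 ?posrE; [apply/andP; split; lra|lra|lra].
Qed.

Lemma measurable_smooth_kernel A :
  measurable_fun setT (fun p : R3 * R3 => smooth_kernel A p.1 p.2).
Proof.
rewrite /smooth_kernel; apply: meas_inv; apply: measurable_funB => //.
apply: measurable_funM => //; rewrite /dotS; apply: measurable_sum => j.
by apply: measurable_funM; apply: (measurableT_comp (proj1 (bdd_coord j))); meas.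
Qed.

Definition smooth_mutual A (p q : probability R3 R) : R :=
  \int[p]_x \int[q]_y smooth_kernel A x y.

Lemma smooth_mutual_approx A N p q : 2 < A ->
  `|smooth_mutual A p q - \int[p]_x \int[q]_y partial_kernel A N x y| <= (2 / A) ^+ N / (A - 2).
Proof.
move=> A2.
have [mk bk] := bdd_mean q (measurable_smooth_kernel A) (fun x y => smooth_kernel_bound x y A2).
have bx x : bounded_measurable (partial_kernel A N x).
  rewrite (funext (partial_kernelE A N x)).
  exact: (bdd_word_comb _ (fun n => A^-1 * (2 / A) ^+ n) (fun n w => word w x)).
apply: mean_dist.
- by split => //; exists (A - 2)^-1.
- rewrite (funext (partial_kernel_potential A N q)).
  exact: (bdd_word_comb _ (fun n => A^-1 * (2 / A) ^+ n) (fun n w => moment w q)).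
- move=> x; apply: mean_dist => //.
    split; last by exists (A - 2)^-1 => y; have /andP[h1 h2] := smooth_kernel_bound x y A2; rewrite ger0_norm.
    apply: (measurableT_comp (measurable_smooth_kernel A) (_ : measurable_fun setT (fun y => (x, y)))).
    by meas.
  by move=> y; exact: smooth_kernel_approx.
Qed.

(** The geometric series has positive coefficients and each power of the inner
    product is a sum of products of words, so that the difference of the two sides
    is a series of squares; the term of degree [n] is kept. *)
Lemma smooth_mutual_gap A p q n : 2 < A ->
  2 * smooth_mutual A p q + A^-1 * (2 / A) ^+ n *
    \sum_(w : {ffun 'I_n -> 'I_3}) (moment w p - moment w q) ^+ 2
  <= smooth_mutual A p p + smooth_mutual A q q.
Proof.
move=> A2; have A0 : 0 < A by lra.
apply/ler_addgt0Pr => e e0.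
have [N [nN Ne]] : exists N, (n < N)%N /\ (2 / A) ^+ N / (A - 2) <= e / 4.
  have q1 : `|2 / A| < 1 by rewrite ger0_norm ?divr_ge0 ?(ltW A0)// ltr_pdivrMr//; lra.
  have e'0 : 0 < e / 4 * (A - 2) by rewrite mulr_gt0 ?divr_gt0//; lra.
  have /cvgrPdist_lt/(_ _ e'0)[N0 _ hN] := cvg_expr q1.
  exists (maxn n.+1 N0); split; first by rewrite leq_max leqnn.
  have := hN (maxn n.+1 N0) (leq_maxr _ _); rewrite /= sub0r normrN => h.
  rewrite ler_pdivrMr; last lra.
  by rewrite (le_trans (ler_norm _))// ltW.
have := smooth_mutual_approx N p q A2; have := smooth_mutual_approx N p p A2.
have := smooth_mutual_approx N q q A2; rewrite !partial_kernel_mean.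
set Epp := (X in `|smooth_mutual A p p - X|); set Eqq := (X in `|smooth_mutual A q q - X|).
set Epq := (X in `|smooth_mutual A p q - X|).
have key : A^-1 * (2 / A) ^+ n * \sum_(w : {ffun 'I_n -> 'I_3}) (moment w p - moment w q) ^+ 2
    <= Epp + Eqq - 2 * Epq.
  have -> : Epp + Eqq - 2 * Epq = \sum_(k < N) A^-1 * (2 / A) ^+ k *
      \sum_(w : {ffun 'I_k -> 'I_3}) (moment w p - moment w q) ^+ 2.
    rewrite /Epp /Eqq /Epq mulr_sumr -big_split -sumrB /=; apply: eq_bigr => k _.
    rewrite mulrCA -mulrDr -mulrBr mulr_sumr -big_split -sumrB /=; congr (_ * _).
    by apply: eq_bigr => w _; ring.
  rewrite (bigD1 (Ordinal nN))//= lerDl; apply: sumr_ge0 => k _.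
  rewrite mulr_ge0// ?mulr_ge0 ?invr_ge0 ?(ltW A0) ?exprn_ge0 ?divr_ge0 ?(ltW A0)//.
  by apply: sumr_ge0 => w _; exact: sqr_ge0.
rewrite !ler_distl => /andP[h1 h2] /andP[h3 h4] /andP[h5 h6].
clearbody Epp Eqq Epq.
move: key h1 h2 h3 h4 h5 h6 Ne.
move: (_ * \sum_(w : _) _) ((2 / A) ^+ N / (A - 2)) => u v; lra.
Qed.

End words.

Section superposition.
Context {R : realType}.
Local Open Scope ereal_scope.
Local Notation L := (@lebesgue_measure R).
Local Notation R3 := (R * R * R)%type.
Local Notation S := (@sphere R).

(** Zero for [s <= 0], so that integrals can run over the whole line. *)
Definition resolvent (s z : R) : R := (\1_(`]0%R, +oo[%classic : set R) s * (s ^+ 2 + z)^-1)%R.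

Lemma resolventE s z : (0 < s)%R -> resolvent s z = ((s ^+ 2 + z)^-1)%R.
Proof. by move=> s0; rewrite /resolvent indicE mem_set ?mul1r//= in_itv /= s0. Qed.

Lemma resolvent0 s z : (s <= 0)%R -> resolvent s z = 0%R.
Proof.
by move=> s0; rewrite /resolvent indicE memNset ?mul0r//= in_itv /= ltNge s0.
Qed.

Lemma resolvent_ge0 s z : (0 <= z)%R -> (0 <= resolvent s z)%R.
Proof.
by move=> z0; rewrite /resolvent mulr_ge0// invr_ge0 addr_ge0// sqr_ge0.
Qed.

Lemma measurable_resolvent d (X : measurableType d) (f g : X -> R) :
  measurable_fun setT f -> measurable_fun setT g ->
  measurable_fun setT (fun x => resolvent (f x) (g x)).
Proof.
move=> mf mg; rewrite /resolvent; apply: measurable_funM; last by meas.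
apply: (measurableT_comp _ mf); apply: measurable_indic; exact: measurable_itv.
Qed.

Lemma integral_resolvent1 : \int[L]_s (resolvent s 1)%:E = (pi / 2)%:E.
Proof.
rewrite -integral0y_oneDsqr -integral_itv_obnd_cbnd; last first.
  have m : measurable_fun setT (fun x : R => ((oneDsqr x)^-1)%:E : \bar R).
    by apply/measurable_EFinP; rewrite /oneDsqr; meas.
  exact: measurable_funS m.
rewrite [RHS]integral_mkcond; apply: eq_integral => s _.
rewrite patchE /resolvent indicE; case: ifPn => _; last by rewrite mul0r.
by rewrite mul1r /oneDsqr addrC.
Qed.

Lemma integral_resolvent z : (0 < z)%R ->
  \int[L]_s (resolvent s z)%:E = (pi / 2)%:E * ((Num.sqrt z)^-1)%:E.
Proof.
move=> z0; set a := Num.sqrt z; have a0 : (0 < a)%R by rewrite sqrtr_gt0.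
have az : (a ^+ 2 = z)%R by rewrite sqr_sqrtr// ltW.
have ai : (0 < a^-1)%R by rewrite invr_gt0.
have mr : measurable_fun setT (fun s : R => (resolvent s 1)%:E : \bar R).
  by apply/measurable_EFinP; apply: measurable_resolvent.
have r0 s : 0 <= (resolvent s 1)%:E :> \bar R by rewrite lee_fin resolvent_ge0.
have mrs : measurable_fun setT (fun s : R => (resolvent (a^-1 * s) 1)%:E : \bar R).
  by apply/measurable_EFinP; apply: measurable_resolvent => //; meas.
have E s : (resolvent s z)%:E = (a^-1 ^+ 2)%:E * (resolvent (a^-1 * s) 1)%:E :> \bar R.
  have [s0|s0] := ltP 0%R s; last first.
    by rewrite !resolvent0 ?mule0// pmulr_rle0.
  rewrite !resolventE ?mulr_gt0// -EFinM; congr (_%:E).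
  rewrite -az; field; have h : (0 < a ^+ 2 + s ^+ 2)%R by rewrite addr_gt0// exprn_gt0.
  by rewrite (gt_eqF a0) (addrC (s ^+ 2)%R) (gt_eqF h).
under eq_integral do rewrite E.
rewrite ge0_integralZl//; last by rewrite lee_fin exprn_ge0// ltW.
rewrite (@lebesgue_scale _ (fun s => (resolvent s 1)%:E))// integral_resolvent1 invrK.
by rewrite -!EFinM; congr (_%:E); field; rewrite gt_eqF.
Qed.

(** Off the diagonal this is the arctangent integral after a dilation; on the
    diagonal, comparison with arbitrarily small distances makes both sides
    infinite. *)
Lemma kern_superposition (x y : R3) :
  \int[L]_s (resolvent s (dist2 x y))%:E = (pi / 2)%:E * kern x y.
Proof.
rewrite /kern enorm3B inver; have := dist2_ge0 x y.
rewrite le_eqVlt => /predU1P[<-|z0]; last first.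
  by rewrite gt_eqF ?sqrtr_gt0// integral_resolvent.
rewrite sqrtr0 eqxx gt0_muley ?lte_fin ?divr_gt0 ?pi_gt0//.
apply/eqyP => A A0; have c0 : (0 < pi / 2 / A :> R)%R by rewrite !divr_gt0// pi_gt0.
have mr z : measurable_fun setT (fun s : R => (resolvent s z)%:E : \bar R).
  by apply/measurable_EFinP; apply: measurable_resolvent.
have -> : A%:E = \int[L]_s (resolvent s ((pi / 2 / A) ^+ 2))%:E.
  rewrite integral_resolvent ?exprn_gt0// sqrtr_sqr ger0_norm ?(ltW c0)// -EFinM.
  by rewrite invf_div mulrCA divff ?mulr1// gt_eqF// divr_gt0// pi_gt0.
apply: ge0_le_integral => //.
- by move=> s _; rewrite lee_fin resolvent_ge0// sqr_ge0.
- exact: mr.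
- exact: mr.
- move=> s _; rewrite lee_fin; have [s0|s0] := ltP 0%R s; last by rewrite !resolvent0.
  rewrite !resolventE// addr0 lef_pV2 ?posrE ?addr_gt0 ?exprn_gt0//.
  by rewrite lerDl sqr_ge0.
Qed.

Definition resolvent_mutual (s : R) (p q : probability R3 R) : \bar R :=
  \int[p]_x \int[q]_y (resolvent s (dist2 x y))%:E.

Let mres3 : measurable_fun setT (fun w : (R3 * measurableTypeR R) * R3 =>
  (resolvent w.1.2 (dist2 w.1.1 w.2))%:E : \bar R).
Proof. by apply/measurable_EFinP; apply: measurable_resolvent; rewrite /dist2; meas. Qed.

Let res3_ge0 (w : (R3 * measurableTypeR R) * R3) : 0 <= (resolvent w.1.2 (dist2 w.1.1 w.2))%:E :> \bar R.
Proof. by rewrite lee_fin resolvent_ge0// dist2_ge0. Qed.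

Let mG (q : probability R3 R) : measurable_fun setT (fun v : R3 * measurableTypeR R =>
  \int[q]_y (resolvent v.2 (dist2 v.1 y))%:E).
Proof.
exact: (@measurable_fun_fubini_tonelli_F _ _ _ _ _ q
  (fun w : (R3 * measurableTypeR R) * R3 => (resolvent w.1.2 (dist2 w.1.1 w.2))%:E) mres3 res3_ge0).
Qed.

Let G0 (q : probability R3 R) (v : R3 * measurableTypeR R) :
  0 <= \int[q]_y (resolvent v.2 (dist2 v.1 y))%:E.
Proof. by apply: integral_ge0 => y _; rewrite lee_fin resolvent_ge0// dist2_ge0. Qed.

Lemma measurable_resolvent_mutual p q :
  measurable_fun setT (fun s : measurableTypeR R => resolvent_mutual s p q).
Proof.
exact: (@measurable_fun_fubini_tonelli_G _ _ _ _ _ p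
  (fun v : R3 * measurableTypeR R => \int[q]_y (resolvent v.2 (dist2 v.1 y))%:E) (mG q) (G0 q)).
Qed.

Lemma resolvent_mutual_ge0 s p q : 0 <= resolvent_mutual s p q.
Proof. by apply: integral_ge0 => x _; exact: (G0 q (x, s)). Qed.

Lemma mutual_superposition p q :
  \int[L]_s resolvent_mutual s p q = (pi / 2)%:E * mutual p q.
Proof.
have pi20 : 0 <= (pi / 2)%:E :> \bar R by rewrite lee_fin divr_ge0// pi_ge0.
rewrite /resolvent_mutual -(@fubini_tonelli _ _ _ _ _ p L
  (fun v : R3 * measurableTypeR R => \int[q]_y (resolvent v.2 (dist2 v.1 y))%:E) (mG q) (G0 q)) /=.
rewrite /mutual -ge0_integralZl//; last 2 first.
- exact: measurable_potential.
- by move=> x _; exact: potential_ge0.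
apply: eq_integral => x _.
have mxs : measurable_fun setT (fun v : measurableTypeR R * R3 =>
    (resolvent v.1 (dist2 x v.2))%:E : \bar R).
  by apply/measurable_EFinP; apply: measurable_resolvent; rewrite /dist2; meas.
have xs0 (v : measurableTypeR R * R3) : 0 <= (resolvent v.1 (dist2 x v.2))%:E :> \bar R.
  by rewrite lee_fin resolvent_ge0// dist2_ge0.
rewrite (@fubini_tonelli _ _ _ _ _ L q
  (fun v : measurableTypeR R * R3 => (resolvent v.1 (dist2 x v.2))%:E) mxs xs0) /=.
rewrite /potential -ge0_integralZl//; last 2 first.
- exact: measurable_kernl.
- by move=> y _; exact: kern_ge0.
by apply: eq_integral => y _; rewrite kern_superposition.
Qed.

Lemma resolvent_mutual_smooth s (p q : probability R3 R) : (0 < s)%R -> p S = 1 -> q S = 1 ->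
  resolvent_mutual s p q = (smooth_mutual (2 + s ^+ 2) p q)%:E.
Proof.
move=> s0 pS qS; have meS := @measurable_sphere R.
have s2 : (0 < s ^+ 2)%R by rewrite exprn_gt0.
have A2 : (2 < 2 + s ^+ 2)%R by rewrite ltrDl.
have [mk bk] := bdd_mean q (measurable_smooth_kernel (2 + s ^+ 2)) (fun x y => smooth_kernel_bound x y A2).
have bx x : bounded_measurable (smooth_kernel (2 + s ^+ 2) x).
  split; last first.
    exists (2 + s ^+ 2 - 2)^-1%R => y.
    by have /andP[h1 h2] := smooth_kernel_bound x y A2; rewrite ger0_norm.
  apply: (measurableT_comp (measurable_smooth_kernel _) (_ : measurable_fun setT (fun y => (x, y)))).
  by meas.
rewrite /smooth_mutual mean_EFin; last by split => //; exists (2 + s ^+ 2 - 2)^-1%R.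
have k0 x y : (0 <= smooth_kernel (2 + s ^+ 2) x y)%R.
  by have /andP[] := smooth_kernel_bound x y A2.
apply: (@eq_integral_on _ _ _ p S) => //.
- exact: (measurableT_comp (mG q) (_ : measurable_fun setT (fun x : R3 => (x, s : measurableTypeR R)))); meas.
- exact/measurable_EFinP.
- by move=> x; exact: (G0 q (x, s)).
- by move=> x; rewrite lee_fin; apply: Rintegral_ge0.
move=> x xS; rewrite mean_EFin//; apply: (@eq_integral_on _ _ _ q S) => //.
- by apply/measurable_EFinP; apply: measurable_resolvent => //; exact: measurable_dist2l.
- by apply/measurable_EFinP; case: (bx x).
- by move=> y; rewrite lee_fin resolvent_ge0// dist2_ge0.
- by move=> y; rewrite lee_fin.
move=> y yS; rewrite resolventE// /smooth_kernel dotS_sphere// dist2_sphere//.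
by congr ((_^-1)%:E); ring.
Qed.

(** At each level [s] positive definiteness gives the opposite of the energy
    inequality, with a gap that is bounded below for [0 < s <= 1]; integration
    over [s] forces the gap to vanish. *)
Lemma energy_moments (p q : probability R3 R) n (w : {ffun 'I_n -> 'I_3}) :
  p S = 1 -> q S = 1 -> mutual p p < +oo -> mutual q q < +oo ->
  mutual p p + mutual q q <= 2%:E * mutual p q -> moment w p = moment w q.
Proof.
move=> pS qS pp qq hpq; apply/eqP; rewrite -subr_eq0 -sqrf_eq0; apply/eqP.
pose d : R := (\sum_(w : {ffun 'I_n -> 'I_3}) (moment w p - moment w q) ^+ 2)%R.
have d0 : (0 <= d)%R by apply: sumr_ge0 => v _; exact: sqr_ge0.
suff : (d <= 0)%R.
  move=> dle; apply/eqP; rewrite eq_le sqr_ge0 andbT (le_trans _ dle)//.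
  by rewrite /d (bigD1 w)//= lerDl sumr_ge0// => v _; exact: sqr_ge0.
(* The coefficient of degree [n] for [A = 3], the largest value of [2 + s^2]
   for [s <= 1]. *)
pose g : R := (3^-1 * (2 / 3) ^+ n)%R.
have g0 : (0 < g)%R by rewrite mulr_gt0// ?exprn_gt0.
have m1 : measurable (`]0%R, 1%R]%classic : set (measurableTypeR R)) by exact: measurable_itv.
have mI : measurable_fun setT (fun s : measurableTypeR R => (\1_(`]0%R, 1%R]%classic : set R) s)%:E : \bar R).
  by apply/measurable_EFinP; exact: measurable_indic.
have gd0 : 0 <= (g * d)%:E :> \bar R by rewrite lee_fin mulr_ge0// ltW.
have step (s : R) : 2%:E * resolvent_mutual s p q + (g * d)%:E * (\1_(`]0%R, 1%R]%classic : set R) s)%:E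
    <= resolvent_mutual s p p + resolvent_mutual s q q.
  have [s0|s0] := ltP 0%R s; last first.
    rewrite indicE memNset ?mule0 ?adde0; last by rewrite /= in_itv /= ltNge s0.
    rewrite {1}/resolvent_mutual integral0_eq; last first.
      by move=> x _; rewrite integral0_eq// => y _; rewrite resolvent0.
    by rewrite mule0 adde_ge0// resolvent_mutual_ge0.
  rewrite !resolvent_mutual_smooth// -!EFinM -!EFinD lee_fin.
  have A2 : (2 < 2 + s ^+ 2)%R by rewrite ltrDl exprn_gt0.
  apply: le_trans (smooth_mutual_gap p q n A2); rewrite -/d lerD2l.
  rewrite indicE; have [|_] := boolP (s \in _); last first.
    rewrite mulr0 mulr_ge0// mulr_ge0 ?invr_ge0 ?exprn_ge0 ?divr_ge0//; exact: (ltW (lt_trans _ A2)).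
  rewrite inE /= in_itv /= => /andP[_ s1]; rewrite mulr1 ler_wpM2r//.
  have A3 : (2 + s ^+ 2 <= 3)%R by have : (s ^+ 2 <= 1)%R; [rewrite expr_le1// ltW|lra].
  have A0 : (0 < 2 + s ^+ 2)%R by exact: lt_trans A2.
  rewrite /g; apply: ler_pM.
  - by rewrite invr_ge0.
  - by rewrite exprn_ge0// divr_ge0.
  - by rewrite lef_pV2 ?posrE.
  - rewrite lerXn2r ?nnegrE ?divr_ge0// ?(ltW A0)//.
    by rewrite ler_pM2l// lef_pV2 ?posrE.
pose U (a b : probability R3 R) : measurableTypeR R -> \bar R := fun s => resolvent_mutual s a b.
have mU a b : measurable_fun setT (U a b) := measurable_resolvent_mutual a b.
have U0 a b s : 0 <= U a b s by exact: resolvent_mutual_ge0.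
have IU a b : \int[L]_s U a b s = (pi / 2)%:E * mutual a b := mutual_superposition a b.
have {}step s : 2%:E * U p q s + (g * d)%:E * (\1_(`]0%R, 1%R]%classic : set R) s)%:E
    <= U p p s + U q q s by exact: step.
clearbody U.
have : \int[L]_s (2%:E * U p q s + (g * d)%:E * (\1_(`]0%R, 1%R]%classic : set R) s)%:E)
    <= \int[L]_s (U p p s + U q q s).
  apply: ge0_le_integral => //.
  - by move=> s _; rewrite adde_ge0// mule_ge0// ?lee_fin.
  - by apply: emeasurable_funD; apply: measurable_funeM.
  - exact: emeasurable_funD.
rewrite ge0_integralD//; last 4 first.
- by move=> s _; rewrite mule_ge0// lee_fin.
- exact: measurable_funeM.
- by move=> s _; rewrite mule_ge0// lee_fin.
- exact: measurable_funeM.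
rewrite ge0_integralD// ge0_integralZl// ge0_integralZl//.
have -> : \int[L]_s (\1_(`]0%R, 1%R]%classic : set R) s)%:E = 1.
  rewrite integral_indic// setIT; apply: etrans (lebesgue_measure_itv `]0%R, 1%R]) _.
  by rewrite /= lte_fin ltr01 sube0.
rewrite !IU.
rewrite mule1.
move: pp qq hpq (mutual_ge0 p p) (mutual_ge0 q q) (mutual_ge0 p q).
have pi20 : (0 < pi / 2 :> R)%R by rewrite divr_gt0// pi_gt0.
case: (mutual p p) => [a||]// _; case: (mutual q q) => [b||]// _.
case: (mutual p q) => [c||]//; last first.
  by move=> _ _ _ _; rewrite gt0_muley ?lte_fin// gt0_muley ?lte_fin// addye.
move=> hab' _ _ _ h'.
have hab : (a + b <= 2 * c)%R by rewrite -lee_fin; exact: hab'.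
have h : (2 * (pi / 2 * c) + g * d <= pi / 2 * a + pi / 2 * b)%R by rewrite -lee_fin; exact: h'.
have h2 : ((pi / 2) * (a + b) <= (pi / 2) * (2 * c))%R by rewrite ler_pM2l.
have : (g * d <= 0)%R by move: h h2; move: (g * d)%R => u; lra.
by rewrite pmulr_rle0.
Qed.

End superposition.

(** * Moments determine a measure on the sphere *)
Section bump.
Context {R : realType}.

Lemma bernoulli (v : R) n : -1 <= v -> 1 + n%:R * v <= (1 + v) ^+ n.
Proof.
move=> v1; elim: n => [|n IH]; first by rewrite mul0r addr0 expr0.
rewrite exprS; apply: (@le_trans _ _ ((1 + v) * (1 + n%:R * v))); last first.
  by rewrite ler_wpM2l//; lra.
rewrite -natr1; have : 0 <= n%:R * v ^+ 2 by rewrite mulr_ge0 ?sqr_ge0.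
by move: (n%:R : R) => k; rewrite expr2; nra.
Qed.

Lemma cvg_natr_expr (q : R) : 0 <= q < 1 -> (fun n : nat => n%:R * q ^+ n) @ \oo --> 0.
Proof.
move=> /andP[]; rewrite le_eqVlt => /predU1P[<- _|q0 q1].
  rewrite (_ : (fun n => _) = cst 0); first exact: cvg_cst.
  by apply/funext => -[|n]; rewrite ?mul0r// exprS mul0r mulr0.
pose r := Num.sqrt q; have r0 : 0 < r by rewrite sqrtr_gt0.
have rq : r ^+ 2 = q by rewrite sqr_sqrtr// ltW.
have r1 : r < 1 by rewrite -(@ltr_pXn2r _ 2) ?nnegrE ?(ltW r0)// rq expr1n.
pose h := r^-1 - 1; have h0 : 0 < h by rewrite subr_gt0 invf_gt1.
have b n : n%:R * q ^+ n <= h^-1 * r ^+ n.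
  rewrite -rq -exprM mulnC exprM expr2 mulrA ler_wpM2r ?exprn_ge0 ?(ltW r0)//.
  have hn : n%:R * h <= (r ^+ n)^-1.
    have hE : 1 + h = r^-1 by rewrite /h addrC subrK.
    have H : 1 + n%:R * h <= (1 + h) ^+ n by apply: bernoulli; rewrite (le_trans _ (ltW h0))// lerN10.
    by rewrite hE exprVn in H; rewrite (le_trans _ H)// lerDr.
  rewrite -(ler_pM2r h0) mulVf ?(gt_eqF h0)// mulrAC.
  by rewrite -ler_pdivlMr ?exprn_gt0// div1r.
apply: (@squeeze_cvgr _ _ _ _ (cst 0) (fun n => h^-1 * r ^+ n)).
- near=> n; rewrite b andbT mulr_ge0// exprn_ge0// ltW//.
- exact: cvg_cst.
- rewrite -(mulr0 h^-1); apply: cvgM; first exact: cvg_cst.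
  by apply: cvg_expr; rewrite gtr0_norm.
Unshelve. all: by end_near.
Qed.

Definition bump (n : nat) (u : R) : R := (1 - u ^+ n) ^+ (n * 2 ^ n).

Lemma bump01 n u : 0 <= u <= 1 -> 0 <= bump n u <= 1.
Proof.
move=> /andP[u0 u1]; have h0 : 0 <= u ^+ n by rewrite exprn_ge0.
have h1 : u ^+ n <= 1 by rewrite exprn_ile1.
rewrite /bump exprn_ge0 ?subr_ge0// exprn_ile1 ?subr_ge0//.
by rewrite lerBlDr lerDl.
Qed.

(** Bernoulli's inequality compares [bump n u] with [n (2 u)^n], the product of the
    exponent and [u^n]. The factor [n] makes the limit vanish at the threshold
    itself, where the product is [n]. *)
Lemma bump_cvg (u : R) : 0 <= u <= 1 -> (fun n => bump n u) @ \oo --> ((u < 2^-1)%R%:R : R).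
Proof.
move=> /andP[u0 u1].
have v01 n : 0 <= u ^+ n <= 1 by rewrite exprn_ge0// exprn_ile1.
have E n : (n * 2 ^ n)%:R * u ^+ n = n%:R * (2 * u) ^+ n :> R.
  by rewrite natrM natrX exprMn mulrA.
have [uh|uh] := ltP u 2^-1 => /=.
  apply: (@squeeze_cvgr _ _ _ _ (fun n => 1 - n%:R * (2 * u) ^+ n) (cst 1)).
  - near=> n; have /andP[b0 b1] := @bump01 n u (introT andP (conj u0 u1)).
    rewrite /= b1 andbT /bump -E -mulrN; apply: bernoulli.
    by rewrite lerN2; have /andP[] := v01 n.
  - rewrite -[X in _ --> X]subr0; apply: cvgB; first exact: cvg_cst.
    by apply: cvg_natr_expr; rewrite mulr_ge0//=; lra.
  - exact: cvg_cst.
apply: (@squeeze_cvgr _ _ _ _ (cst 0) (@harmonic R)).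
- near=> n; have /andP[b0 b1] := @bump01 n u (introT andP (conj u0 u1)).
  rewrite b0 /=; have [v0 v1] := andP (v01 n).
  have h1 : n%:R <= (n * 2 ^ n)%:R * u ^+ n :> R.
    by rewrite E ler_peMr// exprn_ege1//; lra.
  have h2 := @bernoulli (u ^+ n) (n * 2 ^ n); rewrite (le_trans _ v0) ?lerN10// in h2.
  have h3 : bump n u * (1 + u ^+ n) ^+ (n * 2 ^ n) <= 1.
    rewrite /bump -exprMn exprn_ile1//.
      by rewrite mulr_ge0 ?subr_ge0// addr_ge0.
    by rewrite -subr_sqr expr1n lerBlDr lerDl sqr_ge0.
  rewrite /harmonic /= -(@ler_pM2r _ n.+1%:R)// mulVf// (le_trans _ h3)// ler_wpM2l//.
  by rewrite (le_trans _ (h2 isT))// -natr1 addrC lerD2l.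
- exact: cvg_cst.
- exact: cvg_harmonic.
Unshelve. all: by end_near.
Qed.

End bump.

Section determinacy.
Context {R : realType}.
Local Notation R3 := (R * R * R)%type.
Local Notation S := (@sphere R).

Inductive polynomial_fun : (R3 -> R) -> Prop :=
| poly_cst c : polynomial_fun (fun=> c)
| poly_coord j : polynomial_fun (cut_coord j)
| poly_add f g : polynomial_fun f -> polynomial_fun g -> polynomial_fun (fun x => f x + g x)
| poly_mul f g : polynomial_fun f -> polynomial_fun g -> polynomial_fun (fun x => f x * g x).

Lemma poly_exp f n : polynomial_fun f -> polynomial_fun (fun x => f x ^+ n).
Proof.
move=> pf; elim: n => [|n IH].
  by under eq_fun do rewrite expr0; exact: poly_cst.
by under eq_fun do rewrite exprS; exact: poly_mul.
Qed.

(** Words of arbitrary length, closed under concatenation. *)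
Definition seq_word (s : seq 'I_3) (x : R3) : R := \prod_(j <- s) cut_coord j x.

Lemma seq_wordE s : seq_word s = word [ffun i : 'I_(size s) => tnth (in_tuple s) i].
Proof.
apply/funext => x; rewrite /seq_word /word big_tnth.
by apply: eq_bigr => i _; rewrite ffunE.
Qed.

Lemma polynomial_words f : polynomial_fun f ->
  exists r : seq (R * seq 'I_3), forall x, f x = \sum_(t <- r) t.1 * seq_word t.2 x.
Proof.
elim => [c|j|g h _ [r rE] _ [s sE]|g h _ [r rE] _ [s sE]].
- by exists [:: (c, [::])] => x; rewrite big_seq1 /seq_word big_nil mulr1.
- by exists [:: (1, [:: j])] => x; rewrite big_seq1 /seq_word big_seq1 mul1r.
- by exists (r ++ s) => x; rewrite rE sE big_cat.
- exists [seq (t.1 * u.1, t.2 ++ u.2) | t <- r, u <- s] => x.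
  rewrite rE sE mulr_suml big_allpairs_dep /=; apply: eq_bigr => t _.
  rewrite mulr_sumr; apply: eq_bigr => u _ /=.
  by rewrite /seq_word big_cat /=; ring.
Qed.

Section equal_moments.
Variables p q : probability R3 R.
Hypotheses (pS : p S = 1%E) (qS : q S = 1%E).
Hypothesis pq : forall n (w : {ffun 'I_n -> 'I_3}), moment w p = moment w q.

Lemma polynomial_bdd f : polynomial_fun f -> bounded_measurable f.
Proof.
elim => [c|j|g h _ ? _ ?|g h _ ? _ ?];
  [exact: bdd_cst|exact: bdd_coord|exact: bddD|exact: bddM].
Qed.

Lemma polynomial_mean f : polynomial_fun f -> \int[p]_x f x = \int[q]_x f x.
Proof.
move=> /polynomial_words[r rE].
have bw (t : R * seq 'I_3) : bounded_measurable (seq_word t.2).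
  by rewrite seq_wordE; exact: bdd_word.
have key (m : probability R3 R) : \int[m]_x f x = \sum_(t <- r) t.1 * \int[m]_x seq_word t.2 x.
  under eq_Rintegral do rewrite rE.
  rewrite mean_sum; last by move=> t; apply: bddM => //; exact: bdd_cst.
  by apply: eq_bigr => t _; rewrite meanZl.
rewrite !key; apply: eq_bigr => t _; congr (_ * _).
by rewrite seq_wordE; exact: pq.
Qed.

Definition octant (a : R3) : set R3 := [set x | [/\ x.1.1 < a.1.1, x.1.2 < a.1.2 & x.2 < a.2]].

(** Maps [[-1, 1]] into [[0, 1]] and [a] to the threshold of [bump]. *)
Definition rescale (a u : R) : R := (u - a) / (4 * (1 + `|a|)) + 2^-1.

Lemma rescale01 a u : `|u| <= 1 -> 0 <= rescale a u <= 1.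
Proof.
move=> u1; have : `|u - a| <= 1 + `|a| by rewrite (le_trans (ler_normB _ _))// lerD2r.
have d0 : 0 < 1 + `|a| by rewrite ltr_pwDl.
rewrite ler_norml => /andP[h1 h2]; rewrite /rescale.
have k1 : - (4^-1) <= (u - a) / (4 * (1 + `|a|)).
  rewrite ler_pdivlMr ?mulr_gt0//; move: (1 + `|a|) h1 h2 => b; lra.
have k2 : (u - a) / (4 * (1 + `|a|)) <= 4^-1.
  rewrite ler_pdivrMr ?mulr_gt0//; move: (1 + `|a|) h1 h2 => b; lra.
move: (_ / _) k1 k2 => z; lra.
Qed.

Lemma rescale_lt a u : (rescale a u < 2^-1) = (u < a).
Proof.
rewrite /rescale gtrDr pmulr_llt0 ?subr_lt0// invr_gt0 mulr_gt0//.
Qed.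

Definition mid_coord : 'I_3 := Ordinal (isT : (1 < 3)%N).

Definition octant_poly (a : R3) (n : nat) (x : R3) : R :=
  bump n (rescale a.1.1 (cut_coord ord0 x)) * bump n (rescale a.1.2 (cut_coord mid_coord x)) *
  bump n (rescale a.2 (cut_coord ord_max x)).

Lemma poly_bump n a j : polynomial_fun (fun x => bump n (rescale a (cut_coord j x))).
Proof.
have pr : polynomial_fun (fun x => rescale a (cut_coord j x)).
  rewrite /rescale; apply: poly_add; last exact: poly_cst.
  by apply: poly_mul; [apply: poly_add; [exact: poly_coord|exact: poly_cst]|exact: poly_cst].
rewrite /bump; apply: poly_exp; apply: poly_add; first exact: poly_cst.
under eq_fun do rewrite -mulN1r; apply: poly_mul; first exact: poly_cst.
exact: poly_exp.
Qed.

Lemma measurable_octant a : measurable (octant a).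
Proof.
have ray (f : R3 -> R) b : measurable_fun setT f -> measurable [set x | f x < b].
  move=> mf; rewrite (_ : [set x | _] = f @^-1` `]-oo, b[%classic).
    exact: meas_preimage.
  by apply/seteqP; split => x /=; rewrite in_itv.
rewrite (_ : octant a = [set x : R3 | x.1.1 < a.1.1] `&`
  ([set x | x.1.2 < a.1.2] `&` [set x | x.2 < a.2])); last first.
  by apply/seteqP; split => x /= => [[? ? ?]|[? [? ?]]].
by apply: measurableI; [|apply: measurableI]; apply: ray; meas.
Qed.

Lemma octant_cvg (m : probability R3 R) a : m S = 1%E ->
  (\int[m]_x (octant_poly a n x)%:E @[n --> \oo] --> m (octant a))%E.
Proof.
move=> mS.
pose lim_ (x : R3) : R := (cut_coord ord0 x < a.1.1)%R%:R * (cut_coord mid_coord x < a.1.2)%R%:R *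
   (cut_coord ord_max x < a.2)%R%:R.
have bp n : bounded_measurable (octant_poly a n).
  apply: polynomial_bdd; apply: poly_mul; first apply: poly_mul; exact: poly_bump.
have cv x : (fun n => octant_poly a n x) @ \oo --> lim_ x.
  rewrite /octant_poly /lim_ -!(rescale_lt _ (cut_coord _ x)).
  by apply: cvgM; first apply: cvgM; apply: bump_cvg; apply: rescale01; exact: coord_le1.
have b1 n x : `|octant_poly a n x| <= 1.
  have h b j := @bump01 _ n (rescale b (cut_coord j x)) (rescale01 _ (coord_le1 j x)).
  rewrite /octant_poly !normrM.
  have /andP[h1 h1'] := h a.1.1 ord0; have /andP[h2 h2'] := h a.1.2 mid_coord.
  have /andP[h3 h3'] := h a.2 ord_max.
  rewrite !ger0_norm//; apply: mulr_ile1 => //; first exact: mulr_ge0.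
  exact: mulr_ile1.
have mlim : measurable_fun setT lim_.
  apply: (measurable_fun_cvg (h := fun n => octant_poly a n)) => //.
    by move=> n; case: (bp n).
have -> : m (octant a) = (\int[m]_x (lim_ x)%:E)%E.
  have mO : measurable_fun setT (fun x => (\1_(octant a) x)%:E : \bar R).
    by apply/measurable_EFinP; apply: measurable_indic; exact: measurable_octant.
  transitivity (\int[m]_x (\1_(octant a) x)%:E)%E.
    by rewrite integral_indic ?setIT//; exact: measurable_octant.
  apply: (@eq_integral_on _ _ _ m S) => //.
  - exact: measurable_sphere.
  - exact/measurable_EFinP.
  - by move=> x; rewrite lee_fin /lim_ !mulr_ge0.
  move=> x xS.
  have c1 : cut_coord ord0 x = x.1.1 by rewrite /cut_coord indicE mem_set// mulr1.
  have c2 : cut_coord mid_coord x = x.1.2 by rewrite /cut_coord indicE mem_set// mulr1.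
  have c3 : cut_coord ord_max x = x.2 by rewrite /cut_coord indicE mem_set// mulr1.
  rewrite /lim_ c1 c2 c3 indicE -!natrM !mulnb; congr ((_ : nat)%:R%:E); congr (nat_of_bool _).
  apply/idP/idP.
    by rewrite inE => -[-> -> ->].
  by rewrite inE => /andP[/andP[? ?] ?].
have := @dominated_convergence _ _ _ m setT measurableT
  (fun n x => (octant_poly a n x)%:E) (fun x => (lim_ x)%:E) (fun=> 1%E).
case.
- by move=> n; apply/measurable_EFinP; case: (bp n).
- exact/measurable_EFinP.
- by apply: aeW => x _; apply: cvg_EFin; [exact: nearW|exact: cv].
- by apply: (@bdd_integrable _ _ _ m (fun=> 1)); exact: bdd_cst.
- by apply: aeW => x n _; rewrite /= lee_fin.
by [].
Qed.

Lemma octant_eq a : p (octant a) = q (octant a).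
Proof.
have h1 := @octant_cvg p a pS; have := @octant_cvg q a qS.
rewrite (_ : (fun n => _) = (fun n => \int[p]_x (octant_poly a n x)%:E)%E).
  by move=> h2; exact: (cvg_unique _ h1 h2).
apply/funext => n.
have pp : polynomial_fun (octant_poly a n).
  by apply: poly_mul; first apply: poly_mul; exact: poly_bump.
by rewrite -!mean_EFin ?polynomial_mean//; exact: polynomial_bdd.
Qed.

Lemma octant_generates : @measurable _ R3 = <<s range octant >>.
Proof.
apply/seteqP; split; last first.
  apply: smallest_sub; first exact: sigma_algebra_measurable.
  by move=> _ [a _ <-]; exact: measurable_octant.
move=> A mA.
pose T := g_sigma_algebraType (range octant).
have mid (f : R3 -> R) : (forall a, (range octant).-sigma.-measurable [set x | f x < a]) ->
    measurable_fun setT (f : T -> R).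
  move=> hf; apply: (measurability _ (RGenInftyO.measurableE R)).
  move=> _ [_ [a ->] <-]; rewrite setTI.
  by have := hf a; congr (measurable _); apply/seteqP; split => x /=; rewrite in_itv.
have cover (P : R3 -> Prop) (F : nat -> R3) : (forall x, P x <-> exists n, octant (F n) x) ->
    (range octant).-sigma.-measurable [set x | P x].
  move=> h; rewrite (_ : [set x | P x] = \bigcup_n octant (F n)).
    by apply: bigcupT_measurable => n; apply: sub_sigma_algebra; exists (F n).
  apply/seteqP; split => x /=; first by move=> /h[n ?]; exists n.
  by move=> [n _ ?]; apply/h; exists n.
have arch (u v : R) : exists n : nat, u < n%:R /\ v < n%:R.
  exists (Num.bound (Num.max `|u| `|v|)).
  have : Num.max `|u| `|v| < (Num.bound (Num.max `|u| `|v|))%:R.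
    by apply: archi_boundP; rewrite le_max normr_ge0.
  by rewrite gt_max => /andP[h1 h2]; split; apply: le_lt_trans (ler_norm _) _.
have m1 : measurable_fun setT ((fun x : R3 => x.1.1) : T -> R).
  apply: mid => a; apply: (cover _ (fun n => (a, n%:R, n%:R))) => x; split.
    by move=> xa; have [n [? ?]] := arch x.1.2 x.2; exists n.
  by move=> [n []].
have m2 : measurable_fun setT ((fun x : R3 => x.1.2) : T -> R).
  apply: mid => a; apply: (cover _ (fun n => (n%:R, a, n%:R))) => x; split.
    by move=> xa; have [n [? ?]] := arch x.1.1 x.2; exists n.
  by move=> [n []].
have m3 : measurable_fun setT ((fun x : R3 => x.2) : T -> R).
  apply: mid => a; apply: (cover _ (fun n => (n%:R, n%:R, a))) => x; split.
    by move=> xa; have [n [? ?]] := arch x.1.1 x.1.2; exists n.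
  by move=> [n []].
have mI : measurable_fun setT (fun x : T => ((x.1.1, x.1.2), x.2) : R3).
  by apply: measurable_fun_pair => //; exact: measurable_fun_pair.
have := mI measurableT A mA; rewrite setTI.
by congr (_ _); apply/seteqP; split => -[[x y] z].
Qed.

(** Octants are a pi-system generating the Borel sets, and their indicators are
    bounded limits of polynomials on the sphere. *)
Lemma moment_determinacy A : measurable A -> p A = q A.
Proof.
move=> mA.
apply: (@measure_unique _ _ _ (range octant) (fun n => octant (n%:R, n%:R, n%:R))) => //.
- exact: octant_generates.
- move=> _ _ [a _ <-] [b _ <-].
  exists (Num.min a.1.1 b.1.1, Num.min a.1.2 b.1.2, Num.min a.2 b.2) => //.
  apply/seteqP; split => x /=; rewrite /octant /= !lt_min.
    by move=> [/andP[? ?] /andP[? ?] /andP[? ?]].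
  by move=> [[-> -> ->] [-> -> ->]].
- apply/seteqP; split => // x _.
  pose M := Num.max `|x.1.1| (Num.max `|x.1.2| `|x.2|).
  exists (Num.bound M) => //.
  have : M < (Num.bound M)%:R by apply: archi_boundP; rewrite le_max normr_ge0.
  rewrite !gt_max => /and3P[h1 h2 h3].
  by split; apply: le_lt_trans (ler_norm _) _.
- by move=> _ [a _ <-]; exact: octant_eq.
- by move=> n; rewrite (le_lt_trans (probability_le1 _ _))// ?ltry//; exact: measurable_octant.
Qed.

End equal_moments.
End determinacy.

(** * Axial symmetry of the extremal measure *)
Section rotation.
Context {R : realType}.
Local Open Scope ereal_scope.
Local Notation R3 := (R * R * R)%type.
Local Notation S := (@sphere R).

Lemma kern_rot12 (c s : R) (x y : R3) : (c ^+ 2 + s ^+ 2 = 1)%R ->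
  kern (rot12 c s x) (rot12 c s y) = kern x y.
Proof. by move=> cs; rewrite /kern !enorm3B !dist2E !dot_rot12. Qed.

Lemma sphere_rot12 (c s : R) (x : R3) : (c ^+ 2 + s ^+ 2 = 1)%R ->
  S (rot12 c s x) <-> S x.
Proof. by move=> cs; rewrite !sphereP dot_rot12. Qed.

Variables (Q : R3 -> \bar R) (mu : probability R3 R).
Hypotheses (Q0 : forall x, S x -> 0 <= Q x) (mQ : measurable_fun S Q).
Hypotheses (mumin : extremal_measure Q mu) (mufin : weighted_energy Q mu < +oo).
Hypothesis Qrot : rotationally_invariant Q.

(** A rotated extremal measure has the same energy and field. By the first
    variation its mutual energy with the original is at least as large, and
    [energy_moments] identifies the two. *)
Lemma extremal_rotation : axially_symmetric mu.
Proof.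
move=> c s h cs mh h0; have [muS _] := mumin.
have [p [pA pI]] := pushforward_probability mu (@measurable_rot12 R c s).
have meS := @measurable_sphere R.
have pS : p S = 1.
  rewrite pA// (_ : _ @^-1` _ = S) ?muS//.
  by apply/seteqP; split => x /= /(sphere_rot12 x cs).
have [afin qfin] := finite_energy Q0 mumin mufin.
have mP (m : probability R3 R) := measurable_potential m.
have P0 (m : probability R3 R) x := potential_ge0 m x.
have mQs := measurable_sphere_field mQ.
have Qs0 := sphere_field_ge0 Q0.
have ppE : mutual p p = mutual mu mu.
  transitivity (\int[mu]_x potential p (rot12 c s x)); first by rewrite -pI.
  apply: eq_integral => x _.
  rewrite /potential pI; [|exact: measurable_kernl|by move=> y; exact: kern_ge0].
  by apply: eq_integral => y _; rewrite kern_rot12.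
have pQ : \int[p]_x sphere_field Q x = \int[mu]_x sphere_field Q x.
  rewrite pI//; apply: eq_integral => x _; rewrite /sphere_field !patchE.
  have [xS|xS] := pselect (S x); last first.
    by rewrite !memNset// => /(sphere_rot12 x cs).
  have rS : S (rot12 c s x) by apply/(sphere_rot12 x cs).
  by rewrite !mem_set//; apply: Qrot.
have ppfin : mutual p p < +oo by rewrite ppE -ge0_fin_numE// mutual_ge0.
have := first_variation Q0 mQ mumin mufin pS ppfin.
rewrite pQ -ge0_fin_numE; last by apply: integral_ge0 => x _; exact: Qs0.
move=> /(_ qfin); rewrite (robin_constantE Q0 mumin mufin) ge0_integralD// pQ leeD2rE// => h1.
have pmu A : measurable A -> p A = mu A.
  apply: moment_determinacy => // n w; apply: energy_moments => //.
    by rewrite -ge0_fin_numE// mutual_ge0.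
  move: h1; rewrite ppE -/(mutual p mu).
  case: (mutual mu mu) afin => [a||]// _; case: (mutual p mu) => [j||]// h1.
    by move: h1; rewrite lee_fin -!EFinM -!EFinD lee_fin => h1; rewrite mulr_natl mulr2n lerD.
  by rewrite gt0_muley ?lte_fin// leey.
rewrite -pI//; apply: eq_measure_integral => A mA _; exact: pmu.
Qed.

End rotation.

(** * Disintegration along the parallels *)
Section archimedes_change_of_variable.
Context {R : realType}.
Local Open Scope ereal_scope.
Local Notation L := (@lebesgue_measure R).

Lemma measurable_sin : measurable_fun setT (@sin R).
Proof. apply: continuous_measurable_fun; exact: continuous_sin. Qed.
Lemma measurable_cos : measurable_fun setT (@cos R).
Proof. apply: continuous_measurable_fun; exact: continuous_cos. Qed.

Lemma integral_sin (a : R) : (0 <= a < pi)%R ->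
  \int[L]_(x in `[a, pi]) (sin x)%:E = (cos a + 1)%:E.
Proof.
move=> /andP[a0 api].
have hd x : (a <= x <= pi)%R -> is_derive x 1%R (fun x => - cos x)%R (sin x).
  by move=> _; rewrite -[sin x]opprK; exact: is_deriveN (is_derive_cos x).
have hc x : (a <= x <= pi)%R -> {for x, continuous (@sin R)}.
  by move=> _; exact: continuous_sin.
by rewrite (FTC_is_derive api hd hc) cospi; congr (_%:E); ring.
Qed.

(** The two sides are integrals against measures that agree on rays, where the
    fundamental theorem of calculus computes both. *)
Lemma cos_substitution (G : R -> \bar R) : measurable_fun setT G -> (forall t, 0 <= G t) ->
  \int[L]_(t in `[(-1)%R, 1%R]) G t =
  \int[L]_(x in `[0%R, pi]) (G (cos x) * (sin x)%:E).
Proof.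
move=> mG G0; have N11 : (-1 <= 1 :> R)%R by lra.
pose T := measurableTypeR R.
pose I1 : set T := `[(-1)%R, 1%R]%classic; pose I2 : set T := `[0%R, pi]%classic.
have mI1 : measurable I1 by exact: measurable_itv.
have mI2 : measurable I2 by exact: measurable_itv.
pose g1 (t : T) : R := \1_I1 t; pose g2 (x : T) : R := (\1_I2 x * sin x)%R.
have mg1 : measurable_fun setT g1 by exact: measurable_indic.
have mg2 : measurable_fun setT g2.
  by apply: measurable_funM; [exact: measurable_indic|exact: measurable_sin].
have g10 t : (0 <= g1 t)%R by rewrite /g1.
have g20 x : (0 <= g2 x)%R.
  rewrite /g2 indicE; have [|_] := boolP (x \in I2); last by rewrite mul0r.
  by rewrite inE /I2 /= in_itv /= mul1r; exact: sin_ge0_pi.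
have mc : measurable_fun setT (cos : T -> T) by exact: measurable_cos.
have [m1 [m1E im1]] := @image_density_measure _ _ T T R L g1 id mg1 g10 (@measurable_id _ T setT).
have [m2 [m2E im2]] := @image_density_measure _ _ T T R L g2 cos mg2 g20 mc.
have toset (I : set T) (h : T -> \bar R) (k : T -> R) : measurable I ->
    \int[L]_x (h x * (\1_I x * k x)%:E) = \int[L]_(x in I) (h x * (k x)%:E).
  move=> mI; rewrite [RHS]integral_mkcond; apply: eq_integral => x _.
  rewrite patchE indicE; case: ifPn => _; first by rewrite mul1r.
  by rewrite mul0r mule0.
have E1 : \int[m1]_t G t = \int[L]_(t in I1) G t.
  rewrite im1//; transitivity (\int[L]_x (G x * (\1_I1 x * 1)%:E)).
    by apply: eq_integral => x _; rewrite mulr1.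
  by rewrite (toset _ _ (fun=> 1%R))//; apply: eq_integral => x _; rewrite mule1.
have E2 : \int[m2]_t G t = \int[L]_(x in I2) (G (cos x) * (sin x)%:E).
  by rewrite im2// (toset _ (fun x => G (cos x)) sin).
rewrite -/I1 -/I2 -E1 -E2; apply: eq_measure_integral => A mA _.
have ray1 (c : R) : m1 `]-oo, c[%classic = \int[L]_(x in I1 `&` `]-oo, c[%classic) 1.
  rewrite m1E /image_density preimage_id integral_mkcond [RHS]integral_mkcond.
  apply: eq_integral => x _; rewrite !patchE /g1 indicE in_setI.
  by case: (x \in I1); case: (x \in _).
have ray2 (c : R) : m2 `]-oo, c[%classic =
    \int[L]_(x in I2 `&` (cos @^-1` `]-oo, c[%classic)) (sin x)%:E.
  rewrite m2E /image_density integral_mkcond [RHS]integral_mkcond.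
  apply: eq_integral => x _; rewrite !patchE /g2 indicE in_setI.
  by case: (x \in I2); case: (x \in _); rewrite ?mul1r ?mul0r.
have Lm (a b : R) : (a <= b)%R -> \int[L]_(x in `[a, b[) 1 = (b - a)%:E.
  move=> ab; rewrite integral_cst//.
  rewrite mul1e; apply: etrans (lebesgue_measure_itv `[a, b[) _.
  rewrite /= lte_fin; have [->|h] := eqVneq a b; first by rewrite ltxx subrr.
  by rewrite lt_neqAle h ab EFinB.
have pi0 : (0 < pi :> R)%R := pi_gt0 R.
have rays (c : R) : m1 `]-oo, c[%classic = m2 `]-oo, c[%classic.
  rewrite ray1 ray2.
  have [c1|c1] := leP c (-1)%R.
    rewrite (_ : I1 `&` _ = set0); last first.
      apply/seteqP; split => // t [] /=; rewrite /I1 /= !in_itv /= => /andP[h1 h2] h3.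
      by have := le_lt_trans (le_trans c1 h1) h3; rewrite ltxx.
    rewrite (_ : I2 `&` _ = set0); last first.
      apply/seteqP; split => // t [] /=; rewrite in_itv /= => _ h3.
      by have := le_lt_trans (le_trans c1 (cos_geN1 t)) h3; rewrite ltxx.
    by rewrite !integral_set0.
  have [c2|c2] := ltP 1%R c.
    rewrite (_ : I1 `&` _ = I1); last first.
      apply/seteqP; split => [t []//|t]; rewrite /I1 /= !in_itv /= => h; split => //.
      by case/andP: h => _ h; exact: le_lt_trans c2.
    rewrite (_ : I2 `&` _ = I2); last first.
      apply/seteqP; split => [t []//|t]; rewrite /I2 /= !in_itv /= => h; split => //.
      by rewrite (le_lt_trans (cos_le1 t)).
    rewrite /I2 integral_sin ?lexx ?pi0// cos0.
    rewrite /I1 -integral_itv_bndo_bndc// Lm//.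
    by congr (_%:E); ring.
  have ci : (-1 <= c <= 1)%R by rewrite (ltW c1).
  have ca : cos (acos c) = c by apply: acosK; rewrite in_itv.
  have a0 := acos_ge0 ci.
  have api : (acos c < pi)%R by apply: acos_ltpi; rewrite c1.
  rewrite (_ : I1 `&` _ = `[(-1)%R, c[%classic); last first.
    apply/seteqP; split => t /=; rewrite /I1 /= !in_itv /=.
      by move=> [/andP[-> _] ->].
    by move=> /andP[h1 h2]; split => //; rewrite h1 (le_trans (ltW h2)).
  rewrite (_ : I2 `&` _ = `]acos c, pi]%classic); last first.
    apply/seteqP; split => t /=; rewrite /I2 /= !in_itv /=.
      move=> [/andP[h1 h2] h3]; rewrite h2 andbT.
      by rewrite -ltr_cos ?in_itv /= ?h1 ?h2 ?a0 ?(ltW api)// ca.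
    move=> /andP[h1 h2]; rewrite h2 (le_trans a0 (ltW h1)); split => //.
    by rewrite -ca ltr_cos ?in_itv /= ?a0 ?(ltW api) ?h2 ?(le_trans a0 (ltW h1)).
  rewrite Lm ?ltW// integral_itv_obnd_cbnd; last first.
    by apply/measurable_EFinP; apply: measurable_funS measurable_sin.
  by rewrite integral_sin ?a0// ca; congr (_%:E); ring.
apply: (@measure_unique _ R T (@RGenInftyO.G R) (fun n : nat => `]-oo, (n%:R : R)%R[%classic) _ _ _ _ m1 m2) => //.
- exact: RGenInftyO.measurableE.
- move=> _ _ [a ->] [b ->]; exists (Num.min a b).
  by apply/seteqP; split => x /=; rewrite !in_itv /= lt_min; [move=> [-> ->]|move=> /andP[]].
- by move=> n; exists (n%:R : R)%R.
- apply/seteqP; split => // x _; exists (Num.bound `|x|%R) => //=.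
  by rewrite in_itv /= (le_lt_trans (ler_norm _))// archi_boundP.
- by move=> _ [a ->]; exact: rays.
- move=> n; rewrite ray1; apply: (@le_lt_trans _ _ (\int[L]_(x in I1) 1)).
    apply: ge0_subset_integral => //; apply: measurableI => //; exact: measurable_itv.
  by rewrite /I1 -integral_itv_bndo_bndc// Lm ?ltry//.
Qed.

End archimedes_change_of_variable.

Section disintegration.
Context {R : realType}.
Local Open Scope ereal_scope.
Local Notation L := (@lebesgue_measure R).
Local Notation R3 := (R * R * R)%type.
Local Notation S := (@sphere R).

Lemma integral_period (f : R -> \bar R) (T t : R) : measurable_fun setT f ->
  (forall x, 0 <= f x) -> (forall x, f (x + T)%R = f x) -> (0 <= t <= T)%R ->
  \int[L]_(x in `[0%R, T]) f (x + t)%R = \int[L]_(x in `[0%R, T]) f x.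
Proof.
move=> mf f0 fT /andP[t0 tT].
have mf' (c : R) : measurable_fun setT (fun x : R => f (x + c)%R).
  by apply: (measurableT_comp mf); meas.
have mr (h : R -> \bar R) (I : interval R) : measurable_fun setT h ->
    measurable_fun setT (h \_ [set` I]).
  by move=> mh; apply/(measurable_restrictT _ _).1 => //; exact: measurable_funS mh.
have shift_ (I J : interval R) (c : R) : (forall x, (x + c \in J)%R = (x \in I)) ->
    \int[L]_(x in [set` I]) f (x + c)%R = \int[L]_(x in [set` J]) f x.
  move=> IJ; rewrite integral_mkcond [RHS]integral_mkcond.
  rewrite -[RHS](@lebesgue_translate _ _ c); last 2 first.
  - exact: mr.
  - by move=> x; exact: erestrict_ge0.
  apply: eq_integral => x _; rewrite !patchE.
  by rewrite !mem_setE IJ.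
rewrite (shift_ _ `[t, (T + t)%R]); last first.
  by move=> x; rewrite !in_itv /= lerDr lerD2r.
have split1 : \int[L]_(x in `[t, (T + t)%R]) f x =
    \int[L]_(x in `[t, T]) f x + \int[L]_(x in `]T, (T + t)%R]) f x.
  rewrite (@itv_bndbnd_setU _ _ _ (BRight T)) ?bnd_simp ?lerDl//.
  rewrite ge0_integral_setU//; try exact: measurable_itv.
    exact: measurable_funS mf.
  apply/disj_setPS => x [] /=; rewrite !in_itv /= => /andP[_ h1] /andP[h2 _]; lra.
have split2 : \int[L]_(x in `[0%R, T]) f x =
    \int[L]_(x in `[0%R, t[) f x + \int[L]_(x in `[t, T]) f x.
  rewrite (@itv_bndbnd_setU _ _ _ (BLeft t)) ?bnd_simp//.
  rewrite ge0_integral_setU//; try exact: measurable_itv.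
    exact: measurable_funS mf.
  apply/disj_setPS => x [] /=; rewrite !in_itv /= => /andP[_ h1] /andP[h2 _]; lra.
rewrite split1 split2 addeC; congr (_ + _).
rewrite -(shift_ `]0%R, t] _ T); last first.
  by move=> x; rewrite !in_itv /= ltrDr (addrC x) lerD2l.
under eq_integral do rewrite fT.
rewrite integral_itv_bndoo; last exact: measurable_funS mf.
by rewrite [RHS]integral_itv_bndoo//; exact: measurable_funS mf.
Qed.

Definition parallel_point (t theta : R) : R3 :=
  (Num.sqrt (1 - t ^+ 2) * cos theta, Num.sqrt (1 - t ^+ 2) * sin theta, t)%R.

(** Measured by the longitude: every full parallel has length [2 pi]. *)
Definition parallel_length (A : set R3) (t : R) : \bar R :=
  \int[L]_(theta in `[0%R, (2 * pi)%R]) (\1_A (parallel_point t theta))%:E.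

Lemma circle_angle (c s : R) : (c ^+ 2 + s ^+ 2 = 1)%R ->
  exists2 t, (0 <= t <= 2 * pi)%R & c = cos t /\ s = sin t.
Proof.
move=> cs; have c1 : (-1 <= c <= 1)%R.
  rewrite -ler_norml -(@ler_pXn2r _ 2) ?nnegrE// real_normK ?num_real// expr1n -cs.
  by rewrite lerDl sqr_ge0.
have ca : cos (acos c) = c by apply: acosK; rewrite in_itv.
have sa : sin (acos c) = `|s|%R.
  by rewrite sin_acos// -cs addrAC subrr add0r sqrtr_sqr.
have a0 := acos_ge0 c1; have api := acos_lepi c1; have pi0 := pi_gt0 R.
have [s0|s0] := leP 0%R s.
  exists (acos c); first by rewrite a0 /=; lra.
  by rewrite ca sa ger0_norm.
exists (2 * pi - acos c)%R; first by apply/andP; split; lra.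
have -> : (2 * pi - acos c = - acos c + pi *+ 2)%R by rewrite mulr2n; ring.
by rewrite cosD2pi sinD2pi cosN sinN ca sa ltr0_norm// opprK.
Qed.

Lemma sphere_parallel (y : R3) : S y -> (-1 <= y.2 <= 1)%R /\
  exists2 t, (0 <= t <= 2 * pi)%R & y = parallel_point y.2 t.
Proof.
move=> yS; have [_ _ y3] := sphere_coord_le1 yS.
rewrite -ler_norml; split => //.
have /sphereP := yS; rewrite /dot => e.
have rE : (1 - y.2 ^+ 2 = y.1.1 ^+ 2 + y.1.2 ^+ 2)%R by rewrite -e; ring.
have r0 : (0 <= 1 - y.2 ^+ 2)%R by rewrite rE addr_ge0 ?sqr_ge0.
set r := Num.sqrt (1 - y.2 ^+ 2).
have r2 : (r ^+ 2 = 1 - y.2 ^+ 2)%R by rewrite sqr_sqrtr.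
have [r00|rn] := eqVneq r 0%R.
  exists 0%R; first by rewrite lexx mulr_ge0// pi_ge0.
  have : (y.1.1 ^+ 2 + y.1.2 ^+ 2 == 0)%R by rewrite -rE -r2 r00 expr0n.
  rewrite paddr_eq0 ?sqr_ge0// !sqrf_eq0 => /andP[/eqP h1 /eqP h2].
  rewrite /parallel_point -/r r00 !mul0r.
  by move: h1 h2; case: (y) => [[a b] d] /= -> ->.
have rp : (0 < r)%R by rewrite lt_def rn sqrtr_ge0.
have [|t ht [ct st]] := @circle_angle (y.1.1 / r) (y.1.2 / r).
  by rewrite !expr_div_n -mulrDl -rE -r2 divff// sqrf_eq0.
exists t => //; rewrite /parallel_point -/r -ct -st !(mulrC r) !divfK//.
by case: (y) => [[a b] d].
Qed.

Lemma rot12_parallel t a b : rot12 (cos b) (sin b) (parallel_point t a) = parallel_point t (b + a).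
Proof.
rewrite /rot12 /parallel_point /= cosD sinD; congr (_, _, _); ring.
Qed.

Lemma measurable_parallel_point :
  measurable_fun setT (fun p : R * R => parallel_point p.1 p.2).
Proof.
rewrite /parallel_point; meas.
- exact: (measurableT_comp measurable_cos).
- exact: (measurableT_comp measurable_sin).
Qed.

Local Notation T := (measurableTypeR R).

Lemma measurable_parallel_indic A : measurable A -> measurable_fun setT
  (fun p : T * T => (\1_(`[0%R, (2 * pi)%R]%classic : set T) p.2 * \1_A (parallel_point (p.1 : R) (p.2 : R)) : R)%:E).
Proof.
move=> mA; apply/measurable_EFinP; apply: measurable_funM.
  by apply: (measurableT_comp _ (@measurable_snd _ _ T T)); apply: measurable_indic; exact: measurable_itv.
apply: (measurableT_comp _ measurable_parallel_point); exact: measurable_indic.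
Qed.

Lemma parallel_lengthE A t : parallel_length A t =
  \int[L]_theta (\1_(`[0%R, (2 * pi)%R]%classic : set T) theta * \1_A (parallel_point t theta))%:E.
Proof.
rewrite /parallel_length integral_mkcond; apply: eq_integral => x _.
by rewrite patchE [in RHS]indicE; case: ifP => _; rewrite ?mul1r ?mul0r.
Qed.

Lemma measurable_parallel_length A : measurable A -> measurable_fun setT (parallel_length A : T -> \bar R).
Proof.
move=> mA; rewrite (_ : parallel_length A = fun t => \int[L]_theta
  (\1_(`[0%R, (2 * pi)%R]%classic : set T) theta * \1_A (parallel_point t theta))%:E); last first.
  by apply/funext => t; exact: parallel_lengthE.
apply: (@measurable_fun_fubini_tonelli_F _ _ T T R L
  (fun p : T * T => (\1_(`[0%R, (2 * pi)%R]%classic : set T) p.2 * \1_A (parallel_point (p.1 : R) (p.2 : R)) : R)%:E)).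
  exact: measurable_parallel_indic.
by move=> p; rewrite lee_fin mulr_ge0.
Qed.

Lemma parallel_length_ge0 A t : 0 <= parallel_length A t.
Proof. by apply: integral_ge0 => x _; rewrite lee_fin. Qed.

(** The invariance is averaged over all angles and the integrals are exchanged: the
    set of angles that rotate [y] into [A] has the length of [A] on the parallel
    of [y]. *)
Lemma disintegration (m : probability R3 R) A : m S = 1 -> axially_symmetric m ->
  measurable A -> (2 * pi)%:E * m A = \int[m]_y parallel_length A y.2.
Proof.
move=> mS mrot mA; have meS := @measurable_sphere R.
have pi0 : (0 < 2 * pi :> R)%R by rewrite mulr_gt0// pi_gt0.
pose J : set T := `[0%R, (2 * pi)%R]%classic.
have mJ : measurable J by exact: measurable_itv.
pose F (p : R3 * T) : \bar R := (\1_J p.2 * \1_A (rot12 (cos p.2) (sin p.2) p.1))%:E.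
have mIA : measurable_fun setT (fun y => (\1_A y)%:E : \bar R).
  by apply/measurable_EFinP; exact: measurable_indic.
have mF : measurable_fun setT F.
  apply/measurable_EFinP; apply: measurable_funM.
    by apply: (measurableT_comp _ (@measurable_snd _ _ R3 T)); exact: measurable_indic.
  have mr : measurable_fun setT (fun p : R3 * T => rot12 (cos p.2) (sin p.2) p.1).
    rewrite /rot12; meas; try exact: (measurableT_comp measurable_cos);
      exact: (measurableT_comp measurable_sin).
  by apply: (measurableT_comp _ mr); exact: measurable_indic.
have F0 p : 0 <= F p by rewrite lee_fin mulr_ge0.
have LJ : \int[L]_theta (\1_J theta)%:E = (2 * pi)%:E.
  rewrite integral_indic// setIT; apply: etrans (lebesgue_measure_itv `[0%R, (2 * pi)%R]) _.
  by rewrite /= lte_fin pi0 sube0.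
have mAE : m A = \int[m]_y (\1_A y)%:E by rewrite integral_indic// setIT.
transitivity (\int[L]_theta \int[m]_y F (y, theta)).
  transitivity (\int[L]_theta ((\1_J theta)%:E * m A)).
    by rewrite ge0_integralZr ?LJ//; apply/measurable_EFinP; exact: measurable_indic.
  apply: eq_integral => theta _; rewrite /F /= mAE.
  have cs : (cos theta ^+ 2 + sin theta ^+ 2 = 1 :> R)%R by exact: cos2Dsin2.
  rewrite -(mrot _ _ _ cs mIA) => [|x]; last by rewrite lee_fin.
  rewrite -ge0_integralZl//.
  - by move: (measurableT_comp mIA (@measurable_rot12 R (cos theta) (sin theta))).
rewrite -(@fubini_tonelli _ _ _ _ _ m L F mF F0).
apply: (@eq_integral_on _ _ _ m S) => //.
- exact: (@measurable_fun_fubini_tonelli_F _ _ _ _ _ L F mF F0).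
- apply: (measurableT_comp (measurable_parallel_length mA)); exact: measurable_snd.
- by move=> y; apply: integral_ge0 => x _; exact: F0.
- by move=> y; exact: parallel_length_ge0.
move=> y yS; have [_ [t0 ht0 yE]] := sphere_parallel yS.
have mpt : measurable_fun setT (fun x : R => (\1_A (parallel_point y.2 x))%:E : \bar R).
  apply: (measurableT_comp mIA); apply: (measurableT_comp measurable_parallel_point
    (_ : measurable_fun setT (fun x : R => (y.2, x)))); meas.
rewrite /parallel_length -(@integral_period _ (2 * pi) t0)//; last first.
  move=> x; congr ((\1_A _)%:E); rewrite /parallel_point.
  have -> : (x + 2 * pi = x + pi *+ 2)%R by rewrite mulr2n; ring.
  by rewrite cosD2pi sinD2pi.
rewrite [RHS]integral_mkcond; apply: eq_integral => x _.
rewrite /F /= patchE {1}yE rot12_parallel [\1_J x]indicE.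
by rewrite -/J; case: ifP => _; rewrite ?mul1r ?mul0r.
Qed.

Lemma surface_measureE A : measurable A ->
  surface_measure A = \int[L]_(t in `[(-1)%R, 1%R]) parallel_length A t.
Proof.
move=> mA; rewrite cos_substitution//; last 2 first.
- exact: measurable_parallel_length.
- exact: parallel_length_ge0.
rewrite /surface_measure; apply: eq_integral => x; rewrite inE /= in_itv /= => h.
have s0 := sin_ge0_pi h.
have E : (Num.sqrt (1 - cos x ^+ 2) = sin x)%R by rewrite -sin2cos2 sqrtr_sqr ger0_norm.
have pE y : parallel_point (cos x) y = spherical 1 y x.
  by rewrite /parallel_point /spherical E !mul1r.
rewrite /parallel_length -ge0_integralZr//; last first.
- apply/measurable_EFinP; apply: (@measurable_funS _ _ _ _ setT) => //.
  have mI : measurable_fun setT (\1_A : R3 -> R) by exact: measurable_indic.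
  apply: (measurableT_comp mI).
  apply: (measurableT_comp measurable_parallel_point
    (_ : measurable_fun setT (fun y : R => (cos x, y)))); meas.
by apply: eq_integral => y _; rewrite pE EFinM.
Qed.

End disintegration.

(** * Finiteness of the minimal energy *)
Section finite_weighted_energy.
Context {R : realType}.
Local Open Scope ereal_scope.
Local Notation L := (@lebesgue_measure R).
Local Notation R3 := (R * R * R)%type.
Local Notation S := (@sphere R).

Lemma uniform_surface (sb : probability R3 R) A :
  archimedean_sphere sb -> axially_symmetric sb -> measurable A ->
  (2 * pi)%:E * sb A = (1 / 2)%:E * surface_measure A.
Proof.
move=> [sbS sbA] sbrot mA; rewrite (disintegration sbS sbrot mA) surface_measureE//.
have eS : S ((0%R, 0%R, 1%R) : R3) by apply/sphereP; rewrite /dot /=; ring.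
have mP := measurable_parallel_length mA.
have := sbA _ eS (parallel_length A) mP (parallel_length_ge0 A).
have -> : \int[L]_(t in `[(-1)%R, 1%R]) parallel_length A t =
    \int[L]_(t in `](-1)%R, 1%R[) parallel_length A t.
  by rewrite [LHS]integral_itv_bndoo//; exact: measurable_funS mP.
move=> <-; apply: eq_integral => y _; congr (parallel_length A _).
by rewrite /dot /=; ring.
Qed.

(** Some sublevel set of [Q] is charged by the uniform measure; conditioned on it,
    that measure has bounded potential by Newton's theorem, and bounded field. *)
Lemma finite_weighted_energy (Q : R3 -> \bar R) (mu : probability R3 R) :
  external_field Q -> extremal_measure Q mu -> weighted_energy Q mu < +oo.
Proof.
move=> [Q0 lscQ surf] [muS mumin]; have meS := @measurable_sphere R.
have mQ := lsc_measurable lscQ.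
have mQs := measurable_sphere_field mQ; have Qs0 := sphere_field_ge0 Q0.
have QsE y : S y -> sphere_field Q y = Q y by move=> yS; rewrite /sphere_field patchE mem_set.
have [sb [sbU sbrot]] := @uniform_sphere R.
pose A n := S `&` [set x | sphere_field Q x <= (n%:R)%:E].
have mA n : measurable (A n).
  apply: measurableI => //; rewrite -[X in measurable X]setTI.
  exact: emeasurable_fun_infty_c.
have AU : S `&` [set x | Q x < +oo] = \bigcup_n A n.
  apply/seteqP; split => x.
    move=> [xS /= Qx]; have Qf : Q x \is a fin_num by rewrite ge0_fin_numE// Q0.
    exists (Num.bound (fine (Q x))) => //; split => //=; rewrite QsE// -(fineK Qf) lee_fin.
    by rewrite ltW// archi_boundP// fine_ge0// Q0.
  move=> [n _ [xS /= Qn]]; split => //=; rewrite -QsE//.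
  exact: le_lt_trans Qn (ltry _).
have [n An] : exists n, 0 < sb (A n).
  apply: contrapT => none; move: surf; rewrite AU => surf.
  have An0 n : sb (A n) = 0.
    by apply/eqP; rewrite eq_le measure_ge0 andbT leNgt; apply/negP => h; apply: none; exists n.
  have U0 : sb (\bigcup_n A n) = 0.
    apply: measure_negligible; first exact: bigcupT_measurable.
    by apply: negligible_bigcup => k; exists (A k); split => //; exact: An0.
  have := uniform_surface sbU sbrot (bigcupT_measurable A mA).
  rewrite U0 mule0; case: (surface_measure _) surf => [r||]//.
  - rewrite lte_fin -EFinM => r0 [] /esym/eqP; rewrite mulf_eq0 (gt_eqF r0) orbF.
    by rewrite mul1r invr_eq0 pnatr_eq0.
  - by rewrite gt0_muley// lte_fin divr_gt0.
have sbfin : sb (A n) \is a fin_num by exact: fin_num_measure.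
pose v := fine (sb (A n)); have vE : sb (A n) = v%:E by rewrite fineK.
have v0 : (0 < v)%R by rewrite -lte_fin -vE.
have An0 : sb (A n) != 0 by rewrite vE eqe gt_eqF.
have [nu nuE] := conditional_probability (mA n) An0; rewrite -/v in nuE.
have vi0 : 0 <= (v^-1)%:E by rewrite lee_fin invr_ge0 ltW.
have nuS : unit_measure nu.
  have mIS : measurable_fun setT (fun x : R3 => (\1_S x)%:E : \bar R).
    by apply/measurable_EFinP; exact: measurable_indic.
  have : \int[nu]_x (\1_S x)%:E = 1.
    rewrite nuE// (eq_integral (cst 1)); last first.
      by move=> x; rewrite inE => -[xS _]; rewrite indicE mem_set.
    by rewrite integral_cst// mul1e [X in _ * X]vE -EFinM mulVf// gt_eqF.
  by rewrite integral_indic// setIT.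
have nuS1 : nu S = 1 := nuS.
have potle w : S w -> potential nu w <= (v^-1)%:E.
  move=> wS; have mk := measurable_kernl w.
  rewrite /potential nuE//; last by move=> y; exact: kern_ge0.
  rewrite -[leRHS]mule1 lee_wpmul2l//; apply: le_trans (newton_surface sbU wS).
  apply: (@le_trans _ _ (\int[sb]_y kern w y)).
    by apply: ge0_subset_integral => // y _; exact: kern_ge0.
  by apply: ge0_le_integral => //; [move=> y _; exact: kern_ge0|
    exact: measurable_kernr|move=> y _; rewrite kernC].
rewrite mumin; apply: (@le_lt_trans _ _ (weighted_energy Q nu)).
  by apply: ereal_inf_lbound; exists nu.
rewrite weighted_energyE//.
have h1 : mutual nu nu <= (v^-1)%:E.
  apply: (@le_trans _ _ (\int[nu]_w (v^-1)%:E)).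
    apply: (@le_integral_on _ _ _ nu S) => //.
    - exact: measurable_potential.
    - by move=> w; exact: potential_ge0.
  rewrite integral_cst// -[leRHS]mule1 lee_wpmul2l//.
  exact: probability_le1.
have h2 : \int[nu]_x sphere_field Q x <= (n%:R)%:E.
  rewrite nuE//; apply: (@le_trans _ _ ((v^-1)%:E * \int[sb]_(x in A n) (n%:R)%:E)).
    rewrite lee_wpmul2l//; apply: ge0_le_integral => //.
    - exact: measurable_funS mQs.
    - by move=> x [_ /= xn].
  rewrite integral_cst// [X in _ * (_ * X)]vE muleCA -EFinM mulVf ?mulr1 ?gt_eqF//.
apply: (@le_lt_trans _ _ ((v^-1)%:E + 2%:E * (n%:R)%:E)).
  by rewrite leeD// lee_wpmul2l// lee_fin.
by rewrite -EFinM -EFinD ltry.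
Qed.

End finite_weighted_energy.

(** * The law of the height *)
Section slabs.
Context {R : realType}.
Local Notation R3 := (R * R * R)%type.
Local Notation S := (@sphere R).

Lemma sin_lipschitz (a b : R) : `|sin b - sin a| <= `|b - a|.
Proof.
have [c [_ _ ->]] := @mvt_unordered R sin cos a (`|b - a| + 1) a b
  (fun t _ => is_derive_sin t) ltac:(by rewrite subrr normr0 ltr_wpDl) ltac:(by rewrite ltrDl).
rewrite normrM ler_piMl// ler_norml cos_geN1 cos_le1 //.
Qed.

Lemma sin_sqr_le (x : R) : sin x ^+ 2 <= x ^+ 2.
Proof.
have := sin_lipschitz 0 x; rewrite sin0 !subr0 => h.
by rewrite -(real_normK (num_real (sin x))) -(real_normK (num_real x)) lerXn2r ?nnegrE.
Qed.

Lemma one_sub_cos_le (x : R) : 2 * (1 - cos x) <= x ^+ 2.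
Proof.
have xE : x = (x / 2) *+ 2 by rewrite mulr2n -splitr.
rewrite {1}xE cos_mulr2n cos2sin2.
have := sin_sqr_le (x / 2); rewrite expr_div_n; move: (sin _ ^+ 2) (x ^+ 2) => u v.
by rewrite -mulr_natl; lra.
Qed.

(** The mean value theorem for [cos], with the intermediate point moved to the
    endpoint [b] at a quadratic cost. *)
Lemma cos_sub_ge (a b : R) : a <= b ->
  (b - a) * sin b <= cos a - cos b + 2 * (b - a) ^+ 2.
Proof.
move=> ab.
have [c [_ ca E]] := @mvt_unordered R cos (fun t => - sin t) a (`|b - a| + 1) a b
  (fun t _ => is_derive_cos t) ltac:(by rewrite subrr normr0 ltr_wpDl) ltac:(by rewrite ltrDl).
have r0 : 0 <= b - a by rewrite subr_ge0.
have h : sin b - sin c <= 2 * (b - a).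
  have := sin_lipschitz c b; rewrite ler_norml => /andP[_ h]; apply: (le_trans h).
  rewrite (le_trans (ler_distD a _ _))//.
  by move: ca; rewrite (distrC c) (ger0_norm r0) => ca; lra.
have := ler_wpM2l r0 h; move: E.
move: (cos a) (cos b) (sin b) (sin c) (b - a) => u v s s' d; rewrite expr2; lra.
Qed.

Lemma dist2_spherical (t p t' p' : R) : 0 <= p <= pi -> 0 <= p' <= pi ->
  dist2 (spherical 1 t p) (spherical 1 t' p') <=
  (p - p') ^+ 2 + sin p * sin p' * (t - t') ^+ 2.
Proof.
move=> hp hp'; have s0 := sin_ge0_pi hp; have s0' := sin_ge0_pi hp'.
rewrite dist2_sphere; try exact: spherical_sphere.
have -> : 2 - 2 * dot (spherical 1 t p) (spherical 1 t' p') =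
    2 * (1 - cos (p - p')) + sin p * sin p' * (2 * (1 - cos (t - t'))).
  by rewrite !cosB /dot /spherical /=; ring.
by apply: lerD; rewrite ?one_sub_cos_le// ler_wpM2l ?mulr_ge0 ?one_sub_cos_le.
Qed.

Variables (mu : probability R3 R) (K : R).
Hypotheses (K0 : 0 < K).
Hypothesis growth : forall (q : R3) (r : R), 0 < r ->
  (mu [set w | (dist2 q w <= r ^+ 2)%R] <= (K * r ^+ 2)%:E)%E.

Definition slab (c d : R) : set R3 := S `&` [set y | c <= y.2 <= d].

Lemma measurable_slab c d : measurable (slab c d).
Proof.
apply: measurableI; first exact: measurable_sphere.
rewrite (_ : [set y | _] = (fun y : R3 => y.2) @^-1` `[c, d]%classic).
  by apply: meas_preimage => //; meas.
by apply/seteqP; split => y /=; rewrite in_itv.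
Qed.

(** The ring is covered by balls of radius twice its width, centred at equally
    spaced points of its lower rim. *)
Lemma ring_bound (a b : R) : 0 <= a < b -> b <= pi ->
  (mu (slab (cos b) (cos a)) <=
    (8 * pi * K * (cos a - cos b) + (24 * pi + 8) * K * (b - a) ^+ 2)%:E)%E.
Proof.
move=> /andP[a0 ab] bpi; set r := b - a.
have r0 : 0 < r by rewrite subr_gt0.
have pi0 : 0 < pi :> R := pi_gt0 R.
have b0 : 0 <= b by rewrite (le_trans a0)// ltW.
have sb0 : 0 <= sin b by apply: sin_ge0_pi; rewrite b0.
(* [M] bounds the radii of the parallels of the ring, [sin] being 1-Lipschitz. *)
pose M := sin b + r; have M0 : 0 < M by rewrite ltr_wpDl.
have sinM p : a <= p <= b -> 0 <= sin p <= M.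
  move=> /andP[pa pb]; rewrite sin_ge0_pi/=; last by rewrite (le_trans a0 pa) (le_trans pb bpi).
  have := sin_lipschitz b p; rewrite ler_distl => /andP[_ h].
  rewrite (le_trans h)// lerD2l ler0_norm ?subr_le0// opprB lerD2l lerN2//.
have rM := cos_sub_ge (ltW ab); rewrite -/r in rM.
(* Consecutive centres are less than the width [r] apart in arc length. *)
pose n := (Num.truncn (2 * pi * M / r)).+1.
have [n1 n2] : n%:R <= 2 * pi * M / r + 1 /\ 2 * pi * M / r < n%:R.
  have /andP[h1 h2] : (Num.truncn (2 * pi * M / r))%:R <= 2 * pi * M / r < (Num.truncn (2 * pi * M / r)).+1%:R.
    by apply: truncn_itv; rewrite divr_ge0 ?mulr_ge0 ?ltW.
  by split => //; rewrite /n -natr1 lerD2r.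
have n0 : 0 < n%:R :> R by rewrite ltr0n.
pose p_ (k : nat) : R3 := spherical 1 (2 * pi * k%:R / n%:R) b.
pose B k : set R3 := [set w | dist2 (p_ k) w <= (2 * r) ^+ 2].
have cover : slab (cos b) (cos a) `<=` \bigcup_(k in [set k | (k < n.+1)%N]) B k.
  move=> y [yS /= /andP[yb ya]].
  have [y1 [t /andP[t0 t1] yE]] := sphere_parallel yS.
  pose p := acos y.2; have cp : cos p = y.2 by apply: acosK; rewrite in_itv.
  have p0 := acos_ge0 y1; have ppi := acos_lepi y1.
  have inp : p \in `[0, pi] by rewrite in_itv /= p0.
  have hp : a <= p <= b.
    apply/andP; split; rewrite leNgt; apply/negP.
      rewrite -ltr_cos ?in_itv /= ?p0 ?ppi ?a0 ?(le_trans (ltW ab))// cp => h.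
      by have := le_lt_trans ya h; rewrite ltxx.
    rewrite -ltr_cos ?in_itv /= ?p0 ?ppi ?b0// cp => h.
    by have := lt_le_trans h yb; rewrite ltxx.
  have yE' : y = spherical 1 t p.
    rewrite yE /parallel_point /spherical cp !mul1r.
    by rewrite -[y.2]cp -sin2cos2 sqrtr_sqr ger0_norm// sin_ge0_pi// p0.
  pose k := Num.truncn (t * n%:R / (2 * pi)).
  have tp : 0 <= t * n%:R / (2 * pi).
    by apply: divr_ge0; [exact: mulr_ge0|rewrite mulr_ge0// ltW].
  have /andP[k1 k2] := truncn_itv tp; rewrite -/k in k1 k2.
  exists k.
    rewrite /= ltnS -(ler_nat R) (le_trans k1)// ler_pdivrMr ?mulr_gt0//.
    by rewrite mulrC ler_wpM2l// ltW.
  rewrite /B /= yE' (le_trans (dist2_spherical _ _ _ _))//.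
  - by rewrite b0.
  have [/andP[s0 sM] /andP[_ sbM]] : 0 <= sin p <= M /\ 0 <= sin b <= M.
    by split; apply: sinM => //; rewrite (ltW ab) lexx.
  have h1 : (b - p) ^+ 2 <= r ^+ 2.
    have [u0 ur] : 0 <= b - p /\ b - p <= r.
      by case/andP: hp => h1 h2; rewrite subr_ge0 h2 /r lerD2l lerN2.
    by rewrite !expr2 ler_pM.
  have dt : 0 <= t - 2 * pi * k%:R / n%:R <= 2 * pi / n%:R.
    move: k1 k2; rewrite ler_pdivlMr ?mulr_gt0// ltr_pdivrMr ?mulr_gt0// -natr1 => k1 k2.
    rewrite subr_ge0 ler_pdivrMr// lerBlDr -mulrDl ler_pdivlMr//.
    apply/andP; split; first by rewrite mulrC.
    by rewrite ltW// (lt_le_trans k2)// le_eqVlt; apply/orP; left; apply/eqP; ring.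
  have h2 : M * (t - 2 * pi * k%:R / n%:R) <= r.
    have /andP[d0 d1] := dt; rewrite (le_trans (ler_wpM2l (ltW M0) d1))//.
    move: n2; rewrite ltr_pdivrMr// => /ltW n2.
    by rewrite mulrA ler_pdivrMr// (mulrC r) (le_trans _ n2)// mulrC.
  have h3 : sin b * sin p * (2 * pi * k%:R / n%:R - t) ^+ 2 <= r ^+ 2.
    have /andP[d0 _] := dt.
    rewrite -sqrrN opprB; apply: (@le_trans _ _ ((M * (t - 2 * pi * k%:R / n%:R)) ^+ 2)).
      by rewrite exprMn ler_wpM2r ?sqr_ge0// expr2 ler_pM.
    by rewrite lerXn2r ?nnegrE ?mulr_ge0 ?(ltW M0) ?(ltW r0).
  rewrite exprMn (le_trans (lerD h1 h3))//.
  by have := sqr_ge0 r; move: (r ^+ 2) => u; lra.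
have sub : (mu (slab (cos b) (cos a)) <= \sum_(k < n.+1) mu (B k))%E.
  apply: content_subadditive => //.
  - by move=> k _; exact: measurable_dball.
  - exact: measurable_slab.
  - by rewrite -bigcup_mkord.
apply: (le_trans sub).
apply: (@le_trans _ _ (\sum_(k < n.+1) (K * (2 * r) ^+ 2)%:E)%E).
  by apply: lee_sum => k _; apply: growth; rewrite mulr_gt0.
rewrite sumEFin lee_fin sumr_const card_ord -[leLHS]mulr_natl -[n.+1%:R]natr1.
apply: (@le_trans _ _ ((2 * pi * M / r + 1 + 1) * (K * (2 * r) ^+ 2))).
  by rewrite ler_wpM2r ?lerD2r// mulr_ge0 ?sqr_ge0// ltW.
have -> : (2 * pi * M / r + 1 + 1) * (K * (2 * r) ^+ 2) =
    8 * pi * K * (r * sin b) + (8 * pi + 8) * K * r ^+ 2.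
  by rewrite /M; field; rewrite gt_eqF.
have -> : (24 * pi + 8) * K * r ^+ 2 = 8 * pi * K * (2 * r ^+ 2) + (8 * pi + 8) * K * r ^+ 2 by ring.
rewrite [leRHS]addrA; apply: lerD => //; rewrite -[leRHS]mulrDr.
by apply: ler_wpM2l => //; exact: mulr_ge0 (mulr_ge0 _ (ltW pi0)) (ltW K0).
Qed.

(** Cutting the ring into [n] rings divides the quadratic term by [n]. *)
Lemma slab_bound_angle (a b : R) : 0 <= a < b -> b <= pi ->
  (mu (slab (cos b) (cos a)) <= (8 * pi * K * (cos a - cos b))%:E)%E.
Proof.
move=> /andP[a0 ab] bpi; set r := b - a; have r0 : 0 < r by rewrite subr_gt0.
have pi0 : 0 < pi :> R := pi_gt0 R.
pose C := (24 * pi + 8) * K * r ^+ 2.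
have C0 : 0 <= C by exact: mulr_ge0 (mulr_ge0 (addr_ge0 (mulr_ge0 _ (ltW pi0)) _) (ltW K0)) (sqr_ge0 _).
have key n : (mu (slab (cos b) (cos a)) <= (8 * pi * K * (cos a - cos b) + C / n.+1%:R)%:E)%E.
  have n0 : 0 < n.+1%:R :> R by [].
  pose x (i : nat) : R := a + i%:R * (r / n.+1%:R).
  have x0 : x 0%N = a by rewrite /x mul0r addr0.
  have xn : x n.+1 = b by rewrite /x mulrC divfK ?gt_eqF// /r addrC subrK.
  have xS i : x i.+1 - x i = r / n.+1%:R by rewrite /x -natr1; ring.
  have xle i j : (i <= j)%N -> x i <= x j.
    by move=> ij; rewrite lerD2l ler_wpM2r ?ler_nat// divr_ge0 ?ltW.
  have ring1 i : (i <= n)%N -> (mu (slab (cos (x i.+1)) (cos (x i))) <=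
      (8 * pi * K * (cos (x i) - cos (x i.+1)) + C / n.+1%:R ^+ 2)%:E)%E.
    move=> ni; have xi0 : 0 <= x i by rewrite (le_trans a0)// -x0 xle.
    have xib : x i.+1 <= pi by rewrite (le_trans _ bpi)// -xn xle.
    have xii : x i < x i.+1 by rewrite -subr_gt0 xS divr_gt0.
    apply: (le_trans (ring_bound _ xib)); first by rewrite xi0.
    by rewrite lee_fin lerD2l xS expr_div_n mulrA.
  have step m : (m <= n)%N -> (mu (slab (cos (x m.+1)) (cos a)) <=
      (8 * pi * K * (cos a - cos (x m.+1)) + m.+1%:R * (C / n.+1%:R ^+ 2))%:E)%E.
    elim: m => [|m IH] mn; first by have := ring1 0%N (leq0n _); rewrite x0 mul1r.
    have sub : slab (cos (x m.+2)) (cos a) `<=`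
        slab (cos (x m.+2)) (cos (x m.+1)) `|` slab (cos (x m.+1)) (cos a).
      move=> y [yS /= /andP[h1 h2]]; have [h|h] := leP y.2 (cos (x m.+1)).
        by left; split => //=; rewrite h1.
      by right; split => //=; rewrite (ltW h).
    apply: (@le_trans _ _ (mu (slab (cos (x m.+2)) (cos (x m.+1)) `|` slab (cos (x m.+1)) (cos a)))).
      by apply: le_measure; rewrite ?inE//; [|apply: measurableU]; exact: measurable_slab.
    apply: (le_trans (measureU2 mu (measurable_slab _ _) (measurable_slab _ _))).
    apply: (le_trans (leeD (ring1 _ mn) (IH (ltnW mn)))).
    rewrite -EFinD lee_fin le_eqVlt; apply/orP; left; apply/eqP.
    by rewrite -[m.+2%:R]natr1; ring.
  have := step n (leqnn n); rewrite xn => h; apply: (le_trans h).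
  rewrite lee_fin lerD2l le_eqVlt; apply/orP; left; apply/eqP.
  by rewrite expr2; field; rewrite gt_eqF.
apply/lee_addgt0Pr => e e0.
pose n := Num.bound (C / e).
have : C / e < n.+1%:R.
  rewrite (lt_trans (archi_boundP _))// ?ltr_nat// divr_ge0// ltW//.
rewrite ltr_pdivrMr// => h.
apply: (le_trans (key n)); rewrite -EFinD lee_fin lerD2l ler_pdivrMr// mulrC ltW//.
Qed.

(** A slab outside the heights [[-1, 1]] meets the sphere at a pole at most, and is
    compared with a thin slab there. *)
Lemma slab_bound (c d : R) : c < d -> (mu (slab c d) <= (8 * pi * K * (d - c))%:E)%E.
Proof.
move=> cd; have pi0 : 0 < pi :> R := pi_gt0 R.
have k0 : 0 <= 8 * pi * K by rewrite !mulr_ge0// ltW.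
have inner u v : -1 <= u -> u < v -> v <= 1 -> (mu (slab u v) <= (8 * pi * K * (v - u))%:E)%E.
  move=> u1 uv v1.
  have hu : -1 <= u <= 1 by rewrite u1 (le_trans (ltW uv)).
  have hv : -1 <= v <= 1 by rewrite v1 (le_trans u1)// ltW.
  have cu : cos (acos u) = u by apply: acosK; rewrite in_itv.
  have cv : cos (acos v) = v by apply: acosK; rewrite in_itv.
  have h : acos v < acos u.
    by rewrite -ltr_cos ?in_itv /= ?acos_ge0 ?acos_lepi// cu cv.
  have := @slab_bound_angle (acos v) (acos u); rewrite cu cv; apply.
    by rewrite acos_ge0.
  exact: acos_lepi.
have heights y : S y -> -1 <= y.2 <= 1 by move=> /sphere_parallel[].
have mono A B r : (forall y, slab c d y -> slab A B y) ->
    (mu (slab A B) <= r%:E -> mu (slab c d) <= r%:E)%E.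
  move=> sub; apply: le_trans; apply: le_measure; rewrite ?inE//; exact: measurable_slab.
have le8 r : r <= d - c -> ((8 * pi * K * r)%:E <= (8 * pi * K * (d - c))%:E)%E.
  by move=> h; rewrite lee_fin ler_wpM2l.
have [d1|d1] := leP d (-1).
  pose e := Num.min 1 (d - c).
  have e0 : 0 < e by rewrite lt_min ltr01 subr_gt0.
  have e1 : e <= 1 by rewrite ge_min lexx.
  have ed : e <= d - c by rewrite ge_min lexx orbT.
  apply: (mono (-1) (-1 + e)).
    move=> y [yS /= /andP[h1 h2]]; split => //=; have /andP[-> _] := heights y yS.
    by rewrite (le_trans h2)// (le_trans d1)// lerDl ltW.
  have := inner (-1) (-1 + e); rewrite addrAC subrr add0r => h.
  apply: (le_trans (h _ _ _)) => //; [by rewrite ltrDl|lra|exact: le8].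
have [c1|c1] := leP 1 c.
  pose e := Num.min 1 (d - c).
  have e0 : 0 < e by rewrite lt_min ltr01 subr_gt0.
  have e1 : e <= 1 by rewrite ge_min lexx.
  have ed : e <= d - c by rewrite ge_min lexx orbT.
  apply: (mono (1 - e) 1).
    move=> y [yS /= /andP[h1 h2]]; split => //=; have /andP[_ ->] := heights y yS.
    by rewrite andbT (le_trans _ h1)// (le_trans _ c1)// lerBlDr lerDl ltW.
  have := inner (1 - e) 1; rewrite opprB addrCA subrr addr0 => h.
  apply: (le_trans (h _ _ _)) => //; [lra|lra|exact: le8].
apply: (mono (Num.max c (-1)) (Num.min d 1)).
  move=> y [yS /= /andP[h1 h2]]; split => //=; have /andP[h3 h4] := heights y yS.
  by rewrite ge_max le_min h1 h2 h3 h4.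
apply: (le_trans (inner _ _ _ _ _)).
- by rewrite le_max lexx orbT.
- rewrite gt_max !lt_min cd c1 d1 /=; lra.
- by rewrite ge_min lexx orbT.
- apply: le8; apply: lerB; [by rewrite ge_min lexx|by rewrite le_max lexx].
Qed.

(** Lebesgue outer measure is an infimum over covers by half-open intervals, to
    which the bound for slabs applies. *)
Lemma height_dominated (B : set (measurableTypeR R)) : measurable B ->
  (mu (S `&` [set y | B y.2]) <= (8 * pi * K)%:E * lebesgue_measure B)%E.
Proof.
move=> mB; have pi0 : 0 < pi :> R := pi_gt0 R.
have k0 : 0 < 8 * pi * K by rewrite !mulr_gt0.
have pre (A : set (measurableTypeR R)) : measurable A -> measurable (S `&` [set y : R3 | A y.2]).
  move=> mA; apply: measurableI; first exact: measurable_sphere.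
  by apply: (@meas_preimage _ R3 _ (measurableTypeR R) (fun y : R3 => y.2)) => //; meas.
rewrite -lee_pdivrMl//; apply: le_ereal_inf_tmp => _ [F [mF BF] <-].
rewrite lee_pdivrMl// -nneseriesZl; last first.
  by move=> i _; exact: wlength_ge0.
have mF' k : measurable (F k : set (measurableTypeR R)) by apply: sub_sigma_algebra.
apply: (@le_trans _ _ (\sum_(k <oo) mu (S `&` [set y | F k y.2]))%E).
  apply: measure_sigma_subadditive.
  - by move=> k; exact: pre.
  - exact: pre.
  - by move=> y [yS /BF[k _ Fk]]; exists k.
apply: lee_nneseries => // k _; have [[u v] _ /= <-] := mF k.
have [vu|uv] := leP v u.
  rewrite set_itv_ge ?bnd_simp -?leNgt//.
  rewrite (_ : _ `&` _ = set0) ?measure0; last by apply/seteqP; split => // y [].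
  by rewrite mule_ge0 ?wlength_ge0// lee_fin ltW.
rewrite wlength_itv_bnd ?(ltW uv)//= -EFinM.
apply: le_trans (slab_bound uv); apply: le_measure; rewrite ?inE//.
- exact: (pre _ (measurable_itv `]u, v])).
- exact: measurable_slab.
- by move=> y [yS /=]; rewrite in_itv /= => /andP[h1 h2]; split => //=; rewrite (ltW h1).
Qed.

End slabs.

Section height_density.
Context {R : realType}.
Local Open Scope ereal_scope.
Local Notation L := (@lebesgue_measure R).
Local Notation R3 := (R * R * R)%type.
Local Notation S := (@sphere R).
Local Notation T := (measurableTypeR R).

(** The Radon-Nikodym density is at most [k] almost everywhere; truncation makes
    the bound hold everywhere. *)
Lemma height_density (mu : probability R3 R) (k : R) : mu S = 1 -> (0 <= k)%R ->
  (forall B : set T, measurable B -> mu (S `&` [set y | B y.2]) <= k%:E * L B) ->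
  exists h : T -> R, [/\ measurable_fun setT h, forall t, (0 <= h t <= k)%R &
    forall H : T -> \bar R, measurable_fun setT H -> (forall t, 0 <= H t) ->
      \int[mu]_y H y.2 = \int[L]_t (H t * (h t)%:E)].
Proof.
move=> muS k0 dom; have meS := @measurable_sphere R.
have m2 : measurable_fun setT (fun y : R3 => y.2 : T) by exact: measurable_snd.
have [p [pA pI]] := pushforward_probability mu m2.
have pdom (B : set T) : measurable B -> p B <= k%:E * L B.
  move=> mB; rewrite pA//; apply: le_trans (dom B mB).
  have mpre : measurable ((fun y : R3 => y.2 : T) @^-1` B) by exact: meas_preimage.
  have mSB : measurable (S `&` [set y : R3 | B y.2]) by exact: measurableI.
  have mSC : measurable (~` S) by exact: measurableC.
  apply: (@le_trans _ _ (mu ((S `&` [set y : R3 | B y.2]) `|` ~` S))).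
    apply: le_measure; rewrite ?inE//; first exact: measurableU.
    by move=> y By; have [yS|yS] := pselect (S y); [left|right].
  apply: (le_trans (measureU2 mu mSB mSC)).
  have muSC : mu (~` S) = 0 := probability_setC0 meS muS.
  by rewrite [X in _ + X <= _](_ : _ = 0) ?adde0.
have pL : p `<< L.
  move=> N LN A mA AN; apply/eqP; rewrite eq_le measure_ge0 andbT.
  by rewrite (le_trans (pdom A mA))// (LN A mA AN) mule0.
have [g [g0 gfin gint gE]] := @radon_nikodym_sigma_finite _ T R L p pL.
have mg : measurable_fun setT g by case/integrableP : gint.
have mfg : measurable_fun setT (fun t => fine (g t)).
  by apply: (measurableT_comp _ mg).
have gfE t : g t = (fine (g t))%:E by rewrite fineK.
pose h t : R := Num.min (fine (g t)) k.
have mh : measurable_fun setT h.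
  by apply: measurable_minr.
have h0 t : (0 <= h t <= k)%R.
  by rewrite /h le_min k0 andbT fine_ge0// ge_min lexx orbT.
have neg : L.-negligible [set t | k%:E < g t].
  pose E n : set T := [set t | (k + n.+1%:R^-1)%:E <= g t].
  have mE n : measurable (E n).
    by rewrite -[E n]setTI; exact: emeasurable_fun_c_infty.
  apply: (@negligibleS _ _ _ L (\bigcup_n E n)); last first.
    apply: negligible_bigcup => n; exists (E n); split => //.
    have e0 : (0 < n.+1%:R^-1 :> R)%R by rewrite invr_gt0.
    have low : (k + n.+1%:R^-1)%:E * L (E n) <= k%:E * L (E n).
      apply: le_trans (pdom _ (mE n)); rewrite gE// -integral_cst//.
      apply: ge0_le_integral => //.
      - by move=> t _; rewrite lee_fin addr_ge0// ltW.
      - exact: measurable_funS mg.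
    have fin : L (E n) \is a fin_num.
      rewrite ge0_fin_numE//; have : (k + n.+1%:R^-1)%:E * L (E n) <= 1.
        apply: (@le_trans _ _ (p (E n))); last exact: probability_le1.
        rewrite gE// -integral_cst//; apply: ge0_le_integral => //.
        - by move=> t _; rewrite lee_fin addr_ge0// ltW.
        - exact: measurable_funS mg.
      case: (L (E n)) => [r||]//.
      - by move=> _; rewrite ltry.
      - by rewrite gt0_muley// lte_fin ltr_wpDl.
    have Lv : L (E n) = (fine (L (E n)))%:E by rewrite fineK.
    move: low; rewrite -(fineK fin) -!EFinM lee_fin mulrDl gerDl.
    rewrite pmulr_rle0// => l0; apply: etrans Lv _; congr (_%:E); apply/eqP.
    by rewrite eq_le l0 fine_ge0.
  move=> t /= kg; have kg' : (k < fine (g t))%R by rewrite -lte_fin -gfE.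
  exists (Num.bound (fine (g t) - k)^-1) => //=; rewrite /E /= gfE lee_fin -lerBrDl.
  have d0 : (0 < fine (g t) - k)%R by rewrite subr_gt0.
  rewrite invf_ple ?posrE//; rewrite (le_trans (ltW (archi_boundP _)))// ?invr_ge0 ?ltW//.
  by rewrite ltr_nat.
have hE (A : set T) : measurable A -> p A = \int[L]_(t in A) (h t)%:E.
  move=> mA; rewrite gE//; apply: ge0_ae_eq_integral => //.
  - exact: measurable_funS mg.
  - by apply/measurable_EFinP; exact: measurable_funS mh.
  - by move=> t _; rewrite lee_fin; have /andP[] := h0 t.
  - apply: negligibleS neg => t /= /not_implyP[_ ne]; rewrite gfE lte_fin ltNge.
    by apply/negP => le; apply: ne; rewrite /h min_l// -gfE.
exists h; split => // H mH H0; rewrite -pI//.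
have h0' t : (0 <= h t)%R by have /andP[] := h0 t.
have [m' [m'E im']] := @image_density_measure _ _ T T R L h id mh h0' (@measurable_id _ T setT).
rewrite -im'//; apply: eq_measure_integral => A mA _.
by apply: etrans (hE A mA) _; rewrite m'E /image_density preimage_id.
Qed.

End height_density.

(** * The density in polar coordinates *)
Section conclusion.
Context {R : realType}.
Local Open Scope ereal_scope.
Local Notation L := (@lebesgue_measure R).
Local Notation R3 := (R * R * R)%type.
Local Notation S := (@sphere R).
Local Notation T := (measurableTypeR R).

Variables (mu : probability R3 R) (alpha k : R) (h : T -> R).
Hypothesis (alpha0 : (0 < alpha <= pi)%R).
Hypotheses (muS : mu S = 1) (mucap : mu (south_cap alpha) = 1).
Hypothesis mrot : axially_symmetric mu.
Hypotheses (mh : measurable_fun setT h) (h0 : forall t, (0 <= h t <= k)%R).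
Hypothesis hI : forall H : T -> \bar R, measurable_fun setT H -> (forall t, 0 <= H t) ->
  \int[mu]_y H y.2 = \int[L]_t (H t * (h t)%:E).

Lemma measurable_south_cap : measurable (@south_cap R alpha).
Proof.
rewrite -[south_cap _]setCK; apply: measurableC; apply: open_measurable3.
apply: closed_openC; apply: compact_closed; last exact: compact_south_cap.
exact: norm_hausdorff.
Qed.

Let I : set T := `[(-1)%R, cos alpha]%classic.

(** The cap has no heights above [cos alpha], so that the indicator of [I] may be
    inserted; it confines the polar integral to [[alpha, pi]]. *)
Lemma height_formula A : measurable A -> (2 * pi)%:E * mu A =
  \int[L]_(t in `[(-1)%R, 1%R]) (parallel_length A t * (\1_I t * h t)%:E).
Proof.
move=> mA; rewrite (disintegration muS mrot mA).
have mI : measurable I by exact: measurable_itv.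
have m1 : measurable_fun setT (fun t : T => (\1_I t)%:E : \bar R).
  by apply/measurable_EFinP; exact: measurable_indic.
have mP : measurable_fun setT (parallel_length A : T -> \bar R) := measurable_parallel_length mA.
have P0 t : 0 <= parallel_length A t := parallel_length_ge0 A t.
pose H (t : T) : \bar R := parallel_length A t * (\1_I t)%:E.
have mH : measurable_fun setT H by exact: emeasurable_funM.
have H0 t : 0 <= H t by rewrite mule_ge0// lee_fin.
have m2 : measurable_fun setT (fun y : R3 => y.2 : T) by exact: measurable_snd.
transitivity (\int[mu]_y H y.2).
  apply: (@eq_integral_on _ _ _ mu (south_cap alpha)) => //.
  - exact: measurable_south_cap.
  - exact: (measurableT_comp mP m2).
  - exact: (measurableT_comp mH m2).
  move=> y [t [p [_ /andP[p1 p2] ->]]]; rewrite /H /spherical /= mul1r indicE mem_set ?mule1//.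
  have /andP[a0 a1] := alpha0.
  rewrite /I /= in_itv /= cos_geN1 /=; rewrite leNgt ltr_cos -?leNgt// in_itv /=.
    by rewrite p2 (le_trans (ltW a0)).
  by rewrite (ltW a0).
rewrite hI// [RHS]integral_mkcond; apply: eq_integral => t _; rewrite patchE /H indicE.
case: ifPn => tI.
  by rewrite -muleA -EFinM.
rewrite memNset ?mule0 ?mul0e// /I /= in_itv /= => /andP[t1 t2].
move: tI; rewrite notin_setE /= in_itv /= t1 (le_trans t2)//.
Qed.

Lemma dominated_by_surface : mu `<< @surface_measure R.
Proof.
move=> N surf A mA AN; have := height_formula mA.
have mP : measurable_fun setT (parallel_length A : T -> \bar R) := measurable_parallel_length mA.
have P0 t : 0 <= parallel_length A t := parallel_length_ge0 A t.
have mI : measurable I by exact: measurable_itv.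
have k0 : (0 <= k)%R by have /andP[h1 h2] := h0 0%R; exact: le_trans h1 h2.
have : \int[L]_(t in `[(-1)%R, 1%R]) (parallel_length A t * (\1_I t * h t)%:E) <= 0.
  apply: (@le_trans _ _ (\int[L]_(t in `[(-1)%R, 1%R]) (k%:E * parallel_length A t))).
    apply: ge0_le_integral => //.
    - by move=> t _; rewrite mule_ge0// lee_fin mulr_ge0//; have /andP[] := h0 t.
    - apply: (@measurable_funS _ _ _ _ setT) => //; apply: emeasurable_funM => //.
      by apply/measurable_EFinP; apply: measurable_funM => //; exact: measurable_indic.
    - by apply: measurable_funeM; exact: measurable_funS mP.
    - move=> t _; rewrite muleC lee_wpmul2r// lee_fin.
      have /andP[h1 h2] := h0 t; rewrite indicE; case: (t \in I); first by rewrite mul1r.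
      by rewrite mul0r.
  rewrite ge0_integralZl//; last exact: measurable_funS mP.
  by rewrite -surface_measureE// (surf A mA AN) mule0.
move=> le0 E; have pi0 : (0 < 2 * pi :> R)%R by rewrite mulr_gt0// pi_gt0.
move: le0; rewrite -E; have : mu A \is a fin_num by exact: fin_num_measure.
have : 0 <= mu A by exact: measure_ge0.
case: (mu A) => [r||]// r0 _.
rewrite -EFinM lee_fin pmulr_rle0// => rle; congr (_%:E); apply/eqP.
by rewrite eq_le rle -lee_fin.
Qed.

Definition polar_density (phi : R) : R := (h (cos phi) / (2 * pi))%R.

Lemma polar_density_bounded :
  polar_density \in Lfun (mrestr lebesgue_measure (measurable_itv `[alpha, pi])) +oo%E.
Proof.
have pi0 : (0 < 2 * pi :> R)%R by rewrite mulr_gt0// pi_gt0.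
have k0 : (0 <= k)%R by have /andP[h1 h2] := h0 0%R; exact: le_trans h1 h2.
rewrite inE; apply/andP; split; rewrite inE /=.
  rewrite /polar_density; apply: measurable_funM => //.
  exact: (measurableT_comp mh measurable_cos).
rewrite /finite_norm unlock /=; case: ifP => // _.
apply: (@le_lt_trans _ _ (k / (2 * pi))%:E); last exact: ltry.
apply/ess_sup_inf.ess_supP; apply: aeW => phi /=; rewrite lee_fin.
have /andP[h1 h2] := h0 (cos phi).
by rewrite ger0_norm ?divr_ge0 ?(ltW pi0)// ler_pM2r// invr_gt0.
Qed.

(** The substitution [t = cos phi] in [height_formula]. *)
Lemma polar_formula A : measurable A ->
  mu A = \int[L]_(phi in `[alpha, pi]) \int[L]_(theta in `[0%R, (2 * pi)%R])
     (\1_A (spherical 1 theta phi) * (polar_density phi * sin phi))%:E.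
Proof.
move=> mA; have /andP[a0 api] := alpha0.
have pi0 : (0 < 2 * pi :> R)%R by rewrite mulr_gt0// pi_gt0.
have mI : measurable I by exact: measurable_itv.
have mP : measurable_fun setT (parallel_length A : T -> \bar R) := measurable_parallel_length mA.
have P0 t : 0 <= parallel_length A t := parallel_length_ge0 A t.
have mc : measurable_fun setT (cos : T -> T) by exact: measurable_cos.
have h00 t : (0 <= h t)%R by have /andP[] := h0 t.
have s0 phi : (alpha <= phi <= pi)%R -> (0 <= sin phi)%R.
  by move=> /andP[p1 p2]; apply: sin_ge0_pi; rewrite p2 (le_trans (ltW a0)).
have mPc : measurable_fun setT (fun phi : T => parallel_length A (cos phi)).
  exact: (measurableT_comp mP mc).
have md : measurable_fun setT (fun phi : T => (polar_density phi * sin phi)%:E : \bar R).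
  apply/measurable_EFinP; apply: measurable_funM; last exact: measurable_sin.
  by apply: measurable_funM => //; exact: (measurableT_comp mh mc).
have -> : \int[L]_(phi in `[alpha, pi]) \int[L]_(theta in `[0%R, (2 * pi)%R])
     (\1_A (spherical 1 theta phi) * (polar_density phi * sin phi))%:E =
   \int[L]_(phi in `[alpha, pi]) (parallel_length A (cos phi) * (polar_density phi * sin phi)%:E).
  apply: eq_integral => phi; rewrite inE /= in_itv /= => hphi.
  have sphi := s0 _ hphi.
  have E : (Num.sqrt (1 - cos phi ^+ 2) = sin phi)%R by rewrite -sin2cos2 sqrtr_sqr ger0_norm.
  have pE y : parallel_point (cos phi) y = spherical 1 y phi.
    by rewrite /parallel_point /spherical E !mul1r.
  rewrite /parallel_length -ge0_integralZr//; last 2 first.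
  - apply/measurable_EFinP; apply: (@measurable_funS _ _ _ _ setT) => //.
    have mIA : measurable_fun setT (\1_A : R3 -> R) by exact: measurable_indic.
    apply: (measurableT_comp mIA).
    apply: (measurableT_comp measurable_parallel_point
      (_ : measurable_fun setT (fun y : R => (cos phi, y)))); meas.
  - by rewrite lee_fin mulr_ge0// divr_ge0// ltW.
  by apply: eq_integral => y _; rewrite pE EFinM.
have key : (2 * pi)%:E * mu A = (2 * pi)%:E *
    \int[L]_(phi in `[alpha, pi]) (parallel_length A (cos phi) * (polar_density phi * sin phi)%:E).
  rewrite -ge0_integralZl//; last 3 first.
  - by apply: (@measurable_funS _ _ _ _ setT) => //; exact: emeasurable_funM.
  - move=> phi /=; rewrite in_itv /= => hphi.
    by rewrite mule_ge0// lee_fin mulr_ge0 ?s0// divr_ge0// ltW.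
  - by rewrite lee_fin ltW.
  rewrite height_formula// cos_substitution; last 2 first.
  - apply: emeasurable_funM => //; apply/measurable_EFinP; apply: measurable_funM => //.
  - by move=> t; rewrite mule_ge0// lee_fin mulr_ge0.
  rewrite [LHS]integral_mkcond [RHS]integral_mkcond; apply: eq_integral => phi _.
  rewrite !patchE; case: ifPn => [|p1]; last first.
    case: ifPn => // p2; exfalso; move: p1 p2; rewrite notin_setE inE /= !in_itv /=.
    by move=> p1 /andP[p2 p3]; apply: p1; rewrite p3 (le_trans (ltW a0)).
  rewrite inE /= in_itv /= => /andP[p0 ppi].
  have cE : (cos phi <= cos alpha)%R = (alpha <= phi)%R.
    by rewrite leNgt ltr_cos -?leNgt// in_itv /= ?p0 ?ppi// (ltW a0).
  case: ifPn => p2.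
    move: p2; rewrite inE /= in_itv /= => /andP[p2 _].
    rewrite indicE mem_set; last by rewrite /I /= in_itv /= cos_geN1 cE.
    rewrite mul1r -muleA -EFinM muleCA -EFinM; congr (_ * _%:E).
    by rewrite /polar_density mulrA (mulrC (2 * pi)%R) divfK ?gt_eqF.
  rewrite indicE memNset ?mul0r ?mule0 ?mul0e//.
  move: p2; rewrite notin_setE /I /= !in_itv /= cos_geN1 cE ppi andbT //.
have fin : mu A \is a fin_num by exact: fin_num_measure.
have cancel_ (x : \bar R) : x = (2 * pi)^-1%:E * ((2 * pi)%:E * x).
  by rewrite muleA -EFinM mulVf ?mul1e// gt_eqF.
by rewrite [LHS]cancel_ [RHS]cancel_ key.
Qed.

End conclusion.

Theorem theorem1p2 (R : realType) (Q : R * R * R -> \bar R)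
  (mu : probability (R * R * R)%type R) (alpha : R) (N : set (R * R * R))
  (hQ : external_field Q)
  (hrot : rotationally_invariant Q)
  (hmu : extremal_measure Q mu)
  (halpha : 0 < alpha <= pi)
  (hsupp : measure_support mu = south_cap alpha)
  (hN : open_in_sphere N)
  (hcapN : south_cap alpha `<=` N)
  (hC2 : C2_on_sphere N Q) :
  mu `<< @surface_measure R /\
  exists2 f : R -> R,
    f \in Lfun (mrestr lebesgue_measure (measurable_itv `[alpha, pi])) +oo%E &
    forall A : set (R * R * R), measurable A ->
      mu A = (\int[lebesgue_measure]_(phi in `[alpha, pi])
                \int[lebesgue_measure]_(theta in `[0%R, (2 * pi)%R])
                  (\1_A (spherical 1 theta phi) * (f phi * sin phi))%:E)%E.
Proof.
have [Q0 lscQ _] := hQ; have [muS _] := hmu.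
have mQ := lsc_measurable lscQ.
have mufin := finite_weighted_energy hQ hmu.
have [sb [sbU _]] := @uniform_sphere R.
have mcap := @measurable_south_cap R alpha.
have capS : south_cap alpha `<=` @sphere R.
  by move=> x [t [p [_ _ ->]]]; exact: spherical_sphere.
have cap0 : mu (~` south_cap alpha) = 0%E by rewrite -hsupp support_null.
have cap1 : mu (south_cap alpha) = 1%E.
  by rewrite -[south_cap alpha]setCK probability_setC ?cap0 ?sube0//; exact: measurableC.
have capneg : mu.-negligible (~` south_cap alpha).
  by exists (~` south_cap alpha); split => //; exact: measurableC.
have [C C0 sd] := second_difference_cap hN hcapN hC2.
have [K K0 growth] := ball_growth sbU Q0 mQ hmu mufin C0 capS capneg (fun x cx y => sd x y cx).
have rot := extremal_rotation Q0 mQ hmu mufin hrot.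
have k0 : 0 <= 8 * pi * K by rewrite !mulr_ge0 ?pi_ge0// ltW.
have [h [mh h0 hI]] := height_density muS k0 (height_dominated K0 growth).
split; first exact: (dominated_by_surface halpha muS cap1 rot mh h0 hI).
exists (polar_density h); first exact: (polar_density_bounded _ mh h0).
by move=> A mA; exact: (polar_formula halpha muS cap1 rot mh h0 hI).
Qed.
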